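(* Let $d\ge 2$ and let $A$ be a $d$-dimensional polystochastic matrix of order $4$ with $\operatorname{per} A=0$. Then $d$ is odd, and $A$ is equivalent either to $\mathcal{M}_4^d$ or to some matrix from the family $\mathcal{L}_4^d$.
   Context: A $d$-dimensional matrix of order $n$ is an array $A=(a_\alpha)_{\alpha\in I_n^d}$ with real entries, where $I_n^d=\{0,\dots,n-1\}^d$. A line is a set of $n$ indices obtained by fixing all coordinates except one and letting the remaining one range over $\{0,\dots,n-1\}$; a hyperplane of direction $i$ is obtained by fixing coordinate $i$. $A$ is polystochastic if all entries are nonnegative and the entries along every line sum to $1$. A diagonal is a set of $n$ indices $\{\alpha^1,\dots,\alpha^n\}$ such that any two of them differ in every coordinate; the permanent is $\operatorname{per}A=\sum_{p}\prod_{\alpha\in p}a_\alpha$, the sum over all diagonals $p$. Two matrices are equivalent if one is obtained from the other by permuting the coordinate positions of indices and/or permuting the hyperplanes of a fixed direction (i.e. applying a permutation of $\{0,\dots,n-1\}$ to one coordinate), possibly repeatedly. $\mathcal{M}_n^d$ is the $d$-dimensional $(0,1)$-matrix of order $n$ with $m_\alpha=1$ iff $\alpha_1+\dots+\alpha_d\equiv 0 \pmod n$. $\mathcal{L}_n^d$ is the family of matrices $\lambda\mathcal{M}_n^d+(1-\lambda)M$ with $0<\lambda<1$, where $M$ is the $(0,1)$-matrix whose support is $\{\alpha:\alpha_1+\dots+\alpha_{d-1}+\pi(\alpha_d)\equiv 0\pmod n\}$ and $\pi$ is the transposition of $0$ and $1$. *)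

(* Defs.v *)
From HB Require Import structures.
From mathcomp Require Import all_boot all_order all_algebra all_fingroup.
From mathcomp Require Import reals.
From Stdlib Require Import Relations.
Set Implicit Arguments. Unset Strict Implicit. Unset Printing Implicit Defensive.
Import Order.TTheory GRing.Theory Num.Theory.
Local Open Scope ring_scope.

Definition idx (d n : nat) := {ffun 'I_d -> 'I_n}.

Definition dmatrix (R : realType) (d n : nat) := idx d n -> R.

Definition upd (d n : nat) (a : idx d n) (i : 'I_d) (k : 'I_n) : idx d n :=
  [ffun j => if j == i then k else a j].

Definition polystochastic (R : realType) (d n : nat) (A : dmatrix R d n) : Prop :=
  (forall a, 0 <= A a) /\
  (forall (i : 'I_d) (a : idx d n), \sum_(k < n) A (upd a i k) = 1).

Definition diagonal (d n : nat) (p : {set idx d n}) : bool :=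
  (#|p| == n) &&
  [forall a in p, forall b in p, (a != b) ==> [forall j, a j != b j]].

Definition per (R : realType) (d n : nat) (A : dmatrix R d n) : R :=
  \sum_(p : {set idx d n} | diagonal p) \prod_(a in p) A a.

Definition coord_perm_step (R : realType) (d n : nat) (A B : dmatrix R d n) : Prop :=
  exists s : 'S_d, forall a : idx d n, B a = A [ffun j => a (s j)].

Definition hyper_perm_step (R : realType) (d n : nat) (A B : dmatrix R d n) : Prop :=
  exists (i : 'I_d) (t : 'S_n), forall a : idx d n, B a = A (upd a i (t (a i))).

Definition equiv_step (R : realType) (d n : nat) (A B : dmatrix R d n) : Prop :=
  coord_perm_step A B \/ hyper_perm_step A B.

Definition equivalent (R : realType) (d n : nat) (A B : dmatrix R d n) : Prop :=
  clos_refl_trans (dmatrix R d n) (@equiv_step R d n) A B.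

Definition Mmat (R : realType) (d n : nat) : dmatrix R d n :=
  fun a => if ((\sum_(j < d) (a j : nat)) %% n)%N == 0%N then 1 else 0.

Definition pi01 (x : nat) : nat :=
  if x == 0%N then 1%N else if x == 1%N then 0%N else x.

Definition Mpi (R : realType) (d n : nat) : dmatrix R d n :=
  fun a => if ((\sum_(j < d) (if val j == d.-1 then pi01 (a j) else (a j : nat)))
                 %% n)%N == 0%N then 1 else 0.

Definition Lmat (R : realType) (d n : nat) (l : R) : dmatrix R d n :=
  fun a => l * @Mmat R d n a + (1 - l) * @Mpi R d n a.

(* Main.v *)
From Stdlib Require Import NArith Relations.
Require Import Defs.
From HB Require Import structures.
From mathcomp Require Import all_boot all_order all_algebra all_fingroup.
From mathcomp Require Import reals.
From mathcomp Require Import zify ring lra.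
From mathcomp Require boolp.
Set Implicit Arguments. Unset Strict Implicit. Unset Printing Implicit Defensive.
Import Order.TTheory GRing.Theory Num.Theory.

(** For a set X of free coordinates (the others being fixed) call the restriction of the matrix zero if it
    has no positive diagonal.  By induction on #|X|, a zero restriction has odd #|X| and, after relabelling
    each coordinate by Z/4, is supported on {t = y or t = pi y}, where y is one special coordinate, t the sum
    of the others and pi the transposition of 0 and 1; the line sums then force the weights l and 1 - l.

    If fixing two coordinates a, b of X leaves a restriction with a positive diagonal, the four (a, b)-planes
    along it share a positive cell.  By Birkhoff's theorem this cell lies on positive permutations of each
    plane, and these are u, u, v, v in some order with u^-1 v a 3-cycle.  Adding one coordinate, a finite
    search shows that the four 3-dimensional blocks are supported on {t - c_k = y or t - c_k = pi y} with
    c_0 + ... + c_3 = 0 (or are of a type based on Z/2 x Z/2, or sporadic).  Another search, in one more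
    dimension, shows that moving along a further coordinate changes c_k by psi e - psi k for one permutation
    psi.  Hence the shift c is an additive function of the remaining coordinates, which gives the shape of
    the support, and the relation on the sum of the c_k gives the parity; the Z/2 x Z/2 type cannot travel
    consistently.

    Otherwise all restrictions with two coordinates less are zero, hence of the known shape.  An entry
    strictly between 0 and 1 would make the special coordinates of these restrictions the centres of
    incompatible stars, so all entries are 0 or 1 and every such restriction is the table of a sum in Z/4.
    For #|X| >= 7 these tables overlap enough to be glued; #|X| = 5 is a finite search.

    In the searches an array is seen through the sets of permutations supported by its 2-dimensional
    slices. *)

(** * Constraint propagation on positive permutations *)

(** A zero restriction has an odd number of free coordinates, so fixing one more coordinate always
    leaves a positive diagonal and nothing to induct on; this is why two coordinates are fixed at a
    time. The weights [l] and [1 - l] form a continuum, so no finite search can handle the entries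
    themselves. The searches see positivity only: by Birkhoff's theorem a cell of a doubly
    stochastic slice is positive exactly when it lies on a positive permutation, so the support of a
    slice is encoded by a subset of the 24 permutations of four elements. A positive diagonal of the
    array is then a rainbow: four slices on a diagonal of the index space, a positive permutation in
    each, and distinct rows meeting distinct columns. The parity has an arithmetic source: along a
    diagonal every coordinate outside the block contributes 0 + 1 + 2 + 3 = 2 to the sum of the
    shifts, and this sum vanishes modulo 4. *)

Definition perms4 : seq (seq nat) := Eval vm_compute in
  [seq p <- [seq [:: p.1; p.2; q.1; q.2] | p <- allpairs pair (iota 0 4) (iota 0 4),
                                           q <- allpairs pair (iota 0 4) (iota 0 4)] | uniq p].
(** Permutations are named by their place in the lexicographic order: 0 is the identity, 0 to 5 are
    those fixing 0, 3 is a 3-cycle and 9 is x + 1. All tables below use these indices. *)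
Definition papp (t x : nat) : nat := nth 0 (nth [::] perms4 t) x.

Definition cell (x y : nat) : N := N.of_nat (4 * x + y).
Definition mask_of (p : seq nat) : N :=
  foldr (fun x m => N.lor (N.shiftl 1 (cell x (nth 0 p x))) m) 0%num (iota 0 4).
Definition perm_masks : seq N := Eval vm_compute in map mask_of perms4.
Definition perm_mask (t : nat) : N := nth 0%num perm_masks t.

(* The cells (x, y) such that, for slices with permutations a, b, c in three rows of a diagonal, a fourth
   slice positive at (x, y) would complete a positive diagonal; 6 = 0 + 1 + 2 + 3. *)
Definition rainbow_cell (a b c r : seq nat) : N :=
  let x := nth 0 a (nth 0 r 0) in
  let y := nth 0 b (nth 0 r 1) in
  let z := nth 0 c (nth 0 r 2) in
  if (x == y) || (x == z) || (y == z) then 0%num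
  else N.shiftl 1 (cell (nth 0 r 3) (6 - (x + y + z))).
Definition rainbow_mask (a b c : seq nat) : N :=
  foldr (fun r m => N.lor (rainbow_cell a b c r) m) 0%num perms4.
Definition rainbow_table : seq (seq (seq N)) := Eval vm_compute in
  [seq [seq [seq rainbow_mask a b c | c <- perms4] | b <- perms4] | a <- perms4].
Definition rainbow_get a b c := nth 0%num (nth [::] (nth [::] rainbow_table a) b) c.

(* One 2-dimensional slice W: [cands] contains all permutations (indices in [perms4]) supported by W,
   [present] consists of some of them; [covered] and [forced] are the union and the intersection of the
   masks of [cands], a cell (x, y) being bit 4 x + y. *)
Record entry := Ent { cands : seq nat; covered : N; forced : N; present : seq nat }.
Definition mk_entry (l p : seq nat) : entry :=
  Ent l (foldr (fun t m => N.lor (perm_mask t) m) 0%num l)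
        (foldr (fun t m => N.land (perm_mask t) m) 65535%num l) p.
Definition entry0 := mk_entry [::] [::].
Definition full_entry := Eval vm_compute in mk_entry (iota 0 24) [::].
Definition mcompl (m : N) : N := N.ldiff 65535 m.
Definition is0 (m : N) : bool := if m is N0 then true else false.
Definition dead (e : entry) : bool := nilp (cands e) || ~~ all (fun t => t \in cands e) (present e).
Definition forbid (q : N) (e : entry) : entry :=
  if is0 (N.land q (covered e)) then e
  else mk_entry [seq t <- cands e | is0 (N.land (perm_mask t) q)] (present e).
Definition require (q : N) (e : entry) : entry :=
  mk_entry [seq t <- cands e | is0 (N.ldiff q (perm_mask t))] (present e).

Definition state := seq entry.
Definition gete (s : state) i := nth entry0 s i.
Fixpoint sete (s : state) (i : nat) (e : entry) : state :=
  match s, i with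
  | [::], _ => [::]
  | _ :: s', 0 => e :: s'
  | x :: s', i'.+1 => x :: sete s' i' e
  end.

Section Run.
Variable tuples : seq (seq (nat * nat * nat)).
Variable lines : seq (nat * nat * nat * nat).
Variable rels : seq (nat -> nat -> nat -> bool).

Definition qjoin (t : nat) (pu pv : seq nat) : N :=
  foldr (fun a m => foldr (fun b m => N.lor (rainbow_get t a b) m) m pv) 0%num pu.
Definition forbid_rainbow (t u v w : nat) (s : state) : state :=
  match present (gete s u), present (gete s v) with
  | [::], _ => s
  | _, [::] => s
  | pu, pv => let e := gete s w in let q := qjoin t pu pv in
     if is0 (N.land q (covered e)) then s else sete s w (forbid q e)
  end.
Definition mark_present (s : state) (e t : nat) : state :=
  let x := gete s e in
  if t \in present x then s else
  let s := sete s e (Ent (cands x) (covered x) (forced x) (t :: present x)) in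
  foldl (fun s (o : nat * nat * nat) => let: (u, v, w) := o in
    forbid_rainbow t u v w (forbid_rainbow t u w v (forbid_rainbow t v w u s))) s (nth [::] tuples e).

Definition lfix (once : N) (e : entry) (o1 o2 o3 : N) : entry * bool :=
  let q1 := N.land once (covered e) in
  let q2 := N.land (N.lor o1 (N.lor o2 o3)) (covered e) in
  if is0 q2 && is0 (N.ldiff q1 (forced e)) then (e, false) else (forbid q2 (require q1 e), true).

(* The four slices of a line add up to the all-one matrix: each cell is covered, a cell covered by only one
   of them is 1 there, and a cell contained in all permutations of one of them is 0 in the others. *)
Definition line_step (s : state) (o : nat * nat * nat * nat) : option (state * bool) :=
  let: (i0, i1, i2, i3) := o in
  let e0 := gete s i0 in let e1 := gete s i1 in let e2 := gete s i2 in let e3 := gete s i3 in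
  let u01 := N.lor (covered e0) (covered e1) in let u23 := N.lor (covered e2) (covered e3) in
  if ~~ is0 (mcompl (N.lor u01 u23)) then None else
  let tw := N.lor (N.lor (N.land (covered e0) (covered e1)) (N.land (covered e2) (covered e3))) (N.land u01
    u23) in
  let once := mcompl tw in
  let: (f0, b0) := lfix once e0 (forced e1) (forced e2) (forced e3) in
  let: (f1, b1) := lfix once e1 (forced e0) (forced e2) (forced e3) in
  let: (f2, b2) := lfix once e2 (forced e0) (forced e1) (forced e3) in
  let: (f3, b3) := lfix once e3 (forced e0) (forced e1) (forced e2) in
  if [|| b0, b1, b2 | b3] then
    Some (sete (sete (sete (sete s i0 f0) i1 f1) i2 f2) i3 f3, true)
  else Some (s, false).

Fixpoint lines_step (ls : seq (nat * nat * nat * nat)) (s : state) (b : bool) : option (state * bool) :=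
  match ls with
  | [::] => Some (s, b)
  | o :: ls' => match line_step s o with None => None | Some (s', b') => lines_step ls' s' (b || b') end
  end.

(** Every slice has a positive permutation, so a single remaining candidate is present. *)
Definition mark_singletons (s : state) : state * bool :=
  foldl (fun (sb : state * bool) i => let: (s, b) := sb in
    match gete s i with
    | Ent [:: t] _ _ [::] => (mark_present s i t, true)
    | _ => (s, b) end) (s, false) (iota 0 (size s)).

(** Running out of fuel is harmless: every intermediate state is a valid description of the array,
    only less precise. *)
Fixpoint propagate (n : nat) (s : state) : option state :=
  match n with 0 => Some s | n'.+1 =>
    if has dead s then None else
    match lines_step lines s false with
    | None => None
    | Some (s, b) => let: (s, b') := mark_singletons s in
       if b || b' then propagate n' s else Some s
    end
  end.

Definition leafok (i : nat) (s : state) : bool :=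
  (i < size rels) && all (fun e => all (fun t => all (fun x =>
     nth (fun _ _ _ => false) rels i e x (papp t x)) (iota 0 4)) (cands (gete s e))) (iota 0 (size s)).

(* Branch on the first permutation of [l] that is present; last branch: only those of [pp] are. *)
Section Branch.
Variables (go : state -> seq nat -> option (seq nat)) (s : state) (e : nat) (px pp : seq nat).
Fixpoint branch (l scr : seq nat) : option (seq nat) :=
  match l with
  | [::] => if pp is [::] then Some scr else go (sete s e (mk_entry pp px)) scr
  | t :: l' =>
    match go (mark_present (sete s e (mk_entry (l ++ pp) px)) e t) scr with
    | None => None
    | Some scr => branch l' scr
    end
  end.
End Branch.

(* The script gives the slice to branch on, or 99 i at a leaf where all candidates satisfy relation i;
   branches closed by propagation consume nothing. *)
Fixpoint run (fuel : nat) (s : state) (scr : seq nat) : option (seq nat) :=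
  match fuel with 0 => None | n.+1 =>
  match propagate 30 s with
  | None => Some scr
  | Some s =>
    match scr with
    | [::] => None
    | e :: scr =>
      if e == 99 then
        match scr with [::] => None | i :: scr => if leafok i s then Some scr else None end
      else if ~~ (e < size s) then None else
      let x := gete s e in
      let px := present x in
      branch (run n) s e px [seq t <- cands x | t \in px] [seq t <- cands x | t \notin px] scr
    end
  end end.

Definition search (n : nat) (init : seq (nat * seq nat * seq nat)) (scr : seq nat) : bool :=
  let s := foldl (fun s (p : nat * seq nat * seq nat) =>
    sete s p.1.1 (mk_entry p.1.2 [::])) (nseq n full_entry) init in
  isSome (run 60 (foldl (fun s (p : nat * seq nat * seq nat) => foldl (fun s t =>
    mark_present s p.1.1 t) s p.2) s init) scr).

(** * Soundness of propagation and branching *)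

Section Sound.
Variable F : nat -> nat -> bool.
Local Notation T := N.testbit.

(* [F e t]: slice e supports permutation t. *)
Record model (n : nat) : Prop := Model {
  mod_ne : forall e, e < n -> exists t, F e t;
  mod_dom : forall e t, F e t -> t < 24;
  mod_tup : forall e u v w t a b c, (u, v, w) \in nth [::] tuples e ->
     F e t -> F u a -> F v b -> F w c ->
     [/\ N.land (perm_mask c) (rainbow_get t a b) = 0%num, N.land (perm_mask b) (rainbow_get t a c) = 0%num
       & N.land (perm_mask a) (rainbow_get t b c) = 0%num];
  mod_line : forall i0 i1 i2 i3, (i0, i1, i2, i3) \in lines ->
     let s := [:: i0; i1; i2; i3] in
     [/\ uniq s,
         forall c, T 65535 c -> exists2 j, j \in s & exists2 t, F j t & T (perm_mask t) c,
         forall j c, T 65535 c -> j \in s -> (forall j' t, j' \in s -> j' != j -> F j' t ->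
           ~~ T (perm_mask t) c) ->
            forall t, F j t -> T (perm_mask t) c
       & forall j j' c, j \in s -> j' \in s -> j' != j -> (forall t, F j t -> T (perm_mask t) c) ->
            forall t, F j' t -> ~~ T (perm_mask t) c] }.

Variable n : nat.
Hypothesis mF : model n.

Definition okent (e : nat) (x : entry) : Prop :=
  [/\ forall t, F e t -> t \in cands x,
      forall t, t \in present x -> F e t,
      forall t c, t \in cands x -> T (perm_mask t) c -> T (covered x) c
    & forall t c, t \in cands x -> T (forced x) c -> T (perm_mask t) c].
Definition Inv (s : state) : Prop := size s = n /\ forall e, okent e (gete s e).

Lemma isz_eq m : is0 m = (m == 0%num).
Proof. by case: m. Qed.

Lemma isz_bits m : (forall c, T m c = false) -> is0 m.
Proof. by move=> h; rewrite isz_eq; apply/eqP; apply: N.bits_inj => c; rewrite h N.bits_0. Qed.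

Lemma mkent_covered l p t c : t \in cands (mk_entry l p) -> T (perm_mask t) c -> T (covered (mk_entry l p)) c.
Proof.
rewrite /mk_entry /=; elim: l => //= u l IH; rewrite inE N.lor_spec => /predU1P [<- -> //| /IH h /h ->].
by rewrite orbT.
Qed.

Lemma mkent_forced l p t c : t \in cands (mk_entry l p) -> T (forced (mk_entry l p)) c -> T (perm_mask t) c.
Proof.
rewrite /mk_entry /=; elim: l => //= u l IH;
  rewrite inE N.land_spec => /predU1P [<- /andP [] //| /IH h /andP [_ /h]].
by [].
Qed.

Lemma okent_mk e l p : (forall t, F e t -> t \in l) -> (forall t, t \in p -> F e t) ->
  okent e (mk_entry l p).
Proof. by move=> h1 h2; split=> // t c; [apply: mkent_covered | apply: mkent_forced]. Qed.

Lemma okent_forbid e q x : okent e x -> (forall t, F e t -> is0 (N.land (perm_mask t) q)) ->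
  okent e (forbid q x).
Proof.
move=> ox h; rewrite /forbid; case: ifP => // _; case: ox => h1 h2 _ _.
by apply: okent_mk => // t Ft; rewrite mem_filter h // h1.
Qed.

Lemma okent_require e q x : okent e x -> (forall t, F e t -> is0 (N.ldiff q (perm_mask t))) ->
  okent e (require q x).
Proof.
move=> [h1 h2 _ _] h.
by apply: okent_mk => // t Ft; rewrite mem_filter h // h1.
Qed.

Lemma gete_sete s i e j : gete (sete s i e) j = if (j == i) && (i < size s) then e else gete s j.
Proof. by elim: s i j => [|x s IH] [|i] [|j] //=; rewrite ?nth_nil ?ltn0 ?andbF // /gete /= [LHS]IH. Qed.

Lemma size_sete s i e : size (sete s i e) = size s.
Proof. by elim: s i => [|x s IH] [|i] //=; rewrite IH. Qed.

Lemma Inv_sete s i e : Inv s -> okent i e -> Inv (sete s i e).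
Proof. move=> [sz Is] oe; split; rewrite ?size_sete // => j; by rewrite gete_sete;
  case: andP => // -[/eqP -> _]. Qed.

Lemma qjoinP t pu pv c : T (qjoin t pu pv) c -> exists a b, [/\ a \in pu, b \in pv & T (rainbow_get t a b) c].
Proof.
rewrite /qjoin; elim: pu => [|a pu IH] //=.
set m := foldr _ _ pu in IH *.
have: T (foldr (fun b m => N.lor (rainbow_get t a b) m) m pv) c -> T m c \/ exists2 b,
  b \in pv & T (rainbow_get t a b) c.
  elim: (pv) => [|b l IH'] /=; first by left.
  rewrite N.lor_spec => /orP [h|/IH' [h|[b' h1 h2]]]; first by right; exists b; rewrite ?mem_head.
    by left.
  by right; exists b'; rewrite // inE h1 orbT.
move=> h /h [/IH [a' [b [h1 h2 h3]]]|[b h1 h2]]; last by exists a, b; rewrite mem_head.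
by exists a', b; rewrite inE h1 orbT.
Qed.

Lemma Inv_forbid_rainbow t u v w s : Inv s ->
  (forall a b c, F u a -> F v b -> F w c -> N.land (perm_mask c) (rainbow_get t a b) = 0%num) ->
    Inv (forbid_rainbow t u v w s).
Proof.
move=> Is h; rewrite /forbid_rainbow.
have [_ hu _ _] := Is.2 u; have [_ hv _ _] := Is.2 v.
case eu: (present (gete s u)) hu => [//|u0 pu] hu; case ev: (present (gete s v)) hv => [//|v0 pv] hv.
case: ifP => // _; apply: Inv_sete => //; apply: okent_forbid => [|c Fc]; first exact: Is.2.
apply: isz_bits => i; rewrite N.land_spec; apply: negbTE; apply/negP => /andP [ci /qjoinP [a [b [ha hb]]]].
have := h a b c (hu _ ha) (hv _ hb) Fc => /(f_equal (fun m => T m i)).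
by rewrite N.land_spec ci N.bits_0 /= => ->.
Qed.

Lemma Inv_mark_present s e t : Inv s -> F e t -> Inv (mark_present s e t).
Proof.
move=> Is Ft; rewrite /mark_present; case: ifP => // _.
set s0 := sete _ _ _; have: Inv s0.
  apply: Inv_sete => //; have [h1 h2 h3 h4] := Is.2 e; split=> //= t'.
  by rewrite inE => /predU1P [->|/h2].
have := mod_tup mF (e := e) (t := t); elim: (nth [::] tuples e) s0 => [|[[u v] w] l IH] s0 h I0 //=.
apply: IH => [u' v' w' a b c hl|]; first by apply: h; rewrite inE hl orbT.
have h' a b c : F u a -> F v b -> F w c -> _ := fun ha hb hc => h u v w a b c (mem_head _ _) Ft ha hb hc.
apply: Inv_forbid_rainbow; [apply: Inv_forbid_rainbow; [apply: Inv_forbid_rainbow|]|] => // a b c ha hb hc.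
- by have [] := h' c a b hc ha hb.
- by have [] := h' a c b ha hc hb.
- by have [] := h' a b c ha hb hc.
Qed.

Lemma lfix_ok j once x o1 o2 o3 : okent j x ->
  (forall c, T once c -> T (covered x) c -> forall t, F j t -> T (perm_mask t) c) ->
  (forall c, [|| T o1 c, T o2 c | T o3 c] -> forall t, F j t -> ~~ T (perm_mask t) c) ->
  okent j (lfix once x o1 o2 o3).1.
Proof.
move=> ox h1 h2; rewrite /lfix; case: ifP => // _ /=; apply: okent_forbid => [|t Ft].
  apply: okent_require => // t Ft; apply: isz_bits => c; rewrite N.ldiff_spec N.land_spec.
  by apply: negbTE; apply/negP => /andP [/andP [hc hu]]; rewrite (h1 c hc hu t Ft).
apply: isz_bits => c; rewrite !N.land_spec !N.lor_spec.
by apply: negbTE; apply/negP => /and3P [hc hu _]; have := h2 c hu t Ft; rewrite hc.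
Qed.

Lemma line_step_ok s o : o \in lines -> Inv s -> if line_step s o is Some (s', _) then Inv s' else False.
Proof.
case: o => [[[i0 i1] i2] i3] hl Is; have [U cov once' sure] := mod_line mF hl.
have oun j c t : T (covered (gete s j)) c = false -> F j t -> ~~ T (perm_mask t) c.
  by move=> hf Ft; have [h1 _ h3 _] := Is.2 j; apply/negP => /(h3 t c (h1 t Ft)); rewrite hf.
have oit j c : T (forced (gete s j)) c -> forall t, F j t -> T (perm_mask t) c.
  by move=> hc t Ft; have [h1 _ _ h4] := Is.2 j; apply: h4 => //; apply: h1.
rewrite /line_step; case: ifP => [/negP []|_].
  apply: isz_bits => c; rewrite /mcompl N.ldiff_spec !N.lor_spec.
  apply: negbTE; apply/negP => /andP [/cov [j js [t Ft tc]]].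
  have : T (covered (gete s j)) c by apply/negP => hf; have /negP [] := oun j c t (negbTE (introN idP hf)) Ft.
  by move: js; rewrite !inE => /or4P [] /eqP -> ->; rewrite ?orbT.
set e0 := gete s i0; set e1 := gete s i1; set e2 := gete s i2; set e3 := gete s i3.
set once := mcompl _.
have onceP c : T once c -> 
  [/\ T (covered e0) c -> [&& ~~ T (covered e1) c, ~~ T (covered e2) c & ~~ T (covered e3) c],
      T (covered e1) c -> [&& ~~ T (covered e0) c, ~~ T (covered e2) c & ~~ T (covered e3) c],
      T (covered e2) c -> [&& ~~ T (covered e0) c, ~~ T (covered e1) c & ~~ T (covered e3) c]
    & T (covered e3) c -> [&& ~~ T (covered e0) c, ~~ T (covered e1) c & ~~ T (covered e2) c]].
  rewrite /once /mcompl N.ldiff_spec !(N.lor_spec, N.land_spec) => /andP [_].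
  by case: (T (covered e0) c); case: (T (covered e1) c); case: (T (covered e2) c); case: (T (covered e3) c).
(* The update of one slice j of the line against the other three, to be used for each of the four
   slices. *)
have G j x y z (js : [/\ j \in [:: i0; i1; i2; i3], x \in [:: i0; i1; i2; i3], y \in [:: i0; i1; i2;
  i3] & z \in [:: i0; i1; i2; i3]]):
   perm_eq [:: j; x; y; z] [:: i0; i1; i2; i3] ->
   (forall c, T once c -> T (covered (gete s j)) c -> [&& ~~ T (covered (gete s x)) c,
     ~~ T (covered (gete s y)) c & ~~ T (covered (gete s z)) c]) ->
   okent j (lfix once (gete s j) (forced (gete s x)) (forced (gete s y)) (forced (gete s z))).1.
  move=> pe h; case: js => hj hx hy hz; move: (U); rewrite -(perm_uniq pe) /= !inE !negb_or.
  move=> /and4P [/and3P [nx ny nz] _ _ _].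
  apply: lfix_ok => [|c|c]; first exact: Is.2.
    move=> hc hu; have c16 : T 65535 c by move: hc; rewrite /once /mcompl N.ldiff_spec => /andP [].
    apply: once' => // j' t; rewrite -(perm_mem pe) !inE => /orP [/eqP ->|]; first by rewrite eqxx.
    have /and3P [h1 h2 h3] := h c hc hu.
    by move=> /or3P [] /eqP -> _; apply: oun; apply: negbTE.
  by move=> /or3P [] /oit /sure ss t Ft; apply: ss Ft.
have K0 := G i0 i1 i2 i3; have K1 := G i1 i0 i2 i3; have K2 := G i2 i0 i1 i3; have K3 := G i3 i0 i1 i2.
have {K0}: okent i0 (lfix once e0 (forced e1) (forced e2) (forced e3)).1.
  by apply: K0 => [|//|c hc]; [rewrite !inE !eqxx ?orbT | case: (onceP c hc)].
have {K1}: okent i1 (lfix once e1 (forced e0) (forced e2) (forced e3)).1.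
  apply: K1 => [||c hc]; [by rewrite !inE !eqxx ?orbT | | by case: (onceP c hc)].
  by apply/seq.permP => a /=; lia.
have {K2}: okent i2 (lfix once e2 (forced e0) (forced e1) (forced e3)).1.
  apply: K2 => [||c hc]; [by rewrite !inE !eqxx ?orbT | | by case: (onceP c hc)].
  by apply/seq.permP => a /=; lia.
have {K3}: okent i3 (lfix once e3 (forced e0) (forced e1) (forced e2)).1.
  apply: K3 => [||c hc]; [by rewrite !inE !eqxx ?orbT | | by case: (onceP c hc)].
  by apply/seq.permP => a /=; lia.
case: (lfix once e0 _ _ _) => f0 b0 /=; case: (lfix once e1 _ _ _) => f1 b1 /=.
case: (lfix once e2 _ _ _) => f2 b2 /=; case: (lfix once e3 _ _ _) => f3 b3 /= ok3 ok2 ok1 ok0.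
by case: ifP => // _; do 4!apply: Inv_sete => //.
Qed.

Lemma lines_step_ok ls s b : {subset ls <= lines} -> Inv s ->
  if lines_step ls s b is Some (s', _) then Inv s' else False.
Proof.
elim: ls s b => [|o ls IH] s b sub Is //=.
have := line_step_ok (sub o (mem_head _ _)) Is; case: (line_step s o) => // -[s' b'] Is'.
by apply: IH => // o' h; apply: sub; rewrite inE h orbT.
Qed.

Lemma mark_singletons_ok s : Inv s -> Inv (mark_singletons s).1.
Proof.
rewrite /mark_singletons; move: (iota _ _) false => l b; elim: l s b => //= i l IH s b Is.
case eg: (gete s i) => [[|t [|t' d]] u' i' [|p p']]; try exact: IH.
apply: IH; apply: Inv_mark_present => //.
have [h1 _ _ _] := Is.2 i; move: h1; rewrite eg /= => h1.
have [lt|ge] := ltnP i (size s); last by move: eg; rewrite /gete nth_default.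
have [|t0 Ft0] := @mod_ne _ mF i; first by rewrite -Is.1.
by have := h1 _ Ft0; rewrite inE => /eqP <-.
Qed.

Lemma propagate_ok k s : Inv s -> if propagate k s is Some s' then Inv s' else False.
Proof.
elim: k s => [|k IH] s Is //=; case: ifP => [/(has_nthP entry0) [i lt]|_].
  have [h1 h2 _ _] := Is.2 i; have [|t Ft] := @mod_ne _ mF i; first by rewrite -Is.1.
  rewrite /dead -/(gete s i) => /orP [/nilP h|/negP []]; first by have := h1 _ Ft; rewrite h.
  by apply/allP => t' /h2 /h1.
have := lines_step_ok false (fun x h => h) Is; case: (lines_step lines s false) => // -[s1 b] Is1.
have := mark_singletons_ok Is1; case: (mark_singletons s1) => s2 b' /= Is2.
by case: ifP => // _; apply: IH.
Qed.

Definition fits (i : nat) : Prop :=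
  i < size rels /\ forall e t x, F e t -> x < 4 -> nth (fun _ _ _ => false) rels i e x (papp t x).

Lemma leafok_fits i s : Inv s -> leafok i s -> fits i.
Proof.
move=> [sz Is] /andP [lt /allP h]; split=> // e t x Ft x4; have [h1 _ _ _] := Is e.
have lte : e < size s.
  by rewrite ltnNge; apply/negP => ge; have := h1 _ Ft; rewrite /gete nth_default.
have /allP /(_ t (h1 _ Ft)) /allP hx : all _ _ := h e ltac:(by rewrite mem_iota).
by apply: hx; rewrite mem_iota.
Qed.

(** If slice e does not support t, dropping t loses nothing; otherwise the branch that marks t is
    the true one. Once all of [l] is dropped, [pp] contains every permutation of the slice and is
    nonempty. *)
Lemma branch_sound (go : state -> seq nat -> option (seq nat)) s e px pp l scr : Inv s ->
  (forall s scr, Inv s -> go s scr -> exists i, fits i) ->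
  (forall t, t \in px -> F e t) ->
  (forall t, F e t -> t \in l ++ pp) -> (e < n) ->
  branch go s e px pp l scr -> exists i, fits i.
Proof.
move=> Is hgo hpx + lt; elim: l scr => [|t l IH] scr hl /=.
  case: pp hl => [|p0 pp'] hl; first by have [t /hl] := mod_ne mF lt.
  by apply: hgo; apply: Inv_sete => //; apply: okent_mk.
have Is' : Inv (sete s e (mk_entry (t :: l ++ pp) px)) by apply: Inv_sete => //; apply: okent_mk.
case Ft: (F e t); last first.
  case: (go _ _) => // scr'; apply: IH => t' Ft'; have := hl t' Ft'.
  by rewrite inE => /predU1P [ett|//]; rewrite ett Ft in Ft'.
have Ia := Inv_mark_present Is' Ft.
by case: (go _ _) (hgo _ scr Ia) => // scr' h _; apply: h.
Qed.

Arguments propagate : simpl never.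

Lemma run_sound k s scr : Inv s -> run k s scr -> exists i, fits i.
Proof.
elim: k s scr => // k IH s scr Is /=.
have := propagate_ok 30 Is; case: (propagate 30 s) => // s' {}Is.
case: scr => [|e scr0] //=; case: ifP => _.
  by case: scr0 => [|i scr1] //=; case: ifP => // /(leafok_fits Is) h _; exists i.
have [h1 h2 _ _] := Is.2 e.
case: ltnP => //= lt; rewrite Is.1 in lt.
apply: branch_sound => // t /h1 h.
by rewrite mem_cat !mem_filter h !andbT orNb.
Qed.

(** In [init] the lists bound the permutations of a slice from above and from below. The actual
    array follows one branch of the search, which propagation cannot close, so it ends at a leaf and
    satisfies the relation checked there. With [rels] empty this is a contradiction. *)
Lemma search_sound (init : seq (nat * seq nat * seq nat)) scr :
  (forall e t, n <= e -> F e t = false) ->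
  (forall e l p, (e, l, p) \in init -> (forall t, F e t -> t \in l) /\ (forall t, t \in p -> F e t)) ->
  search n init scr -> exists i, fits i.
Proof.
move=> out; rewrite /search => h.
set s0 := foldl _ (nseq _ _) _.
have I0 : Inv s0.
  rewrite /s0; have: Inv (nseq n full_entry).
    split=> [|e]; first by rewrite size_nseq.
    rewrite /gete nth_nseq; case: ltnP => ge; last by apply: (@okent_mk _ [::] [::]) => // t; rewrite out.
    apply: (@okent_mk _ (iota 0 24) [::]) => // t /(mod_dom mF); rewrite mem_iota //.
  have: forall e l p t, (e, l, p) \in init -> F e t -> t \in l by move=> e l p t /h [h1 _]; apply: h1.
  move: (nseq _ _); elim: (init) => [|[[e l] p] ini IH] s hi Is //=.
  apply: IH; first by move=> e' l' p' t hin; apply: (hi e' l' p'); rewrite inE hin orbT.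
  by apply: Inv_sete => //; apply: okent_mk => // t; apply: (hi e l p); rewrite mem_head.
set s1 := foldl _ s0 _.
have : Inv s1.
  rewrite /s1; have : forall e l p t, (e, l, p) \in init -> t \in p -> F e t by move=> e l p t /h [_ h1];
    apply: h1.
  move: s0 I0 {s1} => s0 I0; elim: (init) s0 I0 => [|[[e l] p] ini IH] s Is hi; first by [].
  apply: IH; last by move=> e' l' p' t hin; apply: (hi e' l' p'); rewrite inE hin orbT.
  have {}hi : forall t, t \in p -> F e t by move=> t; apply: (hi e l p); rewrite mem_head.
  elim: p s Is hi => [|t p IHp] s Is hi //=; apply: IHp; last by move=> t' ht; apply: hi; rewrite inE ht orbT.
  by apply: Inv_mark_present => //; apply: hi; rewrite mem_head.
by move=> /(@run_sound 60 s1 scr); case: (run _ _ _) => // a ha _; apply: ha.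
Qed.
End Sound.
End Run.

(** * Search problems and their certificates *)

(* Slices of an array with m further coordinates are numbered in base 4: digit j is coordinate j, the
   leading digit being the position along a diagonal in the remaining coordinates. *)
Definition digit (j e : nat) : nat := (e %/ 4 ^ j) %% 4.
(** [trans] lists every diagonal of the index space once, ordered by the leading digit, each lower
    digit running through a permutation. *)
Definition tuples_of (m : nat) : seq (seq (nat * nat * nat)) :=
  let trans := foldr (fun j tr => [seq [seq p.1 + p.2 * 4 ^ j | p <- zip t p] | t <- tr, p <- perms4])
                     [:: [seq k * 4 ^ m.-1 | k <- iota 0 4]] (iota 0 m.-1) in
  [seq [seq (let o := rem e t in (nth 0 o 0, nth 0 o 1, nth 0 o 2)) | t <- trans & e \in t]
    | e <- iota 0 (4 ^ m)].
Definition tuples1 := Eval vm_compute in tuples_of 1.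
Definition tuples2 := Eval vm_compute in tuples_of 2.
Definition tuples3 := Eval vm_compute in tuples_of 3.
Definition lines_of (m j : nat) : seq (nat * nat * nat * nat) :=
  [seq (e, e + 4 ^ j, e + 2 * 4 ^ j, e + 3 * 4 ^ j) | e <- iota 0 (4 ^ m) & digit j e == 0].
Definition lines1 := Eval vm_compute in lines_of 1 0.
(** Only digit 0 gives lines here: the leading digit runs along a diagonal, whose members may differ
    in several coordinates. [lines3k] serves the case where this diagonal moves in a single
    coordinate. *)
Definition lines2 := Eval vm_compute in lines_of 2 0.
Definition lines3 := Eval vm_compute in lines_of 3 0 ++ lines_of 3 1.
Definition lines3k := Eval vm_compute in lines_of 3 0 ++ lines_of 3 1 ++ lines_of 3 2.

Definition upto_swap (t y : nat) : bool := (t == y) || (t == nth 0 [:: 1; 0; 2; 3] y).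
Definition xor4 (x y : nat) : nat := nth 0 (nth [::] [:: [:: 0;1;2;3]; [:: 1;0;3;2]; [:: 2;3;0;1];
  [:: 3;2;1;0]] x) y.
Definition omega4 (y : nat) : nat := nth 0 [:: 0;2;3;1] y.
Definition add4 (x y : nat) : nat := (x + y) %% 4.
Definition sub4 (x y : nat) : nat := (x + 4 - y) %% 4.

(* s selects which of the three coordinates is special. *)
Definition rel_row (p : nat * nat * nat * nat) : nat -> nat -> nat -> bool :=
  let: (s, il, ix, iy) := p in fun l x y =>
  let fl := papp il l in let fx := papp ix x in let fy := papp iy y in
  if s == 0 then upto_swap (add4 fl fx) fy else if s == 1 then upto_swap (add4 fl fy) fx else upto_swap (add4
    fx fy) fl.
Definition rel_L (sw : bool) (il ix iy : nat) (c : nat -> nat) (k l x y : nat) : bool :=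
  let x' := if sw then y else x in let y' := if sw then x else y in
  upto_swap (sub4 (add4 (papp il l) (papp ix x')) (c k)) (papp iy y').
(* Z/2 x Z/2 acting by [xor4]; [omega4] is multiplication by a generator of the units of GF(4). *)
Definition rel_V (sw : bool) (il ix iy : nat) (c : nat -> nat) (k l x y : nat) : bool :=
  let x' := if sw then y else x in let y' := if sw then x else y in
  let y2 := papp iy y' in
  xor4 (xor4 (papp il l) (papp ix x')) (c k) == (if k < 2 then y2 else omega4 y2).
Definition rel_sporadic (w : seq nat) (e x y : nat) : bool := y == papp (nth 0 w e) x.
Definition script_row := [:: 1;3;2;0;0;0;2;2;0;0;2;2;2;0;0;2;99;0;99;1;0;2;0;99;2;2;0;99;3;0;0;2;0;99;4;2;0;2;
  0;0;99;5;99;6;2;3;99;7;2;99;8;2;2;99;9;2;0;99;10;99;11;3;2;2;2;0;3;2;2;2;2;2;3;3;3;3;1;1;1;2;0;1;3;1;99;12;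
  99;13;3;1;99;14;99;15;0;99;16;3;1;99;17;3;99;18;1;99;19;3;99;20;3;99;21;3;0;99;22;99;23;1;2;0;1;3;1;99;24;
  99;25;3;1;99;26;99;27;3;0;99;28;99;29;3;99;30;0;99;31;99;32;1;3;99;33;3;99;34;3;99;35;2;3;3;3;3;3;0;2;1;1;2;
  3;3;0;3;2;3;3;3;3;2;3;0;0;3;99;36;99;37;1;3;3;2;99;38;99;39;3;2;99;40;99;41;3;1;3;1;0;99;42;0;99;43;3;2;99;
  44;99;45;2;3;3;2;99;46;99;47;3;99;48;99;49;3;3;3;99;50;99;51;3;0;3;2;99;52;0;99;53;99;40;3;99;54;99;55;3;99;
  56;99;57;3;99;58;0;99;59;99;45;1;2;0;3;1;99;60;99;61;3;1;99;62;99;63;1;3;99;64;99;65;0;99;66;3;99;67;3;99;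
  68;3;99;69;3;0;99;70;99;71;2;3;0;99;72;3;0;99;73;99;74;3;1;3;0;3;99;75;3;0;99;76;99;77;3;0;99;78;99;79;3;0;
  99;80;99;81;3;3;99;82;99;83;99;84;99;85;99;83;1;99;86;99;87;99;88;99;61;3;1;2;3;0;99;89;3;3;1;99;90;99;91;0;
  99;92;3;3;0;99;93;99;94;3;0;99;95;3;1;99;96;0;99;97;99;98;3;99;99;99;100;99;11;2;3;99;101;3;0;99;102;99;103;
  1;99;104;1;99;105;2;0;3;1;99;106;3;1;99;107;99;108;1;1;3;99;109;0;2;0;3;99;110;1;99;111;3;99;112;99;113;3;0;
  99;114;99;115;3;1;99;116;0;99;117;99;118;3;99;119;3;99;120;3;99;121;2;3;0;99;122;2;3;99;123;0;99;124;99;125;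
  3;3;99;126;99;127;0;99;128;3;0;99;129;99;130;3;99;131;99;132;99;132;3;0;99;133;2;3;99;134;3;0;99;135;99;136;
  1;99;137;1;99;138;2;3;3;0;3;3;3;2;2;0;1;3;99;139;99;140;3;99;141;0;1;3;99;142;0;2;3;0;0;99;143;99;144;3;2;3;
  99;145;3;99;146;1;3;3;0;3;99;147;3;99;148;99;149;99;150;99;151;99;149;1;3;99;152;1;1;3;99;153;3;99;154;99;
  155;99;156;99;152;2;3;1;99;157;3;3;99;158;3;3;1;99;159;0;99;160;99;139;3;99;161;3;99;162;3;99;163;0;0;99;
  142;2;3;99;164;3;0;99;165;99;166;2;3;0;99;167;99;168;2;99;169;99;170;99;171;99;169;3;0;99;172;99;173;2;3;0;
  99;174;99;175;1;3;99;176;99;177;99;178;99;176;2;3;99;179;3;99;180;99;181;3;1;3;99;182;0;2;1;3;99;183;99;184;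
  1;3;99;185;3;99;186;0;2;3;2;1;2;3;3;3;99;187;3;2;99;188;99;189;2;99;190;3;2;99;191;2;0;2;3;99;192;99;193;0;
  0;0;99;7;3;2;0;99;194;99;195;2;2;2;2;3;99;196;3;99;197].
Definition par_row := [:: (2,0,3,11);(2,0,2,10);(2,0,0,5);(2,0,1,4);(2,0,4,1);(2,0,5,9);(2,0,0,7);(2,0,2,3);
  (2,0,5,0);(2,0,3,2);(2,0,4,8);(2,0,1,6);(1,0,2,2);(0,0,3,3);(1,0,5,5);(1,1,1,1);(0,1,4,4);(1,1,2,2);
  (0,1,3,3);(1,1,5,5);(0,0,0,0);(1,0,1,1);(0,0,4,4);(0,1,0,0);(1,0,3,3);(0,0,2,2);(1,1,3,3);(0,1,5,5);
  (1,0,4,4);(1,1,0,0);(0,0,5,5);(1,1,4,4);(0,1,1,1);(1,0,0,0);(0,1,2,2);(0,0,1,1);(2,2,2,3);(2,2,3,2);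
  (1,2,2,2);(0,2,3,3);(1,2,3,3);(0,2,2,2);(2,12,3,13);(2,12,2,12);(1,2,5,11);(0,2,21,19);(1,2,4,10);
  (0,2,20,18);(0,2,11,5);(1,2,19,21);(0,2,13,13);(1,2,12,12);(2,3,2,3);(2,13,3,13);(0,2,10,4);(1,2,18,20);
  (0,2,12,12);(1,2,13,13);(2,3,3,2);(2,13,2,12);(1,1,5,11);(0,1,9,3);(1,0,5,11);(0,0,21,19);(0,0,9,3);
  (0,1,17,16);(1,1,13,15);(0,1,21,19);(1,0,22,23);(0,0,17,16);(1,0,13,15);(1,1,22,23);(2,2,5,9);(1,2,4,4);
  (1,1,1,7);(2,12,0,14);(0,2,19,19);(0,0,18,18);(0,2,15,13);(0,1,16,16);(1,2,2,8);(1,0,12,14);(2,3,5,9);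
  (1,0,1,7);(0,0,16,16);(2,16,5,16);(1,1,12,14);(0,1,18,18);(2,13,0,14);(2,2,4,8);(1,2,5,5);(1,1,0,6);
  (0,1,8,2);(0,0,19,19);(0,2,18,18);(2,12,1,15);(1,2,3,9);(0,1,19,19);(1,1,22,22);(2,13,1,15);(2,16,4,17);
  (1,0,0,6);(0,0,8,2);(0,2,14,12);(1,0,22,22);(2,3,4,8);(1,1,4,10);(1,0,4,10);(0,0,20,18);(0,1,20,18);
  (0,1,11,5);(1,1,3,9);(0,0,11,5);(1,0,19,21);(0,0,15,13);(0,1,23,22);(1,0,3,9);(0,1,15,13);(1,1,16,17);
  (0,0,23,22);(1,1,19,21);(1,0,16,17);(2,2,1,6);(0,2,5,5);(1,1,2,8);(0,1,6,0);(0,2,9,3);(0,1,22,22);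
  (1,1,19,19);(1,0,2,8);(1,2,12,14);(2,16,1,15);(2,13,4,17);(2,12,4,17);(0,0,22,22);(1,0,19,19);(1,2,18,18);
  (0,0,6,0);(2,3,1,6);(0,0,13,13);(1,0,12,12);(0,1,13,13);(1,1,12,12);(2,2,0,5);(2,2,5,0);(0,2,0,0);(1,2,0,0);
  (1,2,22,23);(2,3,0,5);(1,2,1,7);(0,2,16,16);(2,13,5,16);(0,2,23,22);(2,12,5,16);(2,3,5,0);(0,2,7,1);
  (1,2,16,16);(2,2,3,11);(1,2,1,1);(2,3,3,11);(2,16,3,13);(0,2,17,16);(1,2,0,6);(0,2,22,22);(2,2,0,7);
  (0,2,4,4);(0,1,7,1);(1,2,13,15);(1,1,16,16);(1,1,18,18);(0,1,14,12);(2,16,0,14);(0,2,8,2);(0,0,14,12);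
  (1,2,19,19);(1,0,18,18);(2,3,0,7);(0,0,7,1);(1,0,16,16);(0,1,10,4);(0,0,10,4);(1,0,18,20);(1,1,18,20);
  (0,0,12,12);(1,0,13,13);(0,1,12,12);(1,1,13,13);(0,2,1,1);(1,2,22,22);(1,2,16,17);(0,2,6,0);(2,3,2,10);
  (2,16,2,12);(2,2,2,10);(2,3,1,4);(2,3,4,1);(2,2,1,4);(2,2,4,1)].
Definition script_start := [:: 0;0;6;1;1;7;7;1;1;1;6;11;13;12;2;99;34;2;99;34;13;12;99;0;6;99;0;13;4;13;99;19;
  99;0;6;2;99;0;99;19;13;4;99;17;99;17;14;15;99;34;13;99;17;2;6;99;34;99;17;9;7;13;8;99;0;2;99;0;6;13;99;17;
  99;17;2;11;13;99;0;2;99;0;13;99;17;1;99;17;9;11;13;4;99;22;99;22;1;99;22;13;99;22;1;99;22;12;13;8;99;31;8;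
  99;31;14;99;31;3;99;31;9;7;13;99;34;14;1;99;19;99;19;11;13;99;19;99;19;1;99;34;11;13;8;1;99;6;3;99;6;13;15;
  99;6;2;99;6;8;1;1;99;11;13;7;99;11;7;99;11;9;7;14;12;7;99;25;2;99;25;13;12;99;28;99;28;1;7;13;11;13;6;99;25;
  6;99;25;15;1;1;99;28;6;99;28;11;13;4;99;5;99;5;7;99;5;13;99;5;99;5;13;4;1;99;12;4;99;12;13;99;12;99;12;6;7;
  7;13;1;99;28;13;11;1;99;25;99;25;12;99;25;1;0;7;6;1;1;15;6;9;11;12;1;99;13;1;8;1;99;4;8;1;1;99;4;2;99;13;9;
  7;13;4;99;16;13;99;16;4;1;99;1;1;99;1;6;9;7;13;99;13;1;99;4;4;1;99;4;1;99;13;8;1;7;99;7;1;99;7;1;11;1;99;10;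
  1;99;10;4;1;8;99;10;1;12;99;7;6;9;11;12;1;99;20;12;2;99;33;1;11;13;99;33;1;99;20;11;13;8;1;99;26;13;8;99;27;
  13;99;26;13;99;27;11;13;4;99;21;13;4;99;32;13;99;21;9;7;13;99;21;1;99;32;4;1;99;32;1;99;21;11;13;1;1;1;1;6;
  11;13;99;20;13;99;33;1;1;99;20;7;14;11;9;99;16;7;3;99;16;99;32;9;2;99;10;7;2;99;10;99;26;14;9;10;99;20;4;99;
  20;99;20;11;10;99;21;6;99;21;99;21;6;14;11;99;13;2;99;13;1;99;7;14;9;7;99;33;4;99;33;9;6;99;27;14;9;3;99;16;
  7;1;99;10;14;11;99;33;1;99;27;14;9;7;99;4;4;99;4;11;6;99;1;6;99;1;14;11;99;32;1;99;26;14;9;99;4;99;4;11;99;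
  1;99;1;15;9;6;4;3;1;1;99;30;3;1;1;99;23;1;7;13;99;23;1;99;30;7;14;4;7;99;35;13;99;35;4;2;2;99;18;1;99;18;4;
  2;3;5;2;99;24;1;99;24;2;3;2;99;29;1;99;29;6;6;1;1;11;14;6;6;99;23;99;23;6;13;6;99;30;1;99;30;9;6;11;12;1;99;
  3;1;8;1;99;14;7;13;99;3;1;99;14;7;14;4;99;15;14;8;99;2;1;1;99;15;6;11;13;99;15;1;99;2;4;1;99;15;1;99;2;7;14;
  4;99;9;14;4;99;8;13;99;8;13;99;9;9;2;8;2;4;99;14;6;1;99;3;1;99;3;14;11;13;6;10;6;99;18;99;2;6;99;2;99;18;10;
  7;7;99;29;99;29;6;99;9;9;6;6;2;99;2;99;18;2;99;2;99;18;7;7;7;99;29;99;9;7;99;29;99;9;7;10;9;7;99;35;1;99;15;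
  7;7;99;35;99;15;10;1;99;35;6;99;35;9;7;1;99;14;99;30;7;1;99;14;99;30;11;1;99;14;11;99;30;1;99;15;7;7;3;11;
  99;8;6;4;99;8;99;8;10;4;3;99;24;99;24;4;3;4;99;24;99;24;4;10;11;3;99;23;7;99;3;4;3;3;99;3;99;23;2;99;3;99;
  23;1;3;10;10;3;1;1;1;3;1;1;1;12;1;4;5;99;30;4;99;17;12;12;99;17;99;30;7;8;99;18;5;99;5;12;12;99;5;99;18;1;4;
  12;99;17;12;7;99;5;1;7;99;23;8;99;23;4;99;35;9;99;35;1;7;5;99;29;9;14;99;29;4;5;99;24;9;13;99;24;13;1;7;12;
  99;0;4;12;99;12;13;4;99;12;2;99;0;1;7;12;99;6;12;99;6;4;12;99;11;12;99;11;1;7;99;6;99;6;4;99;11;99;11;1;4;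
  99;30;99;30;8;99;18;10;3;1;1;1;3;12;1;7;99;19;11;99;19;4;99;31;9;99;31;1;4;99;4;4;99;16;99;16;12;1;4;5;5;99;
  22;99;1;9;12;99;22;99;1;8;12;99;34;12;99;13;1;7;99;22;9;99;22;8;99;34;1;4;99;1;99;1;7;99;13;4;4;1;4;13;5;99;
  28;5;99;7;13;11;99;28;99;7;4;8;14;99;25;99;10;4;12;1;4;11;12;99;33;99;14;12;8;7;99;21;7;99;2;13;1;7;11;5;99;
  32;99;15;11;12;99;32;99;15;12;8;7;99;3;7;99;20;1;4;11;99;15;12;7;99;3;1;4;5;99;27;12;99;27;99;27;4;5;99;26;
  12;99;26;99;26;1;4;5;99;8;12;99;8;99;8;7;5;99;9;12;99;9;99;9;1;7;99;33;11;99;33;12;7;99;21;4;1;4;99;32;7;99;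
  20;1;4;99;14;7;99;2;15;8;1;4;8;99;12;9;99;11;3;14;99;30;4;14;99;29;2;4;1;4;99;23;9;99;23;6;99;18;11;99;18;9;
  11;14;99;6;1;99;17;4;2;9;4;99;0;6;99;5;1;1;4;99;35;99;35;9;99;24;8;1;6;99;28;8;99;28;12;99;31;1;4;5;14;6;5;
  12;1;4;5;99;1;9;99;1;6;5;99;4;9;99;4;1;4;99;7;99;7;6;99;16;3;14;8;99;34;14;99;25;1;4;99;10;9;99;13;1;4;99;
  22;99;22;6;99;19;99;19;1;8;9;1;4;8;99;14;11;99;9;1;4;5;99;21;9;99;21;4;99;20;11;99;20;1;4;99;2;99;2;6;99;3;
  99;3;1;6;99;32;8;99;32;11;99;27;4;1;4;99;33;6;99;26;1;4;99;15;6;99;8;9;14;7;3;99;48;99;0;1;1;99;19;99;49;99;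
  50;1;99;19;99;51;4;4;9;7;99;34;99;17;6;11;6;99;15;99;35;6;99;2;99;18;11;1;13;99;15;7;99;2;11;13;99;35;7;1;
  99;18;13;2;99;52;99;53;99;54;99;55;14;7;1;99;39;99;56;99;57;99;58;12;99;59;8;99;60;4;99;44;7;99;7;1;99;27;1;
  99;61;99;62;99;63;99;64;99;27;7;1;1;99;10;99;26;12;99;10;1;99;65;99;66;99;67;99;68;99;26;3;99;46;5;99;69;99;
  70;1;99;71;99;72;99;73;99;37;14;7;1;1;99;29;99;9;12;99;29;7;99;9;1;99;74;99;75;99;76;99;77;3;1;99;78;99;79;
  99;80;99;38;99;81;99;82;99;45;3;99;40;99;83;3;99;84;1;99;85;99;86;99;87;99;43;7;7;99;8;99;24;99;8;99;24;1;
  99;88;99;89;99;90;99;91;2;7;3;99;92;99;20;4;99;93;9;4;2;99;13;99;13;2;7;99;33;99;33;9;6;99;94;7;99;4;1;99;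
  95;99;4;9;4;11;6;1;99;96;99;97;99;98;99;99;99;22;99;5;14;6;99;31;99;12;9;7;2;3;99;100;99;21;1;99;101;6;99;
  16;1;99;102;3;99;32;1;99;103;99;1;2;5;14;1;99;104;99;105;99;106;99;107;1;99;108;99;109;99;110;99;41;1;99;47;
  99;111;99;112;99;113;1;99;114;99;115;99;116;99;117;5;1;99;11;8;99;11;99;118;4;8;99;119;99;25;8;7;99;28;7;99;
  120;1;99;42;5;99;6;8;99;121;99;6;9;99;36;14;6;6;99;30;99;14;99;30;99;14;2;2;3;3;99;3;3;99;23;1;99;122;99;
  123;99;124;99;125].
Definition par_L := [:: (false,0,0,0,[:: 0;1;1;2]);(false,0,1,2,[:: 3;0;2;3]);(false,0,2,5,[:: 3;0;2;3]);
  (false,0,3,3,[:: 0;1;1;2]);(false,0,4,4,[:: 0;1;1;2]);(false,0,5,1,[:: 3;0;2;3]);(false,1,0,0,[:: 0;1;2;1]);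
  (false,1,1,2,[:: 3;0;3;2]);(false,1,2,5,[:: 3;0;3;2]);(false,1,3,3,[:: 0;1;2;1]);(false,1,4,4,[:: 0;1;2;1]);
  (false,1,5,1,[:: 3;0;3;2]);(false,2,0,0,[:: 0;2;0;2]);(false,2,1,2,[:: 3;1;1;3]);(false,2,2,5,[:: 3;1;1;3]);
  (false,2,3,3,[:: 0;2;0;2]);(false,2,4,4,[:: 0;2;0;2]);(false,2,5,1,[:: 3;1;1;3]);(true,0,0,3,[:: 3;0;2;3]);
  (true,0,1,1,[:: 0;1;1;2]);(true,0,2,2,[:: 0;1;1;2]);(true,0,3,4,[:: 3;0;2;3]);(true,0,4,0,[:: 3;0;2;3]);
  (true,0,5,5,[:: 0;1;1;2]);(true,1,0,3,[:: 3;0;3;2]);(true,1,1,1,[:: 0;1;2;1]);(true,1,2,2,[:: 0;1;2;1]);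
  (true,1,3,4,[:: 3;0;3;2]);(true,1,4,0,[:: 3;0;3;2]);(true,1,5,5,[:: 0;1;2;1]);(true,2,0,3,[:: 3;1;1;3]);
  (true,2,1,1,[:: 0;2;0;2]);(true,2,2,2,[:: 0;2;0;2]);(true,2,3,4,[:: 3;1;1;3]);(true,2,4,0,[:: 3;1;1;3]);
  (true,2,5,5,[:: 0;2;0;2])].
Definition par_V := [:: (false,0,1,1,[:: 0;1;2;3]);(false,0,2,2,[:: 0;1;2;3]);(false,0,5,5,[:: 0;1;2;3]);
  (false,1,1,1,[:: 0;1;3;2]);(false,1,2,2,[:: 0;1;3;2]);(false,1,5,5,[:: 0;1;3;2]);(true,0,0,0,[:: 0;1;2;3]);
  (true,0,3,3,[:: 0;1;2;3]);(true,0,4,4,[:: 0;1;2;3]);(true,1,0,0,[:: 0;1;3;2]);(true,1,3,3,[:: 0;1;3;2]);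
  (true,1,4,4,[:: 0;1;3;2])].
Definition sporadic := [:: [:: 0;23;16;7;23;0;7;16;20;6;3;17;17;20;6;3];[:: 0;17;22;7;22;0;7;17;20;6;3;17;17;
  20;6;3];[:: 0;22;17;7;17;0;7;22;20;6;3;17;17;20;6;3];[:: 0;16;23;7;16;0;7;23;20;6;3;17;17;20;6;3];[:: 0;16;
  7;23;16;0;23;7;12;10;3;21;21;12;10;3];[:: 0;13;10;23;10;0;23;13;12;10;3;21;21;12;10;3];[:: 0;10;13;23;13;0;
  23;10;12;10;3;21;21;12;10;3];[:: 0;7;16;23;7;0;23;16;12;10;3;21;21;12;10;3];[:: 0;9;16;18;18;0;9;16;20;11;3;
  12;11;20;12;3];[:: 0;18;16;9;9;0;18;16;20;11;3;12;11;20;12;3];[:: 0;23;16;7;23;0;7;16;20;11;3;12;11;20;12;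
  3];[:: 0;17;22;7;22;0;7;17;20;11;3;12;11;20;12;3];[:: 0;22;17;7;17;0;7;22;20;11;3;12;11;20;12;3];[:: 0;7;16;
  23;7;0;23;16;14;11;3;18;11;18;14;3];[:: 0;9;16;18;18;0;9;16;14;11;3;18;11;18;14;3];[:: 0;18;16;9;9;0;18;16;
  14;11;3;18;11;18;14;3];[:: 0;23;16;7;23;0;7;16;14;11;3;18;11;18;14;3];[:: 0;7;16;23;7;0;23;16;18;11;3;14;11;
  14;18;3];[:: 0;9;16;18;18;0;9;16;18;11;3;14;11;14;18;3];[:: 0;18;16;9;9;0;18;16;18;11;3;14;11;14;18;3];
  [:: 0;23;16;7;23;0;7;16;18;11;3;14;11;14;18;3];[:: 0;18;16;9;9;0;18;16;12;11;3;20;11;12;20;3];[:: 0;9;16;18;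
  18;0;9;16;12;11;3;20;11;12;20;3];[:: 0;7;16;23;7;0;23;16;12;11;3;20;11;12;20;3];[:: 0;10;13;23;13;0;23;10;
  12;11;3;20;11;12;20;3];[:: 0;13;10;23;10;0;23;13;12;11;3;20;11;12;20;3];[:: 0;7;23;16;7;0;16;23;10;12;3;21;
  12;21;10;3];[:: 0;10;23;13;13;0;10;23;10;12;3;21;12;21;10;3];[:: 0;13;23;10;10;0;13;23;10;12;3;21;12;21;10;
  3];[:: 0;16;23;7;16;0;7;23;10;12;3;21;12;21;10;3];[:: 0;16;23;7;16;0;7;23;20;12;3;11;12;20;11;3];[:: 0;17;
  22;7;22;0;7;17;20;12;3;11;12;20;11;3];[:: 0;22;17;7;17;0;7;22;20;12;3;11;12;20;11;3];[:: 0;13;23;10;10;0;13;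
  23;20;12;3;11;12;20;11;3];[:: 0;10;23;13;13;0;10;23;20;12;3;11;12;20;11;3];[:: 0;13;23;10;10;0;13;23;11;12;
  3;20;12;11;20;3];[:: 0;10;23;13;13;0;10;23;11;12;3;20;12;11;20;3];[:: 0;7;23;16;7;0;16;23;11;12;3;20;12;11;
  20;3];[:: 0;9;18;16;18;0;16;9;11;12;3;20;12;11;20;3];[:: 0;18;9;16;9;0;16;18;11;12;3;20;12;11;20;3];[:: 0;7;
  23;16;7;0;16;23;21;12;3;10;12;10;21;3];[:: 0;10;23;13;13;0;10;23;21;12;3;10;12;10;21;3];[:: 0;13;23;10;10;0;
  13;23;21;12;3;10;12;10;21;3];[:: 0;16;23;7;16;0;7;23;21;12;3;10;12;10;21;3];[:: 0;23;7;16;23;0;16;7;11;14;3;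
  18;18;11;14;3];[:: 0;18;9;16;9;0;16;18;11;14;3;18;18;11;14;3];[:: 0;9;18;16;18;0;16;9;11;14;3;18;18;11;14;
  3];[:: 0;7;23;16;7;0;16;23;11;14;3;18;18;11;14;3];[:: 0;16;23;7;16;0;7;23;20;17;3;6;6;20;17;3];[:: 0;17;22;
  7;22;0;7;17;20;17;3;6;6;20;17;3];[:: 0;22;17;7;17;0;7;22;20;17;3;6;6;20;17;3];[:: 0;23;16;7;23;0;7;16;20;17;
  3;6;6;20;17;3];[:: 0;23;7;16;23;0;16;7;11;18;3;14;14;11;18;3];[:: 0;18;9;16;9;0;16;18;11;18;3;14;14;11;18;
  3];[:: 0;9;18;16;18;0;16;9;11;18;3;14;14;11;18;3];[:: 0;7;23;16;7;0;16;23;11;18;3;14;14;11;18;3];[:: 0;16;7;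
  23;16;0;23;7;6;20;3;17;20;17;6;3];[:: 0;17;7;22;22;0;17;7;6;20;3;17;20;17;6;3];[:: 0;22;7;17;17;0;22;7;6;20;
  3;17;20;17;6;3];[:: 0;23;7;16;23;0;16;7;6;20;3;17;20;17;6;3];[:: 0;16;7;23;16;0;23;7;12;20;3;11;20;12;11;3];
  [:: 0;17;7;22;22;0;17;7;12;20;3;11;20;12;11;3];[:: 0;22;7;17;17;0;22;7;12;20;3;11;20;12;11;3];[:: 0;17;7;22;
  22;0;17;7;11;20;3;12;20;11;12;3];[:: 0;22;7;17;17;0;22;7;11;20;3;12;20;11;12;3];[:: 0;23;7;16;23;0;16;7;11;
  20;3;12;20;11;12;3];[:: 0;16;7;23;16;0;23;7;17;20;3;6;20;6;17;3];[:: 0;17;7;22;22;0;17;7;17;20;3;6;20;6;17;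
  3];[:: 0;22;7;17;17;0;22;7;17;20;3;6;20;6;17;3];[:: 0;23;7;16;23;0;16;7;17;20;3;6;20;6;17;3];[:: 0;18;9;16;
  9;0;16;18;11;20;3;12;20;11;12;3];[:: 0;13;10;23;10;0;23;13;12;20;3;11;20;12;11;3];[:: 0;10;13;23;13;0;23;10;
  12;20;3;11;20;12;11;3];[:: 0;9;18;16;18;0;16;9;11;20;3;12;20;11;12;3];[:: 0;7;16;23;7;0;23;16;12;21;3;10;10;
  12;21;3];[:: 0;10;13;23;13;0;23;10;12;21;3;10;10;12;21;3];[:: 0;13;10;23;10;0;23;13;12;21;3;10;10;12;21;3];
  [:: 0;16;7;23;16;0;23;7;12;21;3;10;10;12;21;3]].
Definition script_sporadic := nseq 78 [:: 8].
Definition script_Ltravel := [:: [:: 49;13;52;25;16;99;2;16;56;35;99;0;13;52;16;99;2;17;99;0;12;53;26;17;99;3;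
  4;99;3;17;58;44;99;5;12;53;17;99;3;16;99;5;12;53;24;17;99;4;17;24;19;99;1;28;12;53;17;99;4;19;99;1;28];
  [:: 48;13;52;16;9;99;2;16;59;47;4;99;0;13;52;16;99;2;17;99;0;12;5;26;17;99;5;16;9;18;37;99;3;12;53;17;99;3;
  16;99;5;12;54;25;19;99;1;17;25;17;99;4;29;12;54;19;99;1;17;99;4;28];[:: 51;13;54;25;16;99;2;16;58;35;99;0;
  99;0;13;54;16;99;2;17;99;0;12;55;26;17;99;3;4;99;3;17;24;46;99;5;5;99;5;12;55;17;99;3;16;99;5;12;53;24;19;
  99;1;18;24;17;99;4;28;12;55;17;99;4;19;99;1;28];[:: 50;13;54;24;16;99;2;4;99;2;16;57;28;4;99;0;13;54;16;99;
  2;17;99;0;12;5;26;17;99;5;16;8;17;5;99;3;16;99;3;12;54;17;99;3;16;99;5;12;54;25;17;99;4;17;25;19;99;1;28;12;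
  54;17;99;4;19;99;1;28];[:: 48;13;52;25;18;99;2;4;99;2;16;59;46;24;99;0;13;52;18;99;2;46;99;0;12;5;24;18;6;
  99;5;16;9;18;36;99;3;12;53;17;99;3;35;99;5;12;54;25;33;99;1;99;1;17;25;33;99;4;99;4;29;12;54;17;99;1;99;1;
  19;99;4;99;4;28];[:: 51;13;54;24;18;99;2;16;58;32;8;99;0;13;54;18;99;2;32;99;0;12;55;17;10;99;3;17;56;29;7;
  99;5;12;55;17;99;3;45;99;5;12;53;26;35;99;1;17;26;35;99;4;99;4;28;12;55;19;99;4;99;4;35;99;1;28];[:: 50;13;
  54;25;18;99;2;4;99;2;16;57;28;39;99;0;99;0;99;0;13;54;18;99;2;44;99;0;12;54;27;17;99;3;4;99;3;17;25;47;99;5;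
  99;5;5;99;5;12;54;17;99;3;33;99;5;12;54;25;33;99;4;99;4;17;25;33;99;1;99;1;28;12;54;19;99;4;99;4;17;99;1;99;
  1;28];[:: 49;13;52;26;18;99;2;16;56;35;19;99;0;8;99;0;13;52;18;99;2;34;99;0;12;53;27;17;99;3;4;99;3;17;58;
  47;8;99;5;12;53;17;99;3;47;99;5;12;53;26;35;99;4;17;26;35;99;1;99;1;30;12;53;19;99;4;99;4;47;99;1;28];
  [:: 51;13;55;26;16;99;2;4;99;2;16;58;46;4;99;0;13;54;16;99;2;16;99;0;12;4;25;17;99;5;17;99;5;25;18;6;99;3;
  12;55;18;99;3;17;99;5;12;53;24;17;99;1;17;24;19;99;4;28;12;55;19;99;4;17;99;1;28];[:: 50;13;54;16;9;99;2;16;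
  57;28;4;99;0;13;54;16;99;2;16;99;0;12;4;25;17;99;5;17;99;5;25;35;5;99;3;12;54;18;99;3;17;99;5;12;54;27;19;
  99;4;17;27;17;99;1;28;12;54;19;99;4;17;99;1;28];[:: 49;13;52;25;16;99;2;16;56;34;4;99;0;99;0;13;52;16;99;2;
  16;99;0;12;53;24;18;99;3;4;99;3;17;58;35;5;99;5;99;5;12;53;18;99;3;17;99;5;12;53;24;19;99;4;17;24;17;99;1;
  31;12;53;19;99;4;17;99;1;28];[:: 48;13;52;26;16;99;2;4;99;2;16;59;35;4;99;0;99;0;13;52;16;99;2;16;99;0;12;5;
  24;17;99;5;17;9;18;39;99;3;12;53;18;99;3;17;99;5;12;54;27;17;99;1;17;27;19;99;4;30;12;54;17;99;1;19;99;4;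
  28];[:: 50;13;54;27;16;99;2;4;99;2;16;57;28;4;99;0;13;54;16;99;2;46;99;0;12;54;25;17;99;3;4;99;3;17;27;45;
  99;5;99;5;5;99;5;12;54;17;99;3;35;99;5;12;54;25;33;99;4;99;4;17;25;34;99;1;29;12;54;17;99;4;99;4;19;99;1;99;
  1;28];[:: 49;13;52;25;16;99;2;16;56;31;4;99;0;13;52;16;99;2;32;99;0;12;53;17;10;99;3;17;58;34;24;99;5;8;99;
  5;12;53;17;99;3;45;99;5;12;53;24;35;99;4;99;4;17;24;33;99;1;99;1;28;12;53;17;99;4;99;4;45;99;1;28];[:: 48;
  13;52;27;16;99;2;4;99;2;16;59;34;45;99;0;9;99;0;13;52;16;99;2;44;99;0;12;5;24;46;6;99;5;16;9;19;38;99;3;12;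
  53;17;99;3;33;99;5;12;54;25;33;99;1;99;1;17;25;34;99;4;30;12;54;19;99;1;99;1;17;99;4;99;4;28];[:: 51;13;55;
  16;9;99;2;16;58;29;4;99;0;4;13;54;16;99;2;34;99;0;12;55;25;17;99;3;4;99;3;17;25;55;16;99;5;12;55;17;99;3;47;
  99;5;12;53;24;35;99;1;99;1;17;24;33;99;4;99;4;28;12;55;17;99;4;99;4;33;99;1;28]].
Definition script_Vtravel := nseq 16 [:: 8; 4; 99; 2; 99; 4; 4; 99; 0; 99; 5; 4; 99; 1; 99; 3].
Definition script_exact5 := [:: [:: 11;14;37;50;59;50;10;55;41;9;18;17;18;99;0;22];[:: 23];[:: 23];[:: 23];
  [:: 29];[:: 5];[:: 23];[:: 5];[:: 29]].
Definition at2 (r : nat -> nat -> nat -> nat -> bool) (e x y : nat) := r (digit 1 e) (digit 0 e) x y.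
Definition start_rels : seq (nat -> nat -> nat -> bool) :=
  [seq (let: (sw, il, ix, iy, c) := p in at2 (rel_L sw il ix iy (nth 0 c))) | p <- par_L] ++
  [seq (let: (sw, il, ix, iy, c) := p in at2 (rel_V sw il ix iy (nth 0 c))) | p <- par_V] ++
  [seq rel_sporadic w | w <- sporadic].
Definition init_sporadic (w : seq nat) : seq (nat * seq nat * seq nat) :=
  [seq (digit 1 e * 16 + digit 1 e * 4 + digit 0 e, [:: nth 0 w e], [:: nth 0 w e]) | e <- iota 0 16].
Definition perms_in (P : nat -> nat -> bool) : seq nat := [seq t <- iota 0 24 | all (fun x =>
  P x (papp t x)) (iota 0 4)].
Definition rel_Ltravel (c : nat -> nat -> nat) (e x y : nat) : bool :=
  upto_swap (sub4 (add4 (digit 0 e) x) (c (digit 2 e) (digit 1 e))) y.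
(** The pattern u, u, v, v: positions 0 and 1 have positive weight on t - c = y, positions 2 and 3
    on its twist by pi. *)
Definition present_Ltravel (c : nat -> nat) (k l x y : nat) : bool :=
  sub4 (add4 l x) (c k) == (if k < 2 then y else nth 0 [:: 1; 0; 2; 3] y).
(** The index with digits (k, k, l), as 20 = 16 + 4. There the new coordinate keeps the value it has
    at position k of the diagonal, so the slice belongs to the smaller array and is already
    known. *)
Definition diag_entry e := digit 1 e * 20 + digit 0 e.
Definition init_Ltravel (c : nat -> nat) : seq (nat * seq nat * seq nat) :=
  [seq (diag_entry e, perms_in (fun x y => upto_swap (sub4 (add4 (digit 0 e) x) (c (digit 1 e))) y),
              perms_in (present_Ltravel c (digit 1 e) (digit 0 e))) | e <- iota 0 16].
Definition rels_Ltravel (c : nat -> nat) : seq (nat -> nat -> nat -> bool) :=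
  [seq rel_Ltravel (fun k e => sub4 (add4 (c k) (papp i e)) (papp i k)) | i <- iota 0 24].
Definition rel_Vtravel (c : nat -> nat -> nat) (e x y : nat) : bool :=
  xor4 (xor4 (digit 0 e) x) (c (digit 2 e) (digit 1 e)) == (if digit 2 e < 2 then y else omega4 y).
Definition init_Vtravel (c : nat -> nat) : seq (nat * seq nat * seq nat) :=
  [seq (let a := perms_in (rel_Vtravel (fun k _ => c k) (diag_entry e)) in (diag_entry e, a, a))
    | e <- iota 0 16].
(** Adding a constant to psi changes nothing, so psi 0 = 0 may be assumed and the six permutations
    fixing 0 suffice. *)
Definition rels_Vtravel (c : nat -> nat) : seq (nat -> nat -> nat -> bool) :=
  [seq rel_Vtravel (fun k e => xor4 (xor4 (c k) (papp i e)) (papp i k)) | i <- iota 0 6].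
(* Shifts c with c_0 = 0, indexed by (c_1, c_2), of sum 0 in Z/4, resp. in Z/2 x Z/2. *)
Definition Lstate i := let c1 := i %/ 4 in let c2 := i %% 4 in nth 0 [:: 0; c1; c2; (8 - c1 - c2) %% 4].
Definition Vstate i := let c1 := i %/ 4 in let c2 := i %% 4 in nth 0 [:: 0; c1; c2; xor4 c1 c2].
(* The powers of generators of the three cyclic subgroups of order 4 of S_4. *)
Definition cycle_powers := [:: [:: 0;9;16;18]; [:: 0;10;23;13]; [:: 0;17;7;22]].
(** The slices on the three axes through the origin. The labels can be chosen so that the last axis
    consists of the shifts x + j; each of the other two follows one of three cyclic groups, whence
    nine cases. *)
Definition init_exact5 (i : nat) : seq (nat * seq nat * seq nat) :=
  [seq (16 * j, [:: nth 0 (nth [::] cycle_powers (i %/ 3)) j], [::]) | j <- iota 0 4] ++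
  [seq (4 * j, [:: nth 0 (nth [::] cycle_powers (i %% 3)) j], [::]) | j <- iota 0 4] ++
  [seq (j, [:: nth 0 (nth [::] cycle_powers 0) j], [::]) | j <- iota 0 4].
Definition rel_exact5 (e x y : nat) : bool := y == (digit 2 e + digit 1 e + digit 0 e + x) %% 4.

Lemma search_Ltravel : all (fun i =>
  search tuples3 lines3 (rels_Ltravel (Lstate i)) (4 ^ 3) (init_Ltravel (Lstate i)) (nth [::] script_Ltravel
  i)) (iota 0 16).
Proof. by vm_compute. Qed.

Lemma search_Vtravel : all (fun i =>
  search tuples3 lines3 (rels_Vtravel (Vstate i)) (4 ^ 3) (init_Vtravel (Vstate i)) (nth [::] script_Vtravel
  i)) (iota 0 16).
Proof. by vm_compute. Qed.
Lemma search_sporadic : all (fun i =>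
  search tuples3 lines3 [::] (4 ^ 3) (init_sporadic (nth [::] sporadic i)) (nth [::] script_sporadic i))
  (iota 0 78).
Proof. by vm_compute. Qed.
(** Only case 0, where all three axes consist of shifts, has a leaf; the scripts of the other eight
    cases contain none, so these are contradictory. *)
Lemma search_exact5 : all (fun i => search tuples3 lines3k [::
  rel_exact5] (4 ^ 3) (init_exact5 i) (nth [::] script_exact5 i)) (iota 0 9).
Proof. by vm_compute. Qed.

Local Open Scope ring_scope.

(** * Doubly stochastic matrices of order 4 *)

Definition o4 (i : nat) : 'I_4 := inord i.
Lemma I4_cases (P : 'I_4 -> Prop) : P (o4 0) -> P (o4 1) -> P (o4 2) -> P (o4 3) -> forall i, P i.
Proof.
move=> h0 h1 h2 h3 i; rewrite -[i]inord_val.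
by case: i => [[|[|[|[|//]]]] lt] /=.
Qed.
Lemma sum4 (V : nmodType) (f : 'I_4 -> V) : \sum_i f i = f (o4 0) + f (o4 1) + f (o4 2) + f (o4 3).
Proof.
rewrite !big_ord_recl big_ord0 addr0 !addrA.
by do !congr (_ + _); congr (f _); apply: val_inj; rewrite /= inordK.
Qed.

Definition doubly_stochastic (R : realFieldType) (W : 'I_4 -> 'I_4 -> R) : Prop :=
  [/\ forall x y, 0 <= W x y, forall x, \sum_y W x y = 1 & forall y, \sum_x W x y = 1].

(** Frobenius-Koenig for order 3, over all 512 patterns: the obstructions are the zero rectangles of
    sizes 1 x 3, 3 x 1 and 2 x 2. Indices start at 1 because row and column 0 are to be deleted. *)
Lemma frobenius_koenig3 (b : nat -> nat -> bool) :
  has (fun p => [&& b 1 (nth 0 p 1), b 2 (nth 0 p 2) & b 3 (nth 0 p 3)])%N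
    [:: [:: 0;1;2;3]; [:: 0;1;3;2]; [:: 0;2;1;3]; [:: 0;2;3;1]; [:: 0;3;1;2]; [:: 0;3;2;1]]%N
  \/ [\/ exists2 i, i \in [:: 1; 2; 3] & [&& ~~ b i 1, ~~ b i 2 & ~~ b i 3],
      exists2 j, j \in [:: 1; 2; 3] & [&& ~~ b 1 j, ~~ b 2 j & ~~ b 3 j]
    | exists2 p, p \in allpairs pair [:: (1, 2); (1, 3); (2, 3)] [:: (1, 2); (1, 3); (2, 3)]
      & [&& ~~ b p.1.1 p.2.1, ~~ b p.1.1 p.2.2, ~~ b p.1.2 p.2.1 & ~~ b p.1.2 p.2.2]]%N.
Proof.
have: has (fun p => [&& b 1 (nth 0 p 1), b 2 (nth 0 p 2) & b 3 (nth 0 p 3)])%N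
    [:: [:: 0;1;2;3]; [:: 0;1;3;2]; [:: 0;2;1;3]; [:: 0;2;3;1]; [:: 0;3;1;2]; [:: 0;3;2;1]]%N
  || [|| has (fun i => [&& ~~ b i 1, ~~ b i 2 & ~~ b i 3]) [:: 1; 2; 3],
      has (fun j => [&& ~~ b 1 j, ~~ b 2 j & ~~ b 3 j]) [:: 1; 2; 3]
    | has (fun p => [&& ~~ b p.1.1 p.2.1, ~~ b p.1.1 p.2.2, ~~ b p.1.2 p.2.1 & ~~ b p.1.2 p.2.2])
      (allpairs pair [:: (1, 2); (1, 3); (2, 3)] [:: (1, 2); (1, 3); (2, 3)])]%N.
  rewrite /=; case: (b 1 1)%N (b 1 2)%N (b 1 3)%N (b 2 1)%N (b 2 2)%N (b 2 3)%N (b 3 1)%N (b 3 2)%N (b 3 3)%N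
    => [] [] [] [] [] [] [] [] [] //.
case/orP => [->|/or3P [/hasP [i hi h]|/hasP [j hj h]|/hasP [p hp h]]]; first by left.
- by right; apply: Or31; exists i.
- by right; apply: Or32; exists j.
- by right; apply: Or33; exists p.
Qed.

(** A zero rectangle in the minor without row and column 0 would make the corner vanish: an empty
    row puts weight 1 into column 0, an empty column puts weight 1 into row 0, and for an empty 2 x
    2 block two rows fill column 0 and one further column completely. *)
Lemma birkhoff0 (R : realFieldType) (W : 'I_4 -> 'I_4 -> R) : doubly_stochastic W ->
  0 < W (o4 0) (o4 0) -> exists2 f : 'I_4 -> 'I_4, injective f & f (o4 0) = o4 0 /\ forall x, 0 < W x (f x).
Proof.
move=> [W0 Wr Wc] p00.
have Z i j : ~~ (0 < W i j) -> W i j = 0 by rewrite lt_neqAle W0 andbT negbK => /eqP.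
have rS i : W i (o4 0) + W i (o4 1) + W i (o4 2) + W i (o4 3) = 1 by rewrite -(Wr i) sum4.
have cS i : W (o4 0) i + W (o4 1) i + W (o4 2) i + W (o4 3) i = 1 by rewrite -(Wc i) sum4.
have R0 := rS (o4 0); have R1 := rS (o4 1); have R2 := rS (o4 2); have R3 := rS (o4 3).
have C0 := cS (o4 0); have C1 := cS (o4 1); have C2 := cS (o4 2); have C3 := cS (o4 3).
have N00 := W0 (o4 0) (o4 0); have N01 := W0 (o4 0) (o4 1); have N02 := W0 (o4 0) (o4 2);
  have N03 := W0 (o4 0) (o4 3).
have N10 := W0 (o4 1) (o4 0); have N11 := W0 (o4 1) (o4 1); have N12 := W0 (o4 1) (o4 2);
  have N13 := W0 (o4 1) (o4 3).
have N20 := W0 (o4 2) (o4 0); have N21 := W0 (o4 2) (o4 1); have N22 := W0 (o4 2) (o4 2);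
  have N23 := W0 (o4 2) (o4 3).
have N30 := W0 (o4 3) (o4 0); have N31 := W0 (o4 3) (o4 1); have N32 := W0 (o4 3) (o4 2);
  have N33 := W0 (o4 3) (o4 3).
case: (frobenius_koenig3 (fun i j => 0 < W (o4 i) (o4 j))) => [/hasP [p pin /and3P [h1 h2 h3]]|].
  exists (fun i => o4 (nth 0 p i)%N).
    have: all (fun p => uniq p && (size p == 4) && all (fun x => x < 4)%N p) [:: [:: 0;1;2;3]; [:: 0;1;3;2];
      [:: 0;2;1;3]; [:: 0;2;3;1]; [:: 0;3;1;2]; [:: 0;3;2;1]]%N by [].
    move=> /allP /(_ p pin) /andP [/andP [up /eqP sp] /allP lp] i j /(f_equal val);
      rewrite /= !inordK ?lp ?mem_nth ?sp //.
    by move/eqP; rewrite nth_uniq ?sp // => /eqP /val_inj.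
  have p0 : nth 0%N p 0 = 0%N by move: pin; rewrite !inE; do ?[case/orP]; move/eqP->.
  split=> [|]; first by rewrite inordK // p0.
  by apply: I4_cases; rewrite inordK // p0.
case=> [[i]|[j]|[[[i i'] [j j']]]].
- by rewrite !inE => /or3P [] /eqP -> /and3P [/Z h1 /Z h2 /Z h3]; exfalso; lra.
- by rewrite !inE => /or3P [] /eqP -> /and3P [/Z h1 /Z h2 /Z h3]; exfalso; lra.
- by rewrite /= !inE; do ?[case/orP]; case/eqP => -> -> -> -> /and4P [/Z h1 /Z h2 /Z h3 /Z h4]; exfalso; lra.
Qed.

Lemma birkhoff (R : realFieldType) (W : 'I_4 -> 'I_4 -> R) (i j : 'I_4) : doubly_stochastic W ->
  0 < W i j -> exists2 f : 'I_4 -> 'I_4, injective f & f i = j /\ forall x, 0 < W x (f x).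
Proof.
move=> [W0 Wr Wc] pij.
pose a := tperm (o4 0) i; pose b := tperm (o4 0) j.
case: (@birkhoff0 R (fun x y => W (a x) (b y))).
- split=> // x.
  + by rewrite -(Wr (a x)); apply/esym/reindex_inj/perm_inj.
  + by rewrite -(Wc (b x)); apply/esym/reindex_inj/perm_inj.
- by rewrite /a /b !tpermL.
move=> f injf [f0 pf]; exists (fun x => b (f (a x))).
  by move=> x y /perm_inj /injf /perm_inj.
split; first by rewrite /a tpermR f0 /b tpermL.
by move=> x; have := pf (a x); rewrite tpermK.
Qed.

Definition pp (t : nat) (x : 'I_4) : 'I_4 := inord (papp t x).

Lemma papp_lt t x : (t < 24)%N -> (x < 4)%N -> (papp t x < 4)%N.
Proof.
have /allP h : all (fun t => all (fun x => papp t x < 4)%N (iota 0 4)) (iota 0 24) by [].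
by move=> ht hx; have /allP := h t ltac:(by rewrite mem_iota); apply; rewrite mem_iota.
Qed.

Lemma pp_val t x : (t < 24)%N -> pp t x = papp t x :> nat.
Proof. by move=> ht; rewrite inordK // papp_lt. Qed.

Lemma pp_inj t : (t < 24)%N -> injective (pp t).
Proof.
have /allP h : all (fun t => uniq (map (papp t) (iota 0 4))) (iota 0 24) by [].
move=> ht x y /(f_equal val); rewrite /= !pp_val // => e; apply: val_inj => /=.
have := h t ltac:(by rewrite mem_iota); move: e; case: x y => [[|[|[|[|//]]]] ?] [[|[|[|[|//]]]] ?] //= ->;
  rewrite /= ?inE ?eqxx ?orbT ?andbF //=.
Qed.

Lemma pp_surj (f : 'I_4 -> 'I_4) : injective f -> exists2 t, (t < 24)%N & pp t =1 f.
Proof.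
move=> injf; pose l := [:: f (o4 0) : nat; f (o4 1) : nat; f (o4 2) : nat; f (o4 3) : nat].
have ne x y : x != y -> (f (o4 x) : nat) != f (o4 y) \/ o4 x = o4 y.
  move=> _; case: (eqVneq (o4 x) (o4 y)) => h; [by right | left].
  by apply: contra_neq h => /val_inj /injf.
have n4 x y : (x < 4)%N -> (y < 4)%N -> x != y -> (f (o4 x) : nat) != f (o4 y).
  move=> hx hy xy; case: (ne x y xy) => // /(f_equal val); rewrite /= !inordK // => e.
  by rewrite e eqxx in xy.
have lin : l \in perms4.
  rewrite /l; have := n4 0%N 1%N isT isT isT; have := n4 0%N 2%N isT isT isT; have := n4 0%N 3%N isT isT isT.
  have := n4 1%N 2%N isT isT isT; have := n4 1%N 3%N isT isT isT; have := n4 2%N 3%N isT isT isT.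
  case: (f (o4 0)) (f (o4 1)) (f (o4 2)) (f (o4 3)) =>
    [[|[|[|[|//]]]] ?] [[|[|[|[|//]]]] ?] [[|[|[|[|//]]]] ?] [[|[|[|[|//]]]] ?] //.
exists (index l perms4); first by rewrite -[24%N]/(size perms4) index_mem.
by move=> x; rewrite /pp /papp nth_index // /l; move: x; apply: I4_cases; rewrite inordK //= inord_val.
Qed.

Lemma testbit_perm_mask t x y : (t < 24)%N -> (x < 4)%N -> (y < 4)%N ->
  N.testbit (perm_mask t) (cell x y) = (papp t x == y).
Proof.
have /allP h : all (fun t => all (fun x => all (fun y =>
  N.testbit (perm_mask t) (cell x y) == (papp t x == y)) (iota 0 4)) (iota 0 4)) (iota 0 24) by vm_compute.
move=> ht hx hy; have /allP h1 := h t ltac:(by rewrite mem_iota).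
by have /allP h2 := h1 x ltac:(by rewrite mem_iota); apply/eqP/h2; rewrite mem_iota.
Qed.

Lemma testbit_perm_mask_lt t c : (t < 24)%N -> N.testbit (perm_mask t) c -> exists x y, [/\ (x < 4)%N,
  (y < 4)%N & c = cell x y].
Proof.
have /allP h : all (fun t => N.eqb (N.land (perm_mask t) 65535) (perm_mask t)) (iota 0 24) by vm_compute.
move=> ht; have /N.eqb_spec <- := h t ltac:(by rewrite mem_iota).
rewrite N.land_spec => /andP [_]; case: (ltnP (N.to_nat c) 16) => lt16 hc.
  exists (N.to_nat c %/ 4)%N, (N.to_nat c %% 4)%N; split; [lia|lia|].
  by rewrite /cell; lia.
move: hc; rewrite -(N2Nat.id c); rewrite N.bits_above_log2 //; first by rewrite N2Nat.id /=; lia.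
Qed.

Lemma rainbow_tableE : rainbow_table = [seq [seq [seq rainbow_mask a b c | c <- perms4] | b <- perms4]
  | a <- perms4].
Proof. by vm_compute. Qed.

(** [r] gives the rows used in the four slices; the last one is the row x of the cell itself. *)
Lemma rainbow_getP a b c x y : (a < 24)%N -> (b < 24)%N -> (c < 24)%N -> (x < 4)%N -> (y < 4)%N ->
  N.testbit (rainbow_get a b c) (cell x y) ->
  exists2 r, (r < 24)%N & papp r 3 = x /\ uniq [:: papp a (papp r 0); papp b (papp r 1); papp c (papp r 2);
    y].
Proof.
move=> ha hb hc hx hy; rewrite /rainbow_get rainbow_tableE.
rewrite (nth_map [::]) // (nth_map [::]) // (nth_map [::]) //.
have: forall r, r \in perms4 -> N.testbit (rainbow_cell (nth [::] perms4 a) (nth [::] perms4 b) (nth [::]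
  perms4 c) r) (cell x y) ->
   nth 0%N r 3 = x /\ uniq [:: papp a (nth 0%N r 0); papp b (nth 0%N r 1); papp c (nth 0%N r 2); y].
  move=> r rin; rewrite /rainbow_cell -!/(papp _ _).
  have /allP hr : all (fun r => (size r == 4) && all (fun x => x < 4)%N r) perms4 by [].
  have /andP [/eqP sr /allP lr] := hr r rin.
  have A i : (i < 4)%N -> (nth 0%N r i < 4)%N by move=> hi; rewrite lr // mem_nth // sr.
  have := papp_lt ha (A 0%N isT); have := papp_lt hb (A 1%N isT); have := papp_lt hc (A 2%N isT);
    have := A 3%N isT.
  move: (papp a _) (papp b _) (papp c _) (nth 0%N r 3) => u v w z.
  case: ifP => [|/negbT]; first by rewrite N.bits_0.
  rewrite !negb_or => /andP [/andP [h1 h2] h3] hz hw hv hu.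
  rewrite N.shiftl_1_l N.pow2_bits_eqb => /N.eqb_spec; rewrite /cell => e.
  split; [lia|]; rewrite /= !inE !negb_or h1 h2 h3 /=; lia.
rewrite /rainbow_mask => H; set q := rainbow_cell _ _ _ in H *.
have: forall l, N.testbit (foldr (fun r m => N.lor (q r) m) 0%num l) (cell x y) ->
    exists2 r, r \in l & N.testbit (q r) (cell x y).
  elim=> [|r l IH]; first by rewrite N.bits_0.
  rewrite N.lor_spec => /orP [h|/IH [r' r'l h]]; first by exists r; rewrite ?mem_head.
  by exists r'; rewrite // inE r'l orbT.
move=> /[apply] -[r rin /(H r rin) h].
exists (index r perms4); first by rewrite -[24%N]/(size perms4) index_mem.
by rewrite /papp (nth_index [::] rin).
Qed.

(** * The slices of an array as a model of the constraints *)

Section Model.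
Variables (R : realFieldType) (m : nat) (W : nat -> 'I_4 -> 'I_4 -> R).
Hypothesis dsW : forall e, doubly_stochastic (W e).
Definition rainbow_free : Prop := forall i : 'I_4 -> nat, (forall k, i k < 4 ^ m)%N ->
  (forall j, (j < m)%N -> injective (fun k => digit j (i k))) ->
  forall x y : 'I_4 -> 'I_4, injective x -> injective y -> ~ (forall k, 0 < W (i k) (x k) (y k)).
Hypothesis rfW : rainbow_free.
Variables (tuples : seq (seq (nat * nat * nat))) (lines : seq (nat * nat * nat * nat)).

Definition pos (e t : nat) : bool := [&& (e < 4 ^ m)%N, (t < 24)%N & [forall x, 0 < W e x (pp t x)]].

Definition tuples_ok : bool := all (fun e => all (fun o : nat * nat * nat => let: (u, v, w) := o in
    all (fun i => i < 4 ^ m)%N [:: e; u; v; w] && all (fun j => uniq (map (digit j) [:: e; u; v;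
      w])) (iota 0 m))
  (nth [::] tuples e)) (iota 0 (size tuples)).
Hypothesis tok : tuples_ok.

Hypothesis lok : forall i0 i1 i2 i3, (i0, i1, i2, i3) \in lines ->
  [/\ uniq [:: i0; i1; i2; i3], all (fun i => i < 4 ^ m)%N [:: i0; i1; i2; i3]
    & forall x y, W i0 x y + W i1 x y + W i2 x y + W i3 x y = 1].

Lemma pos_cell e x y : (e < 4 ^ m)%N -> 0 < W e x y -> exists2 t, pos e t & pp t x = y.
Proof.
move=> he /(birkhoff (dsW e)) [f /pp_surj [t ht ef] [fx pf]].
by exists t; rewrite ?ef // /pos he ht; apply/forallP => z; rewrite ef.
Qed.

Lemma pos_dom e t : pos e t -> (t < 24)%N.
Proof. by case/and3P. Qed.

Lemma rainbow_perms (e u v w t a b c : nat) : 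
  all (fun i => i < 4 ^ m)%N [:: e; u; v; w] -> all (fun j => uniq (map (digit j) [:: e; u; v;
    w])) (iota 0 m) ->
  pos e t -> pos u a -> pos v b -> pos w c -> N.land (perm_mask c) (rainbow_get t a b) = 0%num.
Proof.
move=> hl hd pe pu pv pw; apply/N.bits_inj => i; rewrite N.land_spec N.bits_0.
apply: negbTE; apply/negP => /andP [bc bq].
have [x [y [hx hy ei]]] := testbit_perm_mask_lt (pos_dom pw) bc.
move: bc bq; rewrite {}ei testbit_perm_mask ?(pos_dom pw) // => /eqP ey.
move=> /(rainbow_getP (pos_dom pe) (pos_dom pu) (pos_dom pv) hx hy) [r hr [ex uy]].
pose s := [:: e; u; v; w]; pose ts := [:: t; a; b; c].
have P (k : 'I_4) : pos (nth 0%N s k) (nth 0%N ts k) by move: k => [[|[|[|[|//]]]] ?].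
have inj (f : 'I_4 -> nat) (l : seq nat) : size l = 4%N -> uniq l -> (forall k, f k = nth 0%N l k) ->
  injective f.
  by move=> sl ul fE k k'; rewrite !fE => /eqP; rewrite nth_uniq ?sl // => /eqP /val_inj.
apply: (@rfW (fun k => nth 0%N s k) _ _ (pp r) (fun k => pp (nth 0%N ts k) (pp r k))).
- by move=> k; have /allP := hl; apply; rewrite mem_nth.
- move=> j hj; have /allP /(_ j) := hd; rewrite mem_iota => /(_ hj) ul.
  by apply: (inj _ (map (digit j) s)) => // k; rewrite (nth_map 0%N).
- exact: pp_inj.
- move=> k k' /(f_equal val) /= ekk; move: (ekk).
  have D k0 : (nth 0%N ts k0 < 24)%N \/ (4 <= k0)%N.
    by case: (ltnP k0 4) => h; [left; apply: (pos_dom (P (Ordinal h)))|right].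
  have Dk (k0 : 'I_4) : (nth 0%N ts k0 < 24)%N by case: (D k0) => // h; move: (ltn_ord k0); rewrite ltnNge h.
  rewrite !pp_val ?Dk // => /eqP; set l := [:: _; _; _; _] in uy.
  have lE (k0 : 'I_4) : papp (nth 0%N ts k0) (papp r k0) = nth 0%N l k0.
    by move: k0 => [[|[|[|[|//]]]] ?] //=; rewrite ex.
  by rewrite !lE nth_uniq // => /eqP /val_inj.
- by move=> k; case/and3P: (P k) => _ _ /forallP.
Qed.

(** By [pos_cell] a cell is positive exactly when a positive permutation covers it, which translates
    the line sums. A cell covered in only one slice of a line has entry 1 there, so every positive
    permutation of that slice uses it. A cell used by all positive permutations of a slice is the
    only positive one in its row, so its entry is 1 and the other slices vanish there. *)
Lemma pos_model : model tuples lines pos (4 ^ m).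
Proof.
split.
- move=> e he; have [x [y hxy]] : exists x y, 0 < W e x y.
    have [W0 Wr _] := dsW e; exists (o4 0).
    apply/existsP; apply: contraT; rewrite negb_exists => /forallP h.
    have := Wr (o4 0); rewrite big1 => [|y _]; first by move/esym/eqP; rewrite oner_eq0.
    by have := h y; rewrite lt_neqAle W0 andbT negbK => /eqP.
  by have [t pt _] := pos_cell he hxy; exists t.
- by move=> e t /pos_dom.
- move=> e u v w t a b c hin pe pu pv pw.
  have [h|h] := ltnP e (size tuples); last by move: hin; rewrite nth_default.
  have /allP /(_ e) := tok; rewrite mem_iota => /(_ h) /allP /(_ _ hin) /andP [h1 h2].
  split; [exact: (rainbow_perms h1 h2)|..].
    apply: (@rainbow_perms e u w v) => //; first by move: h1 => /= /and5P [-> -> -> -> _].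
    by apply: sub_all h2 => j; rewrite /= !inE !negb_or; lia.
  apply: (@rainbow_perms e v w u) => //; first by move: h1 => /= /and5P [-> -> -> -> _].
  by apply: sub_all h2 => j; rewrite /= !inE !negb_or; lia.
- move=> i0 i1 i2 i3 hin s; have [us ls sumW] := lok hin.
  have sumS x y : \sum_(i <- s) W i x y = 1 by rewrite !big_cons big_nil addr0 !addrA sumW.
  have W0 e x y : 0 <= W e x y by case: (dsW e).
  have Z e x y : ~~ (0 < W e x y) -> W e x y = 0 by rewrite lt_neqAle W0 andbT negbK => /eqP.
  have ls' j : j \in s -> (j < 4 ^ m)%N by move: ls => /allP; apply.
  have nocov j (x y : 'I_4) : j \in s -> (forall t, pos j t -> ~~ N.testbit (perm_mask t) (cell x y)) ->
    W j x y = 0.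
    move=> js h; apply: Z; apply/negP => /(pos_cell (ls' j js)) [t pt ett]; have /negP [] := h t pt.
    by rewrite testbit_perm_mask ?(pos_dom pt) // -(pp_val x (pos_dom pt)) ett.
  have isone j t (x y : 'I_4) : pos j t -> W j x y = 1 -> pp t x = y.
    move=> /and3P [_ ht /forallP /(_ x) pt] w1; apply/eqP; apply: contraT => ne.
    have [_ Wr _] := dsW j; have := Wr x; rewrite (bigD1 y) //= (bigD1 (pp t x)) //= w1.
    set S := \sum_(_ | _) _; have S0 : 0 <= S by apply: sumr_ge0.
    by move=> e1; exfalso; clear -S0 e1 pt; lra.
  have c16 c : N.testbit 65535 c -> exists x y : 'I_4, c = cell x y.
    move=> hc; have lt16 : (N.to_nat c < 16)%N.
      rewrite ltnNge; apply/negP => ge; move: hc; rewrite -(N2Nat.id c) N.bits_above_log2 // N2Nat.id /=; lia.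
    exists (inord (N.to_nat c %/ 4)), (inord (N.to_nat c %% 4)); rewrite /cell !inordK; lia.
  split=> //.
  + move=> c /c16 [x [y ->]].
    have [j js pj] : exists2 j, j \in s & 0 < W j x y.
      apply/hasP; apply: contraT => /hasPn h; have := sumW x y.
      have hz i : i \in s -> W i x y = 0 by move=> hi; apply/Z/h.
      rewrite (hz i0) ?(hz i1) ?(hz i2) ?(hz i3) ?inE ?eqxx ?orbT // !addr0.
      by move/esym/eqP; rewrite oner_eq0.
    have [t pt ett] := pos_cell (ls' j js) pj.
    by exists j => //; exists t; rewrite ?testbit_perm_mask ?(pos_dom pt) // -(pp_val x (pos_dom pt)) ett.
  + move=> j c /c16 [x [y ->]] js h t pt.
    have w1 : W j x y = 1.
      rewrite -(sumS x y) (bigD1_seq j) //= big1_seq ?addr0 // => j' /andP [nj js'].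
      by apply: nocov => // t' pt'; apply: (h j').
    by rewrite testbit_perm_mask ?(pos_dom pt) // -(pp_val x (pos_dom pt)) (isone _ _ _ _ pt w1).
  + move=> j j' c js js' nj h t pt; apply/negP => tc.
    have [x' [y' [hx hy ec]]] := testbit_perm_mask_lt (pos_dom pt) tc.
    pose x : 'I_4 := Ordinal hx; pose y : 'I_4 := Ordinal hy.
    have pj' : 0 < W j' x y.
      have e : pp t x = y.
        apply: val_inj; rewrite /= pp_val ?(pos_dom pt) //=; apply/eqP.
        by rewrite -testbit_perm_mask ?(pos_dom pt) // -ec.
      by case/and3P: pt => _ _ /forallP /(_ x); rewrite e.
    have w1 : W j x y = 1.
      have [W0' Wr _] := dsW j; rewrite -(Wr x) (bigD1 y) //= big1 ?addr0 // => z nz.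
      apply: Z; apply/negP => /(pos_cell (ls' j js)) [t' pt' e']; have := h t' pt'.
      rewrite ec testbit_perm_mask ?(pos_dom pt') // -[x']/(val x) -(pp_val x (pos_dom pt')) e' => /eqP ez';
        have ez : z = y by apply: val_inj.
      by rewrite ez eqxx in nz.
    have /eqP := sumS x y; apply/negP; rewrite gt_eqF //.
    rewrite (bigD1_seq j) //= w1 ltrDl big_mkcond /= (bigD1_seq j') //= nj.
    by apply: ltr_wpDr => //; apply: sumr_ge0 => i _; case: ifP.
Qed.
End Model.

Section SearchRel.
Variables (R : realFieldType) (m : nat) (W : nat -> 'I_4 -> 'I_4 -> R).
Hypothesis dsW : forall e, doubly_stochastic (W e).
Hypothesis rfW : rainbow_free m W.
Variables (tuples : seq (seq (nat * nat * nat))) (js : seq nat) (rels : seq (nat -> nat -> nat -> bool)).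
Hypothesis tok : tuples_ok m tuples.
Hypothesis jsm : all (fun j => j < m)%N js.
Hypothesis lineW : forall j e x y, j \in js -> (e < 4 ^ m)%N -> digit j e = 0%N ->
  \sum_(i < 4) W (e + i * 4 ^ j)%N x y = 1.

Lemma lines_of_ok i0 i1 i2 i3 : (i0, i1, i2, i3) \in flatten [seq lines_of m j | j <- js] ->
  [/\ uniq [:: i0; i1; i2; i3], all (fun i => i < 4 ^ m)%N [:: i0; i1; i2; i3]
    & forall x y, W i0 x y + W i1 x y + W i2 x y + W i3 x y = 1].
Proof.
case/flattenP => l /mapP [j jin ->] /mapP [e];
  rewrite mem_filter mem_iota add0n => /andP [/eqP d0 /= lt] [-> -> -> ->].
have p4 : (0 < 4 ^ j)%N by rewrite expn_gt0.
have jm := allP jsm j jin.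
split.
- rewrite /= !inE !negb_or; lia.
- have e4 : (4 ^ m = 4 ^ j * 4 * 4 ^ (m - j.+1))%N by rewrite -expnSr -expnD subnKC.
  have : (e + 3 * 4 ^ j < 4 ^ m)%N.
    rewrite /digit in d0; have := divn_eq (e %/ 4 ^ j) 4; rewrite d0 addn0 => eq1.
    have := divn_eq e (4 ^ j); rewrite eq1; move: (ltn_pmod e p4) lt; rewrite e4.
    move: (e %/ 4 ^ j %/ 4)%N (4 ^ (m - j.+1))%N => q t; move: (e %% 4 ^ j)%N (4 ^ j)%N => r P ltr lt eE.
    have : (P * 4 * (q + 1) <= P * 4 * t)%N.
      rewrite leq_mul2l; apply/orP; right; rewrite addn1 ltnNge; apply/negP => tq.
      by have : (P * 4 * t <= P * 4 * q)%N; [rewrite leq_mul2l tq orbT | lia].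
    lia.
  by move=> h /=; lia.
- move=> x y; rewrite -(lineW x y jin lt d0) sum4 !inordK // mul0n addn0 mul1n //.
Qed.

(** Every positive entry lies on a positive permutation, so what the search proves about
    permutations holds for all positive entries. *)
Lemma search_rel lines (init : seq (nat * seq nat * seq nat)) scr :
  lines = flatten [seq lines_of m j | j <- js] ->
  (forall e l p, (e, l, p) \in init ->
    (forall t, pos m W e t -> t \in l) /\ (forall t, t \in p -> pos m W e t)) ->
  search tuples lines rels (4 ^ m) init scr ->
  exists2 i, (i < size rels)%N & forall e (x y : 'I_4), (e < 4 ^ m)%N -> 0 < W e x y ->
    nth (fun _ _ _ => false) rels i e x y.
Proof.
move=> lE hin hs.
have mF := pos_model dsW rfW tok (lines := lines).
have [i [lti hi]] := @search_sound tuples lines rels (pos m W) (4 ^ m)%N (mF ltac:(by move=> i0 i1 i2 i3;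
  rewrite lE; apply: lines_of_ok)) init scr
  ltac:(by move=> e t; rewrite /pos ltnNge => ->) hin hs.
exists i => // e x y he /(pos_cell dsW he) [t pt <-].
by rewrite (pp_val x (pos_dom pt)); apply: hi.
Qed.
End SearchRel.

Lemma perms_inP (P : nat -> nat -> bool) t : reflect ((t < 24)%N /\ forall x : 'I_4,
  P x (papp t x)) (t \in perms_in P).
Proof.
rewrite mem_filter mem_iota leq0n add0n andTb andbC; apply: (iffP andP) => -[lt h]; split=> //.
  by move=> x; have := allP h x; rewrite mem_iota ltn_ord; apply.
by apply/allP => x; rewrite mem_iota => lx; apply: (h (Ordinal lx)).
Qed.

Section Pos.
Variables (R : realFieldType) (m : nat) (W : nat -> 'I_4 -> 'I_4 -> R) (e : nat).
Hypothesis he : (e < 4 ^ m)%N.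
Lemma pos_perms_in (P : nat -> nat -> bool) : (forall x y : 'I_4, 0 < W e x y -> P x y) ->
  forall t, pos m W e t -> t \in perms_in P.
Proof.
move=> h t /and3P [_ ht /forallP pt]; apply/perms_inP; split=> // x.
by rewrite -pp_val //; apply: h.
Qed.
Lemma perms_in_pos (P : nat -> nat -> bool) : (forall x y : 'I_4, P x y -> 0 < W e x y) ->
  forall t, t \in perms_in P -> pos m W e t.
Proof.
move=> h t /perms_inP [ht pt]; rewrite /pos he ht; apply/forallP => x; apply: h.
by rewrite pp_val.
Qed.
End Pos.

Lemma tuples1_ok : tuples_ok 1 tuples1. Proof. by vm_compute. Qed.
Lemma tuples2_ok : tuples_ok 2 tuples2. Proof. by vm_compute. Qed.
Lemma tuples3_ok : tuples_ok 3 tuples3. Proof. by vm_compute. Qed.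

(** * Slices of a zero array *)

Section Upd.
Variables d n : nat.
Implicit Types (a : idx d n) (i j : 'I_d) (k l : 'I_n).
Lemma upd_same a i k : upd a i k i = k. Proof. by rewrite ffunE eqxx. Qed.
Lemma upd_other a i j k : j != i -> upd a i k j = a j. Proof. by rewrite ffunE => /negbTE ->. Qed.
Lemma upd_upd a i k l : upd (upd a i k) i l = upd a i l.
Proof. by apply/ffunP => j; rewrite !ffunE; case: eqP. Qed.
Lemma updC a i j k l : i != j -> upd (upd a i k) j l = upd (upd a j l) i k.
Proof. by move=> ij; apply/ffunP => h; rewrite !ffunE; case: eqP => // ->; rewrite eq_sym (negbTE ij). Qed.
Lemma upd_id a i : upd a i (a i) = a.
Proof. by apply/ffunP => h; rewrite !ffunE; case: eqP => // ->. Qed.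
End Upd.

Section Zero.
Variables (R : realType) (d : nat) (A : dmatrix R d 4).
Hypothesis pA : polystochastic A.
Implicit Types (X Y : {set 'I_d}) (r : idx d 4) (p : 'I_4 -> idx d 4).

(* Positions along a diagonal of the restriction to X of the array at r. *)
Definition ppath X r p : Prop :=
  (forall i, i \in X -> injective (fun k => p k i)) /\ (forall k i, i \notin X -> p k i = r i).

Definition zero X r : Prop := forall p, ppath X r p -> ~ (forall k, 0 < A (p k)).

Lemma line_sum (g : 'I_4 -> 'I_4) i r : injective g -> \sum_k A (upd r i (g k)) = 1.
Proof. by move=> ig; rewrite -(pA.2 i r); apply/esym/reindex_inj. Qed.

Section Slices.
Variables (X : {set 'I_d}) (r0 : idx d 4) (a b : 'I_d) (al be : 'I_4 -> 'I_4) (m : nat) (q : nat -> idx d 4).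
Hypotheses (zX : zero X r0) (aX : a \in X) (bX : b \in X) (ab : a != b) (ial : injective al) (ibe :
  injective be).
Hypothesis qoff : forall e i, i \notin X -> q e i = r0 i.
Hypothesis qon : forall i, i \in X -> i != a -> i != b ->
  exists j (g : 'I_4 -> 'I_4), [/\ (j < m)%N, injective g & forall e, q e i = g (o4 (digit j e))].

Definition slice e (x y : 'I_4) : R := A (upd (upd (q e) a (al x)) b (be y)).

Lemma slice_ds e : doubly_stochastic (slice e).
Proof.
split=> [x y|x|y]; rewrite /slice; first exact: pA.1.
  exact: line_sum.
by under eq_bigr do rewrite updC //; apply: line_sum.
Qed.

Lemma digit_lt j e : (digit j e < 4)%N. Proof. by rewrite ltn_mod. Qed.

(** Several coordinates may follow the same digit, as those of a diagonal do. Since distinct digits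
    give distinct values in each of them, a rainbow would be a positive diagonal of the restriction
    to X. *)
Lemma slice_rainbow_free : rainbow_free m slice.
Proof.
move=> i _ di x y ix iy pos; apply: (zX (p := fun k => upd (upd (q (i k)) a (al (x k))) b (be (y k)))) => //.
split=> [c cX k k'|k c cX]; rewrite !ffunE.
  case: eqP => [_ /ibe /iy //|/eqP cb]; case: eqP => [_ /ial /ix //|/eqP ca].
  have [j [g [jm ig qE]]] := qon cX ca cb; rewrite !qE => /ig /(f_equal val).
  by rewrite /= !inordK ?digit_lt //; apply: di.
rewrite (negbTE (memPnC cX _ bX)) (negbTE (memPnC cX _ aX)); exact: qoff.
Qed.

Lemma slice_line j E (g : 'I_4 -> 'I_4) e x y : E != a -> E != b -> injective g ->
  (forall k : 'I_4, q (e + k * 4 ^ j)%N = upd (q e) E (g k)) ->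
  \sum_(k < 4) slice (e + k * 4 ^ j)%N x y = 1.
Proof.
move=> Ea Eb ig h; rewrite /slice.
under eq_bigr => k _ do rewrite h (updC _ _ _ Ea) (updC _ _ _ Eb).
exact: line_sum.
Qed.

End Slices.
End Zero.

Lemma digit_line j j' e k : (k < 4)%N -> digit j e = 0%N ->
  digit j' (e + k * 4 ^ j) = if j' == j then k else digit j' e.
Proof.
move=> k4; rewrite /digit => d0; have p4 : (0 < 4 ^ j)%N by rewrite expn_gt0.
have eE := divn_eq e (4 ^ j); have rl := ltn_pmod e p4.
have qE := divn_eq (e %/ 4 ^ j) 4; rewrite d0 addn0 in qE.
move: (e %/ 4 ^ j %/ 4)%N qE => Q qE; case: eqP => [->|/eqP ne].
  by rewrite addnC divnMDl // qE addnC modnMDl modn_small.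
case: (ltngtP j j') ne => // h _.
  have -> : (4 ^ j' = 4 ^ j * (4 * 4 ^ (j' - j.+1)))%N by rewrite -expnS -expnD; congr (_ ^ _)%N; lia.
  rewrite !divnMA addnC divnMDl // qE; congr (_ %% 4)%N; congr (_ %/ _)%N.
  by rewrite addnC divnMDl // divn_small // addn0 mulnK.
have -> : (k * 4 ^ j = k * (4 ^ (j - j'.+1)) * 4 * 4 ^ j')%N by rewrite -!mulnA -expnS -expnD;
  congr (_ * 4 ^ _)%N; lia.
by rewrite divnDMl ?expn_gt0 // addnC modnMDl.
Qed.

Definition init_ok (R : realFieldType) m (W : nat -> 'I_4 -> 'I_4 -> R) (init :
  seq (nat * seq nat * seq nat)) : Prop :=
  forall e l p, (e, l, p) \in init -> (forall t, pos m W e t -> t \in l) /\ (forall t, t \in p ->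
    pos m W e t).

Lemma idx3_lt (k e l : 'I_4) : (16 * k + 4 * e + l < 4 ^ 3)%N.
Proof. by rewrite (_ : 4 ^ 3 = 64)%N //; have := ltn_ord k; have := ltn_ord l; have := ltn_ord e; lia. Qed.
Lemma idx2_lt (k l : 'I_4) : (4 * k + l < 4 ^ 2)%N.
Proof. by rewrite (_ : 4 ^ 2 = 16)%N //; have := ltn_ord k; have := ltn_ord l; lia. Qed.

Lemma digits3 (k e l : 'I_4) : [/\ digit 2 (16 * k + 4 * e + l) = k,
  digit 1 (16 * k + 4 * e + l) = e & digit 0 (16 * k + 4 * e + l) = l].
Proof.
rewrite /digit /= expn0 divn1 (_ : 4 ^ 2 = 16)%N // expn1.
have := ltn_ord k; have := ltn_ord e; have := ltn_ord l; split; lia.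
Qed.

(** * Searches with one, two or three index digits besides the slice coordinates *)

Section Systems.
Variables (R : realType) (d : nat) (A : dmatrix R d 4).
Hypothesis pA : polystochastic A.
Implicit Types (X Y : {set 'I_d}) (r : idx d 4) (p : 'I_4 -> idx d 4).
Variables (X : {set 'I_d}) (r0 : idx d 4) (zX : zero A X r0).
Let rel0 : nat -> nat -> nat -> bool := fun _ _ _ => false.

Lemma o4_val (i : 'I_4) : o4 i = i. Proof. exact: inord_val. Qed.

Section One.
Variables (L a b : 'I_d) (fl al be : 'I_4 -> 'I_4).
Hypotheses (LX : L \in X) (aX : a \in X) (bX : b \in X) (ab : a != b) (La : L != a) (Lb : L != b).
Hypotheses (ifl : injective fl) (ial : injective al) (ibe : injective be).
Hypothesis X3 : forall i, i \in X -> [|| i == L, i == a | i == b].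

Definition B1 (l x y : 'I_4) : R := A (upd (upd (upd r0 L (fl l)) a (al x)) b (be y)).
Definition W1 : nat -> 'I_4 -> 'I_4 -> R := slice A a b al be (fun e => upd r0 L (fl (o4 (digit 0 e)))).

Lemma W1E (l : 'I_4) x y : W1 l x y = B1 l x y.
Proof. by rewrite /W1 /slice /digit expn0 divn1 modn_small ?ltn_ord // o4_val. Qed.

Lemma search1 rels (init : seq (nat * seq nat * seq nat)) scr :
  init_ok 1 W1 init ->
  search tuples1 lines1 rels (4 ^ 1) init scr ->
  exists2 i, (i < size rels)%N & forall l x y : 'I_4, 0 < B1 l x y -> nth rel0 rels i l x y.
Proof.
move=> hi hs; have ds : forall e, doubly_stochastic (W1 e) by move=> e; apply: slice_ds.
have rf : rainbow_free 1 W1.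
  apply: (slice_rainbow_free zX) => // [e i iX|i iX ia ib].
    by rewrite upd_other //; apply: (memPnC iX).
  have := X3 iX; rewrite (negbTE ia) (negbTE ib) !orbF => /eqP ->.
  by exists 0%N, fl; split=> // e; rewrite upd_same.
have lw j e x y : j \in [:: 0%N] -> (e < 4 ^ 1)%N -> digit j e = 0%N ->
  \sum_(i < 4) W1 (e + i * 4 ^ j)%N x y = 1.
  rewrite inE => /eqP -> _ d0; apply: (@slice_line _ _ _ pA _ _ _ _ _ 0 L fl) => // k.
  by rewrite digit_line // eqxx o4_val upd_upd.
have [i lti h] := search_rel ds rf tuples1_ok (isT : all (fun j => j < 1)%N [:: 0%N]) lw (erefl :
  lines1 = _) hi hs.
by exists i => // l x y; rewrite -W1E; apply: h.
Qed.
End One.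

Section Two.
Variables (p : 'I_4 -> idx d 4) (L a b : 'I_d) (fl al be : 'I_4 -> 'I_4).
Hypotheses (LX : L \in X) (aX : a \in X) (bX : b \in X) (ab : a != b) (La : L != a) (Lb : L != b).
Hypotheses (ifl : injective fl) (ial : injective al) (ibe : injective be).
Hypothesis pX : forall i, i \in X -> i != L -> i != a -> i != b -> injective (fun k => p k i).
Hypothesis poff : forall k i, i \notin X -> p k i = r0 i.

Definition B2 (k l x y : 'I_4) : R := A (upd (upd (upd (p k) L (fl l)) a (al x)) b (be y)).
Definition W2 : nat -> 'I_4 -> 'I_4 -> R :=
  slice A a b al be (fun e => upd (p (o4 (digit 1 e))) L (fl (o4 (digit 0 e)))).

Lemma W2E (k l : 'I_4) x y : W2 (4 * k + l)%N x y = B2 k l x y.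
Proof.
rewrite /W2 /slice /digit expn0 divn1 expn1 mulnC divnMDl // divn_small ?addn0 //.
by rewrite modnMDl !modn_small ?ltn_ord // !o4_val.
Qed.

Lemma search2 rels (init : seq (nat * seq nat * seq nat)) scr :
  init_ok 2 W2 init ->
  search tuples2 lines2 rels (4 ^ 2) init scr ->
  exists2 i, (i < size rels)%N & forall k l x y : 'I_4, 0 < B2 k l x y -> nth rel0 rels i (4 * k + l)%N x y.
Proof.
move=> hi hs; have ds : forall e, doubly_stochastic (W2 e) by move=> e; apply: slice_ds.
have rf : rainbow_free 2 W2.
  apply: (slice_rainbow_free zX) => // [e i iX|i iX ia ib].
    by rewrite upd_other ?poff //; apply: (memPnC iX).
  case: (eqVneq i L) => [->|iL].
    by exists 0%N, fl; split=> // e; rewrite upd_same.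
  exists 1%N, (fun k => p k i); split=> // [|e]; first exact: pX.
  by rewrite upd_other.
have lw j e x y : j \in [:: 0%N] -> (e < 4 ^ 2)%N -> digit j e = 0%N ->
  \sum_(i < 4) W2 (e + i * 4 ^ j)%N x y = 1.
  rewrite inE => /eqP -> _ d0; apply: (@slice_line _ _ _ pA _ _ _ _ _ 0 L fl) => // k.
  by rewrite !digit_line //= o4_val upd_upd.
have [i lti h] := search_rel ds rf tuples2_ok (isT : all (fun j => j < 2)%N [:: 0%N]) lw (erefl :
  lines2 = _) hi hs.
by exists i => // k l x y; rewrite -W2E; apply: h; apply: idx2_lt.
Qed.
End Two.

Section Three.
Variables (p : 'I_4 -> idx d 4) (E L a b : 'I_d) (fe fl al be : 'I_4 -> 'I_4).
Hypotheses (EX : E \in X) (LX : L \in X) (aX : a \in X) (bX : b \in X).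
Hypothesis un : uniq [:: E; L; a; b].
Hypotheses (ife : injective fe) (ifl : injective fl) (ial : injective al) (ibe : injective be).
Hypothesis pX : forall i, i \in X -> i \notin [:: E; L; a; b] -> injective (fun k => p k i).
Hypothesis poff : forall k i, i \notin X -> p k i = r0 i.

Definition B3 (k e l x y : 'I_4) : R := A (upd (upd (upd (upd (p k) E (fe e)) L (fl l)) a (al x)) b (be y)).
Definition W3 : nat -> 'I_4 -> 'I_4 -> R :=
  slice A a b al be (fun e => upd (upd (p (o4 (digit 2 e))) E (fe (o4 (digit 1 e)))) L (fl (o4 (digit 0 e)))).

Lemma W3E (k e l : 'I_4) x y : W3 (16 * k + 4 * e + l)%N x y = B3 k e l x y.
Proof. by rewrite /W3 /slice; have [-> -> ->] := digits3 k e l; rewrite !o4_val. Qed.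

Let neq4 : [/\ [&& E != L, E != a & E != b], [&& L != a & L != b] & a != b].
Proof. by move: un; rewrite /= !inE !negb_or => /and4P [/and3P [-> -> ->] /andP [-> ->] ->]. Qed.

Lemma W3_ds e : doubly_stochastic (W3 e).
Proof. by case: neq4 => _ _ ab; apply: slice_ds. Qed.

Lemma W3_rf : rainbow_free 3 W3.
Proof.
have [/and3P [EL Ea Eb] /andP [La Lb] ab] := neq4.
apply: (slice_rainbow_free zX) => // [e i iX|i iX ia ib].
  by rewrite !upd_other ?poff //; apply: (memPnC iX).
case: (eqVneq i L) => [->|iL].
  by exists 0%N, fl; split=> // e; rewrite upd_same.
case: (eqVneq i E) => [->|iE].
  by exists 1%N, fe; split=> // e; rewrite upd_other // upd_same.
exists 2%N, (fun k => p k i); split=> // [|e].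
  by apply: pX => //; rewrite !inE !negb_or iE iL ia ib.
by rewrite !upd_other.
Qed.

Lemma W3_line j e x y : j \in [:: 0%N; 1%N] -> (e < 4 ^ 3)%N -> digit j e = 0%N ->
  \sum_(i < 4) W3 (e + i * 4 ^ j)%N x y = 1.
Proof.
have [/and3P [EL Ea Eb] /andP [La Lb] ab] := neq4.
rewrite !inE => /orP [] /eqP -> _ d0.
  apply: (@slice_line _ _ _ pA _ _ _ _ _ 0 L fl) => // k.
  by rewrite !digit_line //= o4_val upd_upd.
apply: (@slice_line _ _ _ pA _ _ _ _ _ 1 E fe) => // k.
by rewrite !digit_line //= o4_val [in RHS]updC 1?eq_sym // upd_upd.
Qed.

Lemma search3 rels (init : seq (nat * seq nat * seq nat)) scr :
  init_ok 3 W3 init ->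
  search tuples3 lines3 rels (4 ^ 3) init scr ->
  exists2 i, (i < size rels)%N & forall k e l x y : 'I_4, 0 < B3 k e l x y ->
    nth rel0 rels i (16 * k + 4 * e + l)%N x y.
Proof.
move=> hi hs.
have [i lti h] := search_rel W3_ds W3_rf tuples3_ok (isT : all (fun j => j < 3)%N [:: 0%N;
  1%N]) W3_line (erefl : lines3 = _) hi hs.
by exists i => // k e l x y; rewrite -W3E; apply: h; apply: idx3_lt.
Qed.

(** When the diagonal moves in the single coordinate K, its four positions form a line, so the line
    sums in the leading digit become available as well. *)
Lemma search3k rK K fK rels (init : seq (nat * seq nat * seq nat)) scr :
  K \notin [:: E; L; a; b] -> injective fK -> (forall k, p k = upd rK K (fK k)) ->
  init_ok 3 W3 init ->
  search tuples3 lines3k rels (4 ^ 3) init scr ->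
  exists2 i, (i < size rels)%N & forall k e l x y : 'I_4, 0 < B3 k e l x y ->
    nth rel0 rels i (16 * k + 4 * e + l)%N x y.
Proof.
move=> nK iK pE hi hs; have [/and3P [EL Ea Eb] /andP [La Lb] ab] := neq4.
move: nK; rewrite !inE !negb_or => /and4P [KE KL Ka Kb].
have lw j e x y : j \in [:: 0%N; 1%N;
  2%N] -> (e < 4 ^ 3)%N -> digit j e = 0%N -> \sum_(i < 4) W3 (e + i * 4 ^ j)%N x y = 1.
  rewrite -[[:: 0; 1; 2]%N]/([:: 0; 1]%N ++ [:: 2%N]) mem_cat => /orP [|]; first exact: W3_line.
  rewrite inE => /eqP -> _ d0; apply: (@slice_line _ _ _ pA _ _ _ _ _ 2 K fK) => // k.
  by rewrite !digit_line //= o4_val !pE [in RHS]updC 1?eq_sym // [in X in _ = upd X _ _]updC 1?eq_sym //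
    upd_upd.
have [i lti h] := search_rel W3_ds W3_rf tuples3_ok (isT : all (fun j => j < 3)%N [:: 0%N; 1%N;
  2%N]) lw (erefl : lines3k = _) hi hs.
by exists i => // k e l x y; rewrite -W3E; apply: h; apply: idx3_lt.
Qed.
End Three.
End Systems.

(** * Weights of an array with known support *)

Definition sw01 (y : 'I_4) : 'I_4 := tperm 0 1 y.

Lemma upto_swapE (t y : 'I_4) : upto_swap t y = (t == y) || (t == sw01 y).
Proof.
rewrite /upto_swap /sw01; congr (_ || _).
rewrite permE /=; case: y => [[|[|[|[|//]]]] hy] //=; rewrite -val_eqE /=; case: t => [[|[|[|[|//]]]] ht] //=.
Qed.

Lemma sw01K : involutive sw01. Proof. exact: tpermK. Qed.

Lemma I4E (x : 'I_4) : [|| x == 0, x == 1, x == 2%:R | x == 3%:R].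
Proof. by case: x => [[|[|[|[|//]]]] hx]. Qed.

Lemma I4_ind (P : 'I_4 -> Prop) : P 0 -> P 1 -> P 2%:R -> P 3%:R -> forall i, P i.
Proof. by move=> h0 h1 h2 h3 i; case/or4P: (I4E i) => /eqP ->. Qed.

Lemma sumI4 (V : nmodType) (f : 'I_4 -> V) : \sum_i f i = f 0 + f 1 + f 2%:R + f 3%:R.
Proof.
rewrite sum4; do !congr (_ + _); congr (f _); apply: val_inj; rewrite /= inordK //.
Qed.

Definition agree d n (X : {set 'I_d}) (r a : idx d n) : Prop := forall i, i \notin X -> a i = r i.

Lemma agree_upd d n (X : {set 'I_d}) (r a : idx d n) i k : i \in X -> agree X r a -> agree X r (upd a i k).
Proof. by move=> iX h j jX; rewrite upd_other ?h //; apply: (memPnC jX). Qed.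

Lemma agree_ind d n (X : {set 'I_d}) (r : idx d n) (P : idx d n -> Prop) : P r ->
  (forall a i k, i \in X -> agree X r a -> P a -> P (upd a i k)) -> forall a, agree X r a -> P a.
Proof.
move=> Pr Pupd a; have [m le_m] := ubnP #|[set i | a i != r i]|.
elim: m a le_m => // m IH a le_m h.
case: (pickP (fun i => a i != r i)) => [i ne|e0]; last first.
  by rewrite (_ : a = r) //; apply/ffunP => i; apply/eqP; have := e0 i => /= /negbFE.
have iX : i \in X by apply: contraR ne => /h ->.
rewrite -(upd_id a i) -(upd_upd a i (r i)).
have h' := agree_upd (r i) iX h; apply: Pupd => //; apply: IH => //.
rewrite -ltnS; apply: leq_trans le_m; apply: proper_card; apply/properP; split.
  by apply/subsetP => j; rewrite !inE; have [->|nj] := eqVneq j i; [rewrite ne | rewrite upd_other].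
by exists i; rewrite !inE ?ne // upd_same eqxx.
Qed.

Section Lambda.
Variables (R : realType) (d : nat) (A : dmatrix R d 4).
Hypothesis pA : polystochastic A.
Variables (X : {set 'I_d}) (r : idx d 4) (s : 'I_d) (phi : 'I_d -> 'S_4).

Definition tsum (a : idx d 4) : 'I_4 := \sum_(i in X | i != s) phi i (a i).

Lemma tsum_upd a i k : i \in X -> i != s -> tsum (upd a i k) = tsum a - phi i (a i) + phi i k.
Proof.
move=> iX is_; rewrite /tsum (bigD1 i) ?iX //= [in RHS](bigD1 i) ?iX //= upd_same.
rewrite [phi i (a i) + _]addrC addrK addrC; congr (_ + _); apply: eq_bigr => j /andP [_ ji].
by rewrite upd_other.
Qed.

Lemma tsum_upds a k : tsum (upd a s k) = tsum a.
Proof. by apply: eq_bigr => j /andP [_ js]; rewrite upd_other. Qed.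

Hypothesis sX : s \in X.
Hypothesis supp : forall a, agree X r a -> 0 < A a -> upto_swap (tsum a) (phi s (a s)).

Variable L : 'I_d.
Hypotheses (LX : L \in X) (Ls : L != s).

Lemma off_support a : agree X r a -> ~~ upto_swap (tsum a) (phi s (a s)) -> A a = 0.
Proof.
move=> h; apply: contraNeq => ne; apply: supp => //.
by rewrite lt_neqAle pA.1 eq_sym ne.
Qed.

(* The line through a in direction L meets each level of [tsum] once; [lam] and [lam'] are the values of A
   at level 0 and 1 with special coordinate 0. *)
Let sett a v := upd a L ((phi L)^-1%g (v - tsum a + phi L (a L))).
Let y0 := (phi s)^-1%g (0 : 'I_4).
Let lam a := A (sett (upd a s y0) 0).
Let lam' a := A (sett (upd a s y0) 1).

Lemma tsum_sett a v : tsum (sett a v) = v.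
Proof. by rewrite /sett tsum_upd // permKV; ring. Qed.

Lemma sett_id a : sett a (tsum a) = a.
Proof. by rewrite /sett subrr add0r permK upd_id. Qed.

Lemma perm_line (i : 'I_d) a : \sum_(v : 'I_4) A (upd a i ((phi i)^-1%g v)) = 1.
Proof. by apply: line_sum => //; apply: perm_inj. Qed.

Lemma lam_sum a : agree X r a -> lam a + lam' a = 1.
Proof.
move=> h; set a0 := upd a s y0; have h0 : agree X r a0 by apply: agree_upd.
have -> : 1 = \sum_v A (sett a0 v).
  rewrite -(perm_line L a0) (reindex_inj (addIr (- tsum a0 + phi L (a0 L)))) /=.
  by apply: eq_bigr => v _; rewrite addrA.
have Z (v : 'I_4) : ~~ upto_swap v (0%R : 'I_4) -> A (sett a0 v) = 0.
  move=> g; apply: off_support; first exact: agree_upd.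
  by rewrite tsum_sett /sett upd_other 1?eq_sym // upd_same permKV.
by rewrite sumI4 !(Z _%:R) // !addr0.
Qed.

(** On the line in direction i through the point counted by [lam a] only levels 0 and 1 are
    supported. Its point at level 1 is the one counted by [lam'] at the shifted index, so both
    values of [lam] are 1 minus the same number. *)
Lemma lam_step a i : agree X r a -> i \in X -> i != s -> i != L ->
  lam (upd a i ((phi i)^-1%g (phi i (a i) + 1))) = lam a.
Proof.
move=> h iX is_ iL; set k1 := (phi i)^-1%g _.
have h' := agree_upd k1 iX h; apply: (addIr (lam' (upd a i k1))); rewrite lam_sum //.
have e1 : sett (upd (upd a i k1) s y0) 1 = upd (sett (upd a s y0) 0) i k1.
  have Li : L != i by rewrite eq_sym.
  have si : s != i by rewrite eq_sym.
  rewrite /sett (updC _ _ _ Li) (updC _ _ _ si); congr (upd _ L _); congr (fun_of_perm _ _).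
  rewrite !tsum_upds tsum_upd // !(upd_other _ _ Ls) (upd_other _ _ Li) permKV; ring.
rewrite /lam' e1 /lam; set a0 := sett _ 0.
have ha0 : agree X r a0 by do 2!apply: agree_upd => //.
have ai : a0 i = a i by rewrite /a0 /sett !upd_other // eq_sym.
have t0 : tsum a0 = 0 by rewrite tsum_sett.
have as0 : phi s (a0 s) = 0 by rewrite /a0 /sett upd_other 1?eq_sym // upd_same permKV.
have Z (v : 'I_4) : ~~ upto_swap v (0%R : 'I_4) -> A (upd a0 i ((phi i)^-1%g (phi i (a0 i) + v))) = 0.
  move=> g; apply: off_support; first exact: agree_upd.
  by rewrite tsum_upd // upd_other 1?eq_sym // as0 permKV t0 sub0r addKr.
rewrite -(perm_line i a0) (reindex_inj (addrI (phi i (a0 i)))) /= sumI4 addr0 permK upd_id.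
by rewrite /k1 -ai !(Z _%:R) // !addr0.
Qed.

(** Changes of s or L are undone by the choice of the point on the line; a change of any other
    coordinate is a repeated shift of its label by 1. *)
Lemma lam_const a : agree X r a -> lam a = lam r.
Proof.
move: a; apply: (@agree_ind _ _ X) => // a i k iX h <-.
case: (eqVneq i s) => [->|is_]; first by rewrite /lam upd_upd.
case: (eqVneq i L) => [->|iL].
  rewrite /lam /sett (updC _ _ _ Ls) upd_upd; congr (A (upd _ L _)); congr (fun_of_perm _ _).
  by rewrite tsum_upd // upd_same; ring.
have st j : lam (upd a i ((phi i)^-1%g (phi i (a i) + j%:R))) = lam a.
  elim: j => [|j IH]; first by rewrite addr0 permK upd_id.
  have h' := agree_upd ((phi i)^-1%g (phi i (a i) + j%:R)) iX h.
  by have := lam_step h' iX is_ iL; rewrite upd_upd upd_same permKV -addrA -natr1 IH => ->.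
rewrite -(st (val (phi i k - phi i (a i)))); congr (lam (upd _ _ _)).
by rewrite [(val _)%:R](_ : _ = phi i k - phi i (a i)) ?Zp_nat ?valZpK // addrC subrK permK.
Qed.

(** The two constants give all entries with special label 0. For t = 0 and t = 1 the line in
    direction s has one further supported cell, which receives the rest; for t = 2 and t = 3 the
    labels y = t and pi y = t coincide, the entry is 1 and both terms contribute. *)
Lemma lambda_form : exists2 l : R, 0 <= l <= 1 & forall a, agree X r a ->
  A a = l * (tsum a == phi s (a s))%:R + (1 - l) * (tsum a == sw01 (phi s (a s)))%:R.
Proof.
exists (lam r).
  have := lam_sum (fun i _ => erefl); have := pA.1 (sett (upd r s y0) 0); have := pA.1 (sett (upd r s y0) 1).
  rewrite -/(lam r) -/(lam' r); lra.
have E0 a : agree X r a -> phi s (a s) = 0 -> upd a s y0 = a.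
  by move=> h e; rewrite /y0 -e permK upd_id.
have Y0 a : agree X r a -> phi s (a s) = 0 -> tsum a = 0 -> A a = lam r.
  by move=> h e t; rewrite -(lam_const h) /lam (E0 a h e) -t sett_id.
have Y1 a : agree X r a -> phi s (a s) = 0 -> tsum a = 1 -> A a = 1 - lam r.
  move=> h e t; rewrite -(lam_const h) -(lam_sum h) addrC addKr.
  by rewrite /lam' (E0 a h e) -t sett_id.
have SL a : agree X r a -> A (upd a s ((phi s)^-1%g 0)) + A (upd a s ((phi s)^-1%g 1)) +
    A (upd a s ((phi s)^-1%g 2%:R)) + A (upd a s ((phi s)^-1%g 3%:R)) = 1.
  by move=> _; rewrite -[RHS](perm_line s a) sumI4.
have Z a (v : 'I_4) : agree X r a -> ~~ upto_swap (tsum a) v -> A (upd a s ((phi s)^-1%g v)) = 0.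
  by move=> h g; apply: off_support; rewrite ?tsum_upds ?upd_same ?permKV //; apply: agree_upd.
move=> a h; have := SL a h.
have ea : a = upd a s ((phi s)^-1%g (phi s (a s))) by rewrite permK upd_id.
have h0 := agree_upd ((phi s)^-1%g 0) sX h.
have Y0' := Y0 _ h0; have Y1' := Y1 _ h0.
rewrite upd_same permKV tsum_upds in Y0' Y1'.
have Z0 := Z a 0 h; have Z1 := Z a 1 h; have Z2 := Z a 2%:R h; have Z3 := Z a 3%:R h.
rewrite {5}ea.
move: Y0' Y1' Z0 Z1 Z2 Z3; move: (tsum a) (phi s (a s)) => t y.
move: t y; apply: I4_ind; apply: I4_ind; rewrite /sw01 !permE /= => Y0' Y1' Z0 Z1 Z2 Z3.
all: rewrite ?mulr1 ?mulr0 ?addr0 ?add0r.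
all: try rewrite (Y0' erefl erefl); try rewrite (Y1' erefl erefl); try rewrite (Z0 isT);
  try rewrite (Z1 isT); try rewrite (Z2 isT); try rewrite (Z3 isT).
all: try lra.
Qed.
End Lambda.

(** * Three free coordinates *)

Lemma papp_perm t : (t < 24)%N -> exists g : 'S_4, forall x : 'I_4, papp t x = g x :> nat.
Proof. by move=> ht; exists (perm (pp_inj ht)) => x; rewrite permE pp_val. Qed.

Lemma add4E (x y : 'I_4) : add4 x y = (x + y : 'I_4) :> nat. Proof. by []. Qed.
Lemma sub4E (x y : 'I_4) : sub4 x y = (x - y : 'I_4) :> nat.
Proof. by rewrite /= modnDmr /sub4 addnBA // ltnW. Qed.

Lemma ds_perm (R : realFieldType) (W : 'I_4 -> 'I_4 -> R) : doubly_stochastic W ->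
  exists f : 'S_4, forall x, 0 < W x (f x).
Proof.
move=> ds; have [W0 Wr _] := ds.
have /existsP [y py] : [exists y, 0 < W (o4 0) y].
  apply: contraT; rewrite negb_exists => /forallP h.
  have := Wr (o4 0); rewrite big1 => [|y _]; first by move/esym/eqP; rewrite oner_eq0.
  by have := h y; rewrite lt_neqAle W0 andbT negbK => /eqP.
have [f injf [_ pf]] := birkhoff ds py.
by exists (perm injf) => x; rewrite permE.
Qed.

Section Support.
Variables (R : realType) (d : nat) (A : dmatrix R d 4).
Hypothesis pA : polystochastic A.
Implicit Types (X : {set 'I_d}) (r a : idx d 4).

Definition supptype X r : Prop := exists (s : 'I_d) (phi : 'I_d -> 'S_4), s \in X /\
  forall a, agree X r a -> 0 < A a -> upto_swap (tsum X s phi a) (phi s (a s)).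

Lemma supptype3 X r (u v s : 'I_d) (gu gv gs : 'S_4) :
  X = [set u; v; s] -> u != v -> u != s -> v != s ->
  (forall a, agree X r a -> 0 < A a -> upto_swap (gu (a u) + gv (a v))%R (gs (a s))) -> supptype X r.
Proof.
move=> XE uv us vs h; exists s, (fun i => if i == u then gu else if i == v then gv else gs).
split; first by rewrite XE !inE eqxx orbT.
move=> a ag pa; have := h a ag pa.
rewrite [s == u]eq_sym (negbTE us) [s == v]eq_sym (negbTE vs).
suff E : tsum X s (fun i => if i == u then gu else if i == v then gv else gs) a = gu (a u) + gv (a v) by
  rewrite E.
rewrite /tsum (bigD1 u) /=; last by rewrite XE !inE eqxx us.
rewrite (bigD1 v) /=; last by rewrite XE !inE eqxx vs orbT /= eq_sym.
rewrite eqxx [v == u]eq_sym (negbTE uv) eqxx big1 ?addr0 // => i; rewrite XE !inE.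
by case: (i == u); case: (i == v); case: (i == s).
Qed.

Lemma search_row : search tuples1 lines1 (map rel_row par_row) (4 ^ 1) [:: (0, iota 0 24, [::
  0])]%N script_row.
Proof. by vm_compute. Qed.

(** A positive permutation [f] of one slice is absorbed into the labels of b, so that the search may
    start from a slice containing the identity. The value s in the relation found says which of b,
    a, L is the special coordinate. *)
Lemma supptype_card3 X r : #|X| = 3%N -> zero A X r -> supptype X r.
Proof.
move=> X3 zX; have : size (enum X) = 3%N by rewrite -cardE.
case eX : (enum X) => [|L [|a [|b [|]]]] // _.
have := enum_uniq X; rewrite eX /= !inE !negb_or => /and3P [/andP [La Lb] ab _].
have XE : X = [set L; a; b] by apply/setP => i; rewrite -mem_enum eX !inE orbA.
have [LX aX bX] : [/\ L \in X, a \in X & b \in X] by rewrite XE !inE !eqxx !orbT.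
have X3' i : i \in X -> [|| i == L, i == a | i == b] by rewrite XE !inE orbA.
have id_inj : injective (@id 'I_4) by [].
have [f pf] : exists f : 'S_4, forall x, 0 < W1 A r L a b id id id 0 x (f x).
  by apply: ds_perm; apply: slice_ds.
have := @search1 _ _ A pA X r zX L a b id id f LX aX bX ab La Lb id_inj id_inj (@perm_inj _ f) X3' _ _ _ _
  search_row.
case=> [e l p|i]; rewrite ?inE.
  case/eqP => -> -> ->; split=> [t /pos_dom lt24|t]; first by rewrite -[_ \in _]/(t \in iota 0 24) mem_iota.
  rewrite inE => /eqP ->; apply/and3P; split=> //; apply/forallP => x.
  have -> : pp 0 x = x by apply: val_inj; rewrite /= pp_val //; case: x => [[|[|[|[|//]]]] ?].
  exact: pf.
rewrite size_map => lti h.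
case ep: (nth (0, 0, 0, 0)%N par_row i) => [[[s il] ix] iy].
have /allP ok : all (fun p => [&& p.1.1.2 < 24, p.1.2 < 24 & p.2 < 24])%N par_row by [].
have := ok _ (mem_nth (0, 0, 0, 0)%N lti);
  rewrite ep /= => /and3P [/papp_perm [gl Hl] /papp_perm [gx Hx] /papp_perm [gy Hy]].
have H c : agree X r c -> 0 < A c ->
  if s == 0%N then upto_swap (gl (c L) + gx (c a))%R ((f^-1 * gy)%g (c b)) else
     if s == 1%N then upto_swap (gl (c L) + (f^-1 * gy)%g (c b))%R (gx (c a)) else upto_swap (gx (c a) +
       (f^-1 * gy)%g (c b))%R (gl (c L)).
  move=> ag pc; have := h (c L) (c a) ((f^-1)%g (c b)).
  rewrite /B1 permKV (nth_map (0, 0, 0, 0)%N) // ep /rel_row Hl Hx Hy !add4E permM; apply.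
  suff -> : upd (upd (upd r L (c L)) a (c a)) b (c b) = c by [].
  apply/ffunP => j; rewrite !ffunE; case: eqP => [-> //|/eqP jb]; case: eqP => [-> //|/eqP ja];
    case: eqP => [-> //|/eqP jL].
  by rewrite ag // XE !inE !negb_or jL ja.
case s0: (s == 0%N) in H; first by apply: (supptype3 XE La Lb ab H).
case s1: (s == 1%N) in H.
  by apply: (@supptype3 X r L b a _ _ _ _ Lb La _ H); rewrite 1?eq_sym // XE; apply/setP => j;
    rewrite !inE -!orbA; case: (j == L) => //=; rewrite orbC.
apply: (@supptype3 X r a b L _ _ _ _ ab _ _ H); rewrite 1?eq_sym // XE.
by apply/setP => j; rewrite !inE -!orbA orbC orbA.
Qed.
End Support.

(** * A positive slice of codimension two *)

Definition start (k : nat) : nat := nth 0%N [:: 0; 0; 3; 3]%N k.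

(* Four permutations fixing 0 admit a rainbow diagonal or can be brought to [start]: id, id, c, c with c a
   3-cycle. *)
Definition norm_ok (t : seq nat) : bool :=
  if has (fun r => uniq [seq papp (nth 0 t k) (papp r k) | k <- iota 0 4]) (iota 0 24) then true else
  has (fun kap => has (fun al => has (fun be => all (fun k => all (fun x =>
     papp (nth 0 t (papp kap k)) (papp al x) == papp be (papp (start k) x)) (iota 0 4)) (iota 0 4))
     (iota 0 6)) (iota 0 6)) (iota 0 24).

Lemma norm_all : all (fun t0 => all (fun t1 => all (fun t2 => all (fun t3 => norm_ok [:: t0; t1; t2; t3])
  (iota 0 6)) (iota 0 6)) (iota 0 6)) (iota 0 6).
Proof. by vm_compute. Qed.

Lemma fix0_lt6 t : (t < 24)%N -> papp t 0 = 0%N -> (t < 6)%N.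
Proof.
have /allP h : all (fun t => (papp t 0 == 0%N) ==> (t < 6)%N) (iota 0 24) by [].
by move=> ht e; have := h t; rewrite mem_iota e => /(_ ht).
Qed.

Lemma normalize (f : 'I_4 -> 'I_4 -> 'I_4) : (forall k, injective (f k)) -> (forall k, f k 0 = 0) ->
  (forall r : 'I_4 -> 'I_4, injective r -> ~ injective (fun k => f k (r k))) ->
  exists kap al be : 'I_4 -> 'I_4, [/\ injective kap, injective al, injective be &
    forall k x, f (kap k) (al x) = be (pp (start k) x)].
Proof.
move=> injf f0 nr.
have [t0 l0 e0] := pp_surj (injf 0); have [t1 l1 e1] := pp_surj (injf 1).
have [t2 l2 e2] := pp_surj (injf 2%:R); have [t3 l3 e3] := pp_surj (injf 3%:R).
pose t := [:: t0; t1; t2; t3].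
have tlt (k : 'I_4) : (nth 0%N t k < 24)%N by case: k => [[|[|[|[|//]]]] ?].
have fE (k : 'I_4) x : f k x = pp (nth 0%N t k) x.
  by move: k; apply: I4_ind => /=; rewrite ?e0 ?e1 ?e2 ?e3.
have six k : (k < 4)%N -> (nth 0%N t k < 6)%N.
  move=> hk; have := fE (Ordinal hk) 0; rewrite f0 => /(f_equal val) /=.
  by rewrite pp_val ?(tlt (Ordinal hk)) //= => /esym; apply: fix0_lt6; apply: (tlt (Ordinal hk)).
have : norm_ok t.
  have /allP a0 := norm_all; have /allP a1 := a0 t0 ltac:(by rewrite mem_iota; apply: (six 0%N)).
  have /allP a2 := a1 t1 ltac:(by rewrite mem_iota; apply: (six 1%N)).
  have /allP a3 := a2 t2 ltac:(by rewrite mem_iota; apply: (six 2%N)).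
  by apply: a3; rewrite mem_iota; apply: (six 3%N).
rewrite /norm_ok; case: ifP => [/hasP [r]|_ /hasP [kap]].
  rewrite mem_iota => hr ur _; case: (nr (pp r) (pp_inj hr)) => k k' /(f_equal val) /=.
  have vE (k0 : 'I_4) : val (f k0 (pp r k0)) = nth 0%N [seq papp (nth 0 t k) (papp r k) | k <- iota 0 4]%N k0.
    by rewrite (nth_map 0%N) ?size_iota // nth_iota // add0n fE /= pp_val // pp_val.
  by rewrite !vE => /eqP; rewrite nth_uniq ?size_map ?size_iota // => /eqP /val_inj.
rewrite mem_iota => hk /hasP [al]; rewrite mem_iota => ha /hasP [be]; rewrite mem_iota => hb h.
have ha' : (al < 24)%N by apply: leq_trans ha _.
have hb' : (be < 24)%N by apply: leq_trans hb _.
have hs (k : 'I_4) : (start k < 24)%N by case: k => [[|[|[|[|//]]]] ?].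
exists (pp kap), (pp al), (pp be); split; [exact: pp_inj..|].
move=> k x; apply: val_inj; have tk : (nth 0 t (papp kap k) < 24)%N by rewrite -(pp_val k hk) tlt.
by rewrite /= fE !pp_val ?tlt //; apply/eqP; have /allP /(_ k) := h;
  rewrite mem_iota ltn_ord => /(_ isT) /allP /(_ x); rewrite mem_iota ltn_ord; apply.
Qed.

Section CaseE.
Variables (R : realType) (d : nat) (A : dmatrix R d 4).
Hypothesis pA : polystochastic A.
Variables (X : {set 'I_d}) (r0 : idx d 4) (zX : zero A X r0).
Variables (L a b : 'I_d).
Hypotheses (LX : L \in X) (aX : a \in X) (bX : b \in X) (ab : a != b) (La : L != a) (Lb : L != b).

Lemma search_start : search tuples2 lines2 start_rels (4 ^ 2) [seq (5 * k, iota 0 24, [:: start k])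
  | k <- iota 0 4]%N script_start.
Proof. by vm_compute. Qed.

(** The transpositions [s1] and [s2] move the common positive cell to (0, 0), so the permutations
    given by Birkhoff's theorem fix 0. Rows and columns that are both distinct along p would yield a
    positive diagonal of X, hence the hypothesis of [normalize]. *)
Lemma positive_start (p : 'I_4 -> idx d 4) :
  (forall i, i \in X -> i != a -> i != b -> injective (fun k => p k i)) ->
  (forall k i, i \notin X -> p k i = r0 i) ->
  (forall k, p k a = p 0 a) -> (forall k, p k b = p 0 b) -> (forall k, 0 < A (p k)) ->
  exists kap al be : 'I_4 -> 'I_4, [/\ injective kap, injective al, injective be &
    forall k x, 0 < A (upd (upd (p (kap k)) a (al x)) b (be (pp (start k) x)))].
Proof.
move=> pX poff pa pb pp0.
pose W k (x y : 'I_4) := A (upd (upd (p k) a x) b y).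
have idi : injective (@id 'I_4) by [].
have dsW k : doubly_stochastic (W k) := slice_ds pA (fun=> p k) ab idi idi 0.
have W0 k : 0 < W k (p 0 a) (p 0 b) by rewrite /W -(pa k) upd_id -(pb k) upd_id.
have /boolp.choice [f hf] : forall k, exists f : 'I_4 -> 'I_4, injective f /\ (f (p 0 a) = p 0 b /\ forall x,
  0 < W k x (f x)).
  by move=> k; have [f h1 h2] := birkhoff (dsW k) (W0 k); exists f.
pose s1 := tperm 0 (p 0 a); pose s2 := tperm 0 (p 0 b).
have [k|k|r ir inj|kap [al [be [ik ia ib h]]]] := @normalize (fun k x => s2 (f k (s1 x))).
- by apply: inj_comp; [apply: perm_inj | apply: inj_comp; [case: (hf k) | apply: perm_inj]].
- by have [_ [e _]] := hf k; rewrite /s1 tpermL e /s2 tpermR.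
- apply: (zX (p := fun k => upd (upd (p k) a (s1 (r k))) b (f k (s1 (r k))))) => [|k];
  last by have [_ [_ h]] := hf k; apply: h.
  split=> [i iX|k i iX]; last by rewrite !upd_other ?poff //; apply: (memPnC iX).
  case: (eqVneq i b) => [->|ib] k k'; first by rewrite !upd_same => e; apply: inj; rewrite e.
  rewrite !(upd_other _ _ ib); case: (eqVneq i a) => [->|ia]; first by rewrite !upd_same => /perm_inj /ir.
  by rewrite !(upd_other _ _ ia); apply: pX.
exists kap, (fun x => s1 (al x)), (fun y => s2 (be y)).
split=> //; [by apply: inj_comp ia; apply: perm_inj | by apply: inj_comp ib; apply: perm_inj |].
by move=> k x; rewrite -h tpermK; have [_ [_ h']] := hf (kap k); apply: h'.
Qed.

(** Labelling L by its own values along the diagonal makes the slices with index 4 k + k = 5 k the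
    planes at q k, where [start k] is known to be positive; the search needs nothing else. *)
Lemma start_templates (p : 'I_4 -> idx d 4) :
  (forall i, i \in X -> i != a -> i != b -> injective (fun k => p k i)) ->
  (forall k i, i \notin X -> p k i = r0 i) ->
  (forall k, p k a = p 0 a) -> (forall k, p k b = p 0 b) -> (forall k, 0 < A (p k)) ->
  exists kap al be : 'I_4 -> 'I_4, let q k := p (kap k) in let B := B2 A q L a b (fun l => q l L) al be in
   [/\ injective kap, injective al, injective be,
     forall k x, 0 < B k k x (pp (start k) x) &
     exists2 i, (i < size start_rels)%N & forall k l x y, 0 < B k l x y -> nth (fun _ _ _ =>
       false) start_rels i (4 * k + l)%N x y].
Proof.
move=> pX poff pa pb pp0; have [kap [al [be [ik ia ib h]]]] := positive_start pX poff pa pb pp0.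
exists kap, al, be => q B.
have hB k x : 0 < B k k x (pp (start k) x) by rewrite /B /B2 upd_id; apply: h.
split=> //.
have iqL : injective (fun l => q l L) by move=> k k' /(pX L LX La Lb) /ik.
apply: (@search2 _ _ A pA X r0 zX q L a b _ al be LX aX bX ab La Lb iqL ia ib _ _ _ _ _ _ search_start).
- by move=> i iX iL ia' ib' k k' /(pX i iX ia' ib') /ik.
- by move=> k i iX; apply: poff.
move=> e l t /mapP [k]; rewrite mem_iota => hk [-> -> ->]; split.
  by move=> t' /pos_dom lt24; rewrite -[_ \in _]/(t' \in iota 0 24) mem_iota.
move=> t'; rewrite inE => /eqP ->; apply/and3P; split.
- by rewrite (_ : 4 ^ 2 = 16)%N //; lia.
- by move: hk; case: k => [|[|[|[|]]]].
apply/forallP => x; have -> : (5 * k = 4 * (Ordinal hk : 'I_4) + (Ordinal hk : 'I_4))%N by rewrite /=; lia.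
by rewrite W2E; apply: (hB (Ordinal hk)).
Qed.
End CaseE.

(** * Moving between diagonals *)

Section Paths.
Variables (d : nat) (X : {set 'I_d}) (r : idx d 4).
Implicit Types p : 'I_4 -> idx d 4.

Lemma ppath_upd p i (g : 'I_4 -> 'I_4) : i \in X -> injective g -> ppath X r p ->
  ppath X r (fun k => upd (p k) i (g k)).
Proof.
move=> iX ig [h1 h2]; split=> [j jX|k j jX]; last first.
  by rewrite upd_other ?h2 //; apply: (memPnC jX).
have [->|ji] := eqVneq j i; first by move=> k k'; rewrite !upd_same => /ig.
by move=> k k'; rewrite !upd_other //; apply: h1.
Qed.

(** In one coordinate two diagonals are two bijections onto the same four values, so a permutation
    of the positions turns one into the other; coordinates are matched one at a time. *)
Lemma path_connect (Q : ('I_4 -> idx d 4) -> Prop) :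
  (forall p i (s : 'I_4 -> 'I_4), i \in X -> injective s -> ppath X r p -> Q p ->
     Q (fun k => upd (p k) i (p (s k) i))) ->
  forall p p', ppath X r p -> ppath X r p' -> Q p -> Q p'.
Proof.
move=> Qstep p p'; have [m] := ubnP #|[set i | [exists k, p k i != p' k i]]|.
elim: m p => // m IH p le_m pp pp' Qp.
case: (pickP (mem [set i | [exists k, p k i != p' k i]])) => [i|e0]; last first.
  suff -> : p' = p by [].
  apply: boolp.funext => k; apply/ffunP => i; apply/eqP; rewrite eq_sym; apply: contraT => ne.
  by have := e0 i; rewrite !inE => /existsP []; exists k.
rewrite !inE => /existsP [k ne].
have iX : i \in X by apply: contraR ne => iX; rewrite pp.2 // pp'.2.
have [g gK Kg] := injF_bij (pp.1 i iX).
pose s k := g (p' k i).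
have is_ : injective s by apply: inj_comp (can_inj Kg) (pp'.1 i iX).
have sE k0 : p (s k0) i = p' k0 i by rewrite /s Kg.
apply: (IH (fun k => upd (p k) i (p (s k) i))) => //; last 2 first.
- by apply: ppath_upd => // u v; rewrite !sE; apply: pp'.1.
- exact: Qstep.
rewrite -ltnS; apply: leq_trans le_m; apply: proper_card; apply/properP; split.
  apply/subsetP => j; rewrite !inE => /existsP [k0]; have [->|ji] := eqVneq j i.
    by rewrite upd_same sE eqxx.
  by rewrite upd_other // => h; apply/existsP; exists k0.
exists i; rewrite !inE; first by apply/existsP; exists k.
by apply/existsPn => k0; rewrite upd_same sE negbK.
Qed.

Lemma path_through2 (a b : idx d 4) : agree X r a -> agree X r b -> (forall i, i \in X -> a i != b i) ->
  exists p, [/\ ppath X r p, p 0 = a & p 1 = b].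
Proof.
(* The inner transposition sends 0 to a i; the outer one sends the image of 1 to b i and leaves a i
   alone because a i differs from b i. *)
move=> ha hb ne; pose h i := (fun k => tperm (tperm 0 (a i) 1) (b i) (tperm 0 (a i) k)).
exists (fun k => [ffun i => if i \in X then h i k else r i]); split.
- split=> [i iX k k'|k i iX]; rewrite !ffunE; last by rewrite (negbTE iX).
  by rewrite iX /h => /perm_inj /perm_inj.
- apply/ffunP => i; rewrite ffunE; case: ifP => [iX|/negbT /ha //].
  rewrite /h tpermL tpermD //; last by rewrite eq_sym ne.
  by rewrite -{2}(tpermL 0 (a i)) (inj_eq perm_inj).
- apply/ffunP => i; rewrite ffunE; case: ifP => [iX|/negbT /hb //].
  by rewrite /h tpermL.
Qed.

Lemma path_through (a : idx d 4) k0 : agree X r a -> exists p, ppath X r p /\ p k0 = a.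
Proof.
move=> ha; exists (fun k => [ffun i => if i \in X then a i + (k - k0) else r i]); split.
  split=> [i iX k k'|k i iX]; rewrite !ffunE ?(negbTE iX) //.
  by rewrite iX => /addrI /addIr.
by apply/ffunP => i; rewrite ffunE subrr addr0; case: ifP => // /negbT /ha.
Qed.

Lemma exists_third (u v : 'I_4) : exists w, (u != w) && (w != v).
Proof.
have : [forall u : 'I_4, forall v : 'I_4, exists w, (u != w) && (w != v)].
  apply/forallP; apply: I4_ind; apply/forallP; apply: I4_ind; apply/existsP;
    by [exists 0 | exists 1 | exists 2%:R].
by move=> /forallP /(_ u) /forallP /(_ v) /existsP.
Qed.

(** Serves to link arbitrary points: c lies on a common diagonal with a and on another one with
    b. *)
Lemma exists_opposite (a b : idx d 4) : exists c, [/\ agree X r c, forall i, i \in X ->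
  a i != c i & forall i, i \in X -> c i != b i].
Proof.
have /boolp.choice [f hf] : forall i : 'I_d, exists w, (a i != w) && (w != b i) by move=> i;
  apply: exists_third.
exists [ffun i => if i \in X then f i else r i]; split=> i iX; rewrite ffunE ?(negbTE iX) //.
  by rewrite iX; case/andP: (hf i).
by rewrite iX; case/andP: (hf i).
Qed.

Lemma additive_of_increments (g : idx d 4 -> 'I_4) :
  (forall e a b u v, e \in X -> agree X r a -> agree X r b ->
     g (upd a e u) - g (upd a e v) = g (upd b e u) - g (upd b e v)) ->
  forall a, agree X r a -> g a = g r + \sum_(e in X) (g (upd r e (a e)) - g r).
Proof.
move=> h; apply: agree_ind => [|a i k iX ha ga].
  by rewrite big1 ?addr0 // => e _; rewrite upd_id subrr.
have := h i a r k (a i) iX ha (fun i _ => erefl); rewrite upd_id => /(canRL (subrK _)) ->.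
rewrite {1}ga (bigD1 i) //= [in RHS](bigD1 i) //= upd_same.
have -> : \sum_(e in X | e != i) (g (upd r e (upd a i k e)) - g r) = \sum_(e in X
  | e != i) (g (upd r e (a e)) - g r).
  by apply: eq_bigr => e /andP [_ ei]; rewrite upd_other.
by ring.
Qed.
End Paths.

Section Spread.
Variables (R : realType) (d : nat) (A : dmatrix R d 4).
Hypothesis pA : polystochastic A.
Variables (X : {set 'I_d}) (r : idx d 4) (s : 'I_d) (phi : 'I_d -> 'S_4).
Hypothesis sX : s \in X.
Hypothesis supp : forall a, agree X r a -> 0 < A a -> upto_swap (tsum X s phi a) (phi s (a s)).
Variable L : 'I_d.
Hypotheses (LX : L \in X) (Ls : L != s).

Definition twist (ty : bool) (y : 'I_4) : 'I_4 := if ty then sw01 y else y.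

(** The witness sits at t = 0, where y and pi y differ, so its entry is the weight of the branch
    [ty] alone. A positive weight makes the whole branch positive. *)
Lemma pos_spread (ty : bool) z0 : agree X r z0 -> 0 < A z0 ->
  tsum X s phi z0 = 0 -> tsum X s phi z0 = twist ty (phi s (z0 s)) ->
  forall z, agree X r z -> tsum X s phi z = twist ty (phi s (z s)) -> 0 < A z.
Proof.
have [l l01 lE] := lambda_form pA sX supp LX Ls.
move=> h0 p0 t0 e0 z hz ez; rewrite lE // in p0; rewrite lE // ez.
have y0 : phi s (z0 s) = twist ty 0 by rewrite -t0 e0; case: (ty) => //=; rewrite sw01K.
move: p0; rewrite t0 {}y0; move: (phi s (z s)) => y; clear e0 ez; case: (ty) => /=; rewrite /sw01.
  by move: y; apply: I4_ind; rewrite ?permE /= ?eqxx /=; lra.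
by move: y; apply: I4_ind; rewrite ?permE /= ?eqxx /=; lra.
Qed.
End Spread.

Lemma LstateE (c : 'I_4 -> 'I_4) : \sum_k c k = 0 -> forall k : 'I_4,
  Lstate (4 * (c 1 - c 0)%R + (c 2%:R - c 0)%R)%N k = (c k - c 0 : 'I_4) :> nat.
Proof.
rewrite sumI4 => e; pose u := c 1 - c 0; pose v := c 2%:R - c 0.
have e3 : c 3%:R - c 0 = - u - v.
  (* Multiples of 4 vanish in Z/4, so subtracting c 0 from all four shifts keeps their sum 0. *)
  have q : c 0 + c 0 + c 0 + c 0 = 0 by move: (c 0); apply: I4_ind; apply: val_inj.
  move/eqP: e; rewrite addrC addr_eq0 => /eqP ->.
  by rewrite -[LHS]addr0 -[X in _ + X = _]q /u /v; ring.
rewrite -/u -/v /Lstate.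
have -> : ((4 * u + v) %/ 4)%N = u by have := ltn_ord v; lia.
have -> : ((4 * u + v) %% 4)%N = v by have := ltn_ord v; lia.
move=> k; have -> : c k - c 0 = if k == 0 then 0 else if k == 1 then u else if k == 2%:R then v else - u - v.
  by move: k; apply: I4_ind; rewrite ?subrr.
by move: u v k {e3}; apply: I4_ind; apply: I4_ind; apply: I4_ind.
Qed.

Lemma lt16 (u v : 'I_4) : (4 * u + v < 16)%N.
Proof. by have := ltn_ord u; have := ltn_ord v; lia. Qed.

Lemma sw01E (y : 'I_4) : nth 0%N [:: 1; 0; 2; 3]%N y = sw01 y :> nat.
Proof. by move: y; apply: I4_ind; rewrite /sw01 permE. Qed.

Lemma diag_entryE e : (e < 16)%N -> exists k l : 'I_4, [/\ digit 1 e = k,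
  digit 0 e = l & diag_entry e = (16 * k + 4 * k + l)%N].
Proof.
move=> he; exists (inord (digit 1 e)), (inord (digit 0 e)); rewrite !inordK ?digit_lt //.
by split=> //; rewrite /diag_entry -mulnDl mulnC.
Qed.

(* Blocks: the restrictions to L, a, b.  [Lsup c r]: the block at r is of type L with shift c; [Lpos ty c r]:
   its weight on t - c = y (ty = false) or on t - c = pi y (ty = true) is positive. *)
Section Blocks.
Variables (R : realType) (d : nat) (A : dmatrix R d 4).
Hypothesis pA : polystochastic A.
Variables (X : {set 'I_d}) (r0 : idx d 4) (zX : zero A X r0).
Variables (L a b : 'I_d).
Hypotheses (LX : L \in X) (aX : a \in X) (bX : b \in X) (un : uniq [:: L; a; b]).
Let B := [set L; a; b].
Variables (gl gx gy : 'S_4).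

Definition Lval (z : idx d 4) : 'I_4 := gl (z L) + gx (z a).
Definition Lsup (c : 'I_4) (r : idx d 4) : Prop :=
  forall z, agree B r z -> 0 < A z -> upto_swap (Lval z - c)%R (gy (z b)).
Definition Lpos (ty : bool) (c : 'I_4) (r : idx d 4) : Prop :=
  forall z, agree B r z -> Lval z - c = twist ty (gy (z b)) -> 0 < A z.
(** The invariant transported along diagonals. Positions 0 and 1 carry one branch and 2 and 3 the
    other, as left by u, u, v, v; the vanishing sum is what later yields the parity. *)
Definition Linv (c : 'I_4 -> 'I_4) (p : 'I_4 -> idx d 4) : Prop :=
  \sum_k c k = 0 /\ forall k : 'I_4, Lsup (c k) (p k) /\ Lpos (2 <= k)%N (c k) (p k).

Let neq3 : [/\ L != a, L != b & a != b].
Proof. by move: un; rewrite /= !inE !negb_or => /and3P [/andP [-> ->] ->]. Qed.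

Lemma Lpos_witness ty c r : Lpos ty c r -> exists z, [/\ agree B r z, 0 < A z,
  Lval z = c & gy (z b) = twist ty 0].
Proof.
have [La Lb ab] := neq3.
move=> h; pose z := upd (upd r b ((gy^-1)%g (twist ty 0))) L ((gl^-1)%g (c - gx (r a))).
have zL : gl (z L) = c - gx (r a) by rewrite upd_same permKV.
have za : z a = r a by rewrite !upd_other // eq_sym.
have zb : gy (z b) = twist ty 0 by rewrite upd_other 1?eq_sym // upd_same permKV.
have tz : Lval z = c by rewrite /Lval zL za subrK.
have az : agree B r z by apply: agree_upd; [|apply: agree_upd] => //; rewrite !inE eqxx ?orbT.
exists z; split=> //; apply: h => //; rewrite tz subrr zb.
by case: (ty) => //=; rewrite sw01K.
Qed.

Section Travel.
Variables (p : 'I_4 -> idx d 4) (c : 'I_4 -> 'I_4) (E : 'I_d).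
Hypotheses (EX : E \in X) (EB : E \notin B).
Hypothesis pp : ppath (X :\: B) r0 p.
Hypothesis inv : Linv c p.

Let un4 : uniq [:: E; L; a; b].
Proof. by rewrite cons_uniq un andbT; move: EB; rewrite !inE -orbA. Qed.

Let pE_inj : injective (fun e => p e E).
Proof. by apply: pp.1; rewrite inE EB EX. Qed.

Let pX4 i : i \in X -> i \notin [:: E; L; a; b] -> injective (fun k => p k i).
Proof. by move=> iX; rewrite inE negb_or => /andP [_ h]; apply: pp.1; move: h;
  rewrite !inE -orbA iX andbT. Qed.

Let poff k i : i \notin X -> p k i = r0 i.
Proof. by move=> iX; apply: pp.2; rewrite inE (negbTE iX) andbF. Qed.

(** Shifting the labels of L by c 0 reduces the shifts to the sixteen normalised ones. The invariant
    supplies the slices with digits (k, k, l), and the relation found by the search names psi. *)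
Lemma Ltravel_sup : exists psi : 'S_4, forall k e, Lsup (c k + psi e - psi k) (upd (p k) E (p e E)).
Proof.
have [La Lb ab] := neq3; have [Ea Eb EL] : [/\ E != a, E != b & E != L].
  by move: EB; rewrite !inE !negb_or => /andP [/andP [-> ->] ->].
have [sc hc] := inv.
pose i0 := (4 * (c 1 - c 0)%R + (c 2%:R - c 0)%R)%N.
have hi0 : (i0 < 16)%N by apply: lt16.
pose fl l := (gl^-1)%g (l + c 0).
have ifl : injective fl by move=> x y /perm_inj /addIr.
have [igx igy] : injective (gx^-1)%g /\ injective (gy^-1)%g by split; apply: perm_inj.
have key (k e l x y : 'I_4) : exists z, [/\ agree B (upd (p k) E (p e E)) z, Lval z = l + c 0 + x,
  gy (z b) = y &
    B3 A p E L a b (fun e => p e E) fl (gx^-1)%g (gy^-1)%g k e l x y = A z].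
  exists (upd (upd (upd (upd (p k) E (p e E)) L (fl l)) a ((gx^-1)%g x)) b ((gy^-1)%g y)); split=> //.
  - by do 3!(apply: agree_upd; first by rewrite !inE eqxx ?orbT).
  - by rewrite /Lval upd_other // upd_other // upd_same upd_other // upd_same !permKV.
  - by rewrite upd_same permKV.
have := @search3 _ _ A pA X r0 zX p E L a b _ fl _ _ EX LX aX bX un4 pE_inj ifl igx igy pX4 poff
  (rels_Ltravel (Lstate i0)) (init_Ltravel (Lstate i0)) (nth [::] script_Ltravel i0).
case.
- move=> e l t /mapP [e1]; rewrite mem_iota => he1 [-> -> ->].
  have [k [l' [e1k e1l ->]]] := diag_entryE he1.
  split.
    apply: pos_perms_in => x y; rewrite W3E e1k e1l; have [z [az tz <- ->]] := key k k l' x y.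
    move=> pz; move: az; rewrite upd_id => az; have [hs _] := hc k.
    have := hs z az pz; rewrite tz (LstateE sc) add4E sub4E.
    by have -> : (l' + c 0 + x - c k = l' + x - (c k - c 0))%R by ring.
  apply: perms_in_pos; first exact: idx3_lt.
  move=> x y; rewrite W3E e1k e1l; have [z [az tz yz ->]] := key k k l' x y.
  move: az; rewrite upd_id => az; have [_ hp] := hc k.
  rewrite /present_Ltravel (LstateE sc) add4E sub4E => /eqP h; apply: hp => //.
  rewrite tz yz; have -> : (l' + c 0 + x - c k = l' + x - (c k - c 0))%R by ring.
  apply: val_inj; rewrite /= -/(val _) [LHS]h /twist ltnNge.
  by case: (2 <= k)%N => //=; rewrite sw01E.
- by have /allP := search_Ltravel; apply; rewrite mem_iota.
rewrite size_map size_iota => i lti h.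
have [psi hpsi] := papp_perm lti; exists psi => k e z az pz.
have zE : A z = B3 A p E L a b (fun e =>
  p e E) fl (gx^-1)%g (gy^-1)%g k e (gl (z L) - c 0) (gx (z a)) (gy (z b)).
  rewrite /B3 /fl subrK !permK; congr A; apply/ffunP => j; rewrite !ffunE.
  case: eqP => [-> //|/eqP jb]; case: eqP => [-> //|/eqP ja]; case: eqP => [-> //|/eqP jL].
  by rewrite az ?ffunE // !inE !negb_or jL ja jb.
move: pz; rewrite zE => /h; have [d2 d1 d0] := digits3 k e (gl (z L) - c 0).
rewrite (nth_map 0%N) ?size_iota // nth_iota // add0n /rel_Ltravel d0 d1 d2 (LstateE sc) !hpsi add4E add4E
  sub4E sub4E.
by have -> : (gl (z L) - c 0 + gx (z a) - (c k - c 0 + psi e - psi k) = Lval z - (c k + psi e - psi k))%R by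
  rewrite /Lval; ring.
Qed.

(** By [Ltravel_sup] the restriction to the four coordinates E, L, a, b has the known shape, with
    special coordinate b and label -psi on E. Its weights are therefore global, and the branch
    positive in the block of [p k] stays positive as E moves. *)
Lemma Ltravel : exists psi : 'S_4, forall k e,
  Lsup (c k + psi e - psi k) (upd (p k) E (p e E)) /\
    Lpos (2 <= k)%N (c k + psi e - psi k) (upd (p k) E (p e E)).
Proof.
have [La Lb ab] := neq3; have [Ea Eb EL] : [/\ E != a, E != b & E != L].
  by move: EB; rewrite !inE !negb_or => /andP [/andP [-> ->] ->].
have [sc hc] := inv; have [psi hs] := Ltravel_sup; exists psi => k e; split=> // z az tz.
have [g gK Kg] := injF_bij pE_inj.
have ig : injective g := can_inj Kg.
pose X4 := [set E; L; a; b].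
have isl : injective (fun v => gl v - c k + psi k) by move=> u v /addIr /addIr /perm_inj.
have ise : injective (fun v => - psi (g v)) by move=> u v /oppr_inj /perm_inj /ig.
pose phi i := if i == E then perm ise else if i == L then perm isl else if i == a then gx else gy.
have tE w : tsum X4 b phi w = Lval w - (c k + psi (g (w E)) - psi k).
  rewrite /tsum (bigD1 E) ?inE ?eqxx //= (bigD1 L) /=; last by rewrite !inE eqxx Lb eq_sym EL orbT.
  rewrite (bigD1 a) /=; last by rewrite !inE eqxx ab ![a == _]eq_sym Ea La !orbT.
  rewrite big1 ?addr0 => [|i].
    rewrite /phi eqxx [L == E]eq_sym (negbTE EL) eqxx [a == E]eq_sym (negbTE Ea) [a == L]eq_sym (negbTE La)
      eqxx !permE /Lval.
    by ring.
  by rewrite !inE; case: (i == E); case: (i == L); case: (i == a); case: (i == b).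
have phib : phi b = gy by rewrite /phi ![b == _]eq_sym (negbTE Eb) (negbTE Lb) (negbTE ab).
have BX4 i : i \notin X4 -> i \notin B by rewrite !inE !negb_or => /andP [/andP [/andP [_ ->] ->] ->].
have X4B i : i \notin B -> i != E -> i \notin X4 by rewrite !inE !negb_or => /andP [/andP [-> ->] ->] ->.
have agB w : agree X4 (p k) w -> agree B (upd (p k) E (p (g (w E)) E)) w.
  move=> aw i iB; rewrite ffunE; case: eqP => [->|/eqP iE]; first by rewrite Kg.
  by apply: aw; apply: X4B.
have sup4 w : agree X4 (p k) w -> 0 < A w -> upto_swap (tsum X4 b phi w) (phi b (w b)).
  by move=> aw pw; rewrite tE phib; apply: (hs k (g (w E))) => //; apply: agB.
have [_ hp] := hc k; have [z0 [az0 pz0 tz0 yz0]] := Lpos_witness hp.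
have az0E : z0 E = p k E by apply: az0.
have bX4 : b \in X4 by rewrite !inE eqxx !orbT.
have LX4 : L \in X4 by rewrite !inE eqxx !orbT.
apply: (@pos_spread _ _ _ pA X4 (p k) b phi bX4 sup4 L LX4 Lb (2 <= k)%N z0) => //.
- by move=> i iX4; apply: az0; apply: BX4.
- by rewrite tE az0E gK tz0; ring.
- rewrite tE az0E gK tz0 phib yz0; have -> : c k - (c k + psi k - psi k) = 0 by ring.
  by case: (2 <= k)%N => //=; rewrite sw01K.
- move=> i iX4; rewrite az; last exact: BX4.
  by rewrite upd_other //; apply: contraNneq iX4 => ->; rewrite !inE eqxx.
rewrite tE phib -tz az; last by [].
by rewrite upd_same gK.
Qed.

(** The new shifts are c k + psi (s k) - psi k; as s permutes the positions, the psi terms cancel in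
    the sum. *)
Lemma Linv_travel (s : 'I_4 -> 'I_4) : injective s ->
  exists c', Linv c' (fun k => upd (p k) E (p (s k) E)).
Proof.
move=> is_; have [psi h] := Ltravel; exists (fun k => c k + psi (s k) - psi k); split=> [|k]; last exact: h.
rewrite !big_split /= inv.1 add0r sumrN; apply/eqP; rewrite subr_eq0; apply/eqP.
by rewrite [RHS](reindex_inj is_).
Qed.
End Travel.
End Blocks.

(** * Blocks based on Z/2 x Z/2 *)

Definition xor (x y : 'I_4) : 'I_4 := inord (xor4 x y).

Lemma xorE (x y : 'I_4) : xor4 x y = xor x y :> nat.
Proof. by rewrite inordK //; move: x y; apply: I4_ind; apply: I4_ind. Qed.

Lemma xorC x y : xor x y = xor y x.
Proof. by apply: val_inj; rewrite /= -!xorE; move: x y; apply: I4_ind; apply: I4_ind. Qed.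

Lemma xorA x y z : xor x (xor y z) = xor (xor x y) z.
Proof. by apply: val_inj; rewrite /= -!xorE; move: x y z; apply: I4_ind; apply: I4_ind; apply: I4_ind. Qed.

Lemma xorK x y : xor (xor x y) y = x.
Proof. by apply: val_inj; rewrite /= -!xorE; move: x y; apply: I4_ind; apply: I4_ind. Qed.

Lemma xor0 x : xor x 0 = x.
Proof. by apply: val_inj; rewrite /= -!xorE; move: x; apply: I4_ind. Qed.

Lemma xor_self x : xor x x = 0.
Proof. by apply: val_inj; rewrite /= -!xorE; move: x; apply: I4_ind. Qed.

Lemma xor0l x : xor 0 x = x. Proof. by rewrite xorC xor0. Qed.

HB.instance Definition _ := Monoid.isComLaw.Build 'I_4 0 xor xorA xorC xor0l.

Definition omega (y : 'I_4) : 'I_4 := inord (omega4 y).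
Lemma omegaE (y : 'I_4) : omega4 y = omega y :> nat.
Proof. by rewrite inordK //; move: y; apply: I4_ind. Qed.

Lemma omega_xor x y : omega (xor x y) = xor (omega x) (omega y).
Proof. by apply: val_inj; rewrite /= -xorE -!omegaE -!xorE; move: x y; apply: I4_ind; apply: I4_ind. Qed.

Lemma VstateE (c : 'I_4 -> 'I_4) : \big[xor/0]_k c k = 0 -> forall k : 'I_4,
  Vstate (4 * xor (c 1%R) (c 0%R) + xor (c 2%:R) (c 0%R))%N k = xor (c k) (c 0) :> nat.
Proof.
have -> : \big[xor/0]_k c k = xor (c 0) (xor (c 1) (xor (c 2%:R) (c 3%:R))).
  rewrite !big_ord_recl big_ord0 xor0; do !congr (xor _ _); congr (c _); exact: val_inj.
move=> e; rewrite /Vstate; set u := xor (c 1) (c 0); set v := xor (c 2%:R) (c 0).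
have -> : ((4 * u + v) %/ 4)%N = u by have := ltn_ord v; lia.
have -> : ((4 * u + v) %% 4)%N = v by have := ltn_ord v; lia.
have c3 : xor (c 3%:R) (c 0) = xor u v.
  rewrite /u /v; have := f_equal (fun z => xor z (c 3%:R)) e; rewrite xor0l => {1}<-.
  rewrite -!xorA; move: (c 0) (c 1) (c 2%:R) (c 3%:R) => x y z w.
  by apply: val_inj; rewrite /= -!xorE; move: x y z w; do 4!apply: I4_ind.
move=> k; have -> : xor (c k) (c 0) = if k == 0 then 0 else if k == 1 then u else if k == 2%:R then v else
  xor u v.
  by move: k; apply: I4_ind; rewrite ?xor_self.
by move: u v k {e c3}; apply: I4_ind; apply: I4_ind; apply: I4_ind; rewrite /= -?xorE.
Qed.

Lemma line_pos (R : realType) d (A : dmatrix R d 4) (pA : polystochastic A) (r : idx d 4) i :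
  exists k, 0 < A (upd r i k).
Proof.
apply/existsP; apply: contraT; rewrite negb_exists => /forallP h.
have /eqP := pA.2 i r; rewrite big1 => [|k _]; first by rewrite eq_sym oner_eq0.
by apply/eqP; have := h k; rewrite lt_neqAle pA.1 andbT negbK eq_sym.
Qed.

Section VBlocks.
Variables (R : realType) (d : nat) (A : dmatrix R d 4).
Hypothesis pA : polystochastic A.
Variables (X : {set 'I_d}) (r0 : idx d 4) (zX : zero A X r0).
Variables (L a b : 'I_d).
Hypotheses (LX : L \in X) (aX : a \in X) (bX : b \in X) (un : uniq [:: L; a; b]).
Let B := [set L; a; b].
Variables (gl gx gy : 'S_4).

Definition Vval (z : idx d 4) : 'I_4 := xor (gl (z L)) (gx (z a)).
Definition Vsup (ty : bool) (c : 'I_4) (r : idx d 4) : Prop :=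
  forall z, agree B r z -> 0 < A z -> xor (Vval z) c = if ty then omega (gy (z b)) else gy (z b).
Definition Vinv (c : 'I_4 -> 'I_4) (p : 'I_4 -> idx d 4) : Prop :=
  \big[xor/0]_k c k = 0 /\ forall k : 'I_4, Vsup (2 <= k)%N (c k) (p k).

Let neq3 : [/\ L != a, L != b & a != b].
Proof. by move: un; rewrite /= !inE !negb_or => /and3P [/andP [-> ->] ->]. Qed.

Section Travel.
Variables (p : 'I_4 -> idx d 4) (c : 'I_4 -> 'I_4) (E : 'I_d).
Hypotheses (EX : E \in X) (EB : E \notin B).
Hypothesis pp : ppath (X :\: B) r0 p.
Hypothesis inv : Vinv c p.

Let un4 : uniq [:: E; L; a; b].
Proof. by rewrite cons_uniq un andbT; move: EB; rewrite !inE -orbA. Qed.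

Let pE_inj : injective (fun e => p e E).
Proof. by apply: pp.1; rewrite inE EB EX. Qed.

Let pX4 i : i \in X -> i \notin [:: E; L; a; b] -> injective (fun k => p k i).
Proof. by move=> iX; rewrite inE negb_or => /andP [_ h]; apply: pp.1; move: h;
  rewrite !inE -orbA iX andbT. Qed.

Let poff k i : i \notin X -> p k i = r0 i.
Proof. by move=> iX; apply: pp.2; rewrite inE (negbTE iX) andbF. Qed.

Lemma Vtravel_sup : exists psi : 'S_4, forall k e : 'I_4,
  Vsup (2 <= k)%N (xor (xor (c k) (psi e)) (psi k)) (upd (p k) E (p e E)).
Proof.
have [La Lb ab] := neq3; have [Ea Eb EL] : [/\ E != a, E != b & E != L].
  by move: EB; rewrite !inE !negb_or => /andP [/andP [-> ->] ->].
have [sc hc] := inv.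
pose i0 := (4 * xor (c 1%R) (c 0%R) + xor (c 2%:R) (c 0%R))%N.
have hi0 : (i0 < 16)%N by apply: lt16.
pose fl l := (gl^-1)%g (xor l (c 0)).
have ifl : injective fl by move=> x y /perm_inj e; rewrite -(xorK x (c 0)) e xorK.
have [igx igy] : injective (gx^-1)%g /\ injective (gy^-1)%g by split; apply: perm_inj.
have key (k e l x y : 'I_4) : exists z, [/\ agree B (upd (p k) E (p e E)) z, Vval z = xor (xor l (c 0)) x,
  gy (z b) = y &
    B3 A p E L a b (fun e => p e E) fl (gx^-1)%g (gy^-1)%g k e l x y = A z].
  exists (upd (upd (upd (upd (p k) E (p e E)) L (fl l)) a ((gx^-1)%g x)) b ((gy^-1)%g y)); split=> //.
  - by do 3!(apply: agree_upd; first by rewrite !inE eqxx ?orbT).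
  - by rewrite /Vval upd_other // upd_other // upd_same upd_other // upd_same !permKV.
  - by rewrite upd_same permKV.
have vshift (u x v : 'I_4) : xor (xor (xor u (c 0)) x) v = xor (xor u x) (xor v (c 0)).
  by rewrite -!xorA; congr (xor _ _); rewrite xorC -xorA; congr (xor x _).
have vE (k l x y : 'I_4) : rel_Vtravel (fun k _ => Vstate i0 k) (16 * k + 4 * k + l) x y =
    (xor (xor (xor l (c 0)) x) (c k) == if (2 <= k)%N then omega y else y).
  rewrite /rel_Vtravel; have [-> _ ->] := digits3 k k l; rewrite (VstateE sc) !xorE ltnNge vshift -val_eqE /=.
  by case: (2 <= k)%N => /=; rewrite ?omegaE.
have supkk (k l x y : 'I_4) : 0 < W3 A p E L a b (fun e =>
  p e E) fl (gx^-1)%g (gy^-1)%g (16 * k + 4 * k + l)%N x y ->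
   xor (xor (xor l (c 0)) x) (c k) = if (2 <= k)%N then omega y else y.
  rewrite W3E; have [z [az tz <- ->]] := key k k l x y => pz.
  by move: az; rewrite upd_id => az; rewrite -tz; apply: hc.
have := @search3 _ _ A pA X r0 zX p E L a b _ fl _ _ EX LX aX bX un4 pE_inj ifl igx igy pX4 poff
  (rels_Vtravel (Vstate i0)) (init_Vtravel (Vstate i0)) (nth [::] script_Vtravel i0).
case.
- move=> e l t /mapP [e1]; rewrite mem_iota => he1 [-> -> ->].
  have [k [l' [_ _ ->]]] := diag_entryE he1.
  split; first by apply: pos_perms_in => x y h; rewrite vE; apply/eqP/supkk.
  apply: perms_in_pos; first exact: idx3_lt.
  move=> x y; rewrite vE => /eqP h.
  (* The law of the block leaves at most one cell in each row, so a positive permutation of the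
     slice fills all allowed cells. *)
  have [f pf] := @ds_perm _ (W3 A p E L a b (fun e =>
    p e E) fl (gx^-1)%g (gy^-1)%g (16 * k + 4 * k + l')%N) ltac:(by apply: W3_ds).
  suff -> : y = f x by [].
  have := supkk k l' x (f x) (pf x); rewrite h; case: (2 <= k)%N => // /(f_equal val).
  by rewrite /= -!omegaE; move: (f x) (y); apply: I4_ind; apply: I4_ind.
- by have /allP := search_Vtravel; apply; rewrite mem_iota.
rewrite size_map size_iota => i lti h.
have lt24 : (i < 24)%N by apply: leq_trans lti _.
have [psi hpsi] := papp_perm lt24; exists psi => k e z az pz.
pose l0 := xor (gl (z L)) (c 0).
have zE : A z = B3 A p E L a b (fun e => p e E) fl (gx^-1)%g (gy^-1)%g k e l0 (gx (z a)) (gy (z b)).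
  rewrite /B3 /fl xorK !permK; congr A; apply/ffunP => j; rewrite !ffunE.
  case: eqP => [-> //|/eqP jb]; case: eqP => [-> //|/eqP ja]; case: eqP => [-> //|/eqP jL].
  by rewrite az ?ffunE // !inE !negb_or jL ja jb.
move: pz; rewrite zE => /h; have [d2 d1 d0] := digits3 k e l0.
rewrite (nth_map 0%N) ?size_iota // nth_iota // add0n /rel_Vtravel d0 d1 d2 (VstateE sc) !hpsi !xorE ltnNge
  => /eqP e1.
apply: val_inj; have -> : val (if (2 <= k)%N then omega (gy (z b)) else gy (z b)) =
    (if ~~ (2 <= k)%N then val (gy (z b)) else omega4 (gy (z b))).
  by case: (2 <= k)%N => //=; rewrite omegaE.
rewrite -e1; congr val; rewrite /l0 /Vval.
set g1 := gl (z L); set g2 := gx (z a); move: (c k) (psi e) (psi k) g1 g2 => x1 x2 x3 g1 g2.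
by rewrite vshift; congr (xor _ _); rewrite vshift -[RHS]xorA xorK.
Qed.

Lemma Vinv_travel (s : 'I_4 -> 'I_4) : injective s ->
  exists c', Vinv c' (fun k => upd (p k) E (p (s k) E)).
Proof.
move=> is_; have [psi h] := Vtravel_sup; exists (fun k => xor (xor (c k) (psi (s k))) (psi k)); split=> [|k];
  last exact: h.
rewrite !big_split /= inv.1 xor0l [X in xor _ X](reindex_inj is_) /=; exact: xor_self.
Qed.
End Travel.

(** Travelling reaches diagonals with [r0] at position 0 and others with [r0] at position 2. The
    same block then obeys both laws, so omega (v + c0) = v + c2 for all v, with + the [xor] law. As
    omega is additive, v = 0 and v = 1 give omega 1 = 1, which is false. *)
Lemma V_impossible p c : ppath (X :\: B) r0 p -> Vinv c p -> False.
Proof.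
have [La Lb ab] := neq3.
move=> pp Vp.
have all p' : ppath (X :\: B) r0 p' -> exists c, Vinv c p'.
  move=> pp'; apply: (@path_connect _ (X :\: B) r0 (fun p => exists c, Vinv c p) _ p p') => //;
    last by exists c.
  move=> q E s; rewrite inE => /andP [EB EX] is_ pq [c' h].
  exact: (Vinv_travel EX EB pq h is_).
have ag : agree (X :\: B) r0 r0 by [].
have [p0 [/all [c0 [_ /(_ 0) h0]] e0]] := path_through (0 : 'I_4) ag.
have [p2 [/all [c2 [_ /(_ 2%:R) h2]] e2]] := path_through (2%:R : 'I_4) ag.
rewrite e0 in h0; rewrite e2 in h2.
have key v : omega (xor v (c0 0)) = xor v (c2 2%:R).
  have [y py] := line_pos pA (upd r0 L ((gl^-1)%g (xor v (gx (r0 a))))) b.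
  set z := upd _ _ _ in py.
  have az : agree B r0 z by do 2!(apply: agree_upd; first by rewrite !inE eqxx ?orbT).
  have vz : Vval z = v.
    by rewrite /Vval /z upd_other // upd_same permKV upd_other // upd_other 1?eq_sym // xorK.
  by rewrite -vz (h0 z az py) (h2 z az py).
have k0 := key 0; rewrite !xor0l in k0.
have := key 1; rewrite omega_xor k0 => /(f_equal (fun u => xor u (c2 2%:R))); rewrite !xorK => /(f_equal val).
by rewrite /= -omegaE.
Qed.
End VBlocks.

Lemma papp_inj t t' : (t < 24)%N -> (t' < 24)%N -> (forall x : 'I_4, papp t x = papp t' x) -> t = t'.
Proof.
have /allP h : all (fun t => all (fun t' => all (fun x =>
  papp t x == papp t' x) (iota 0 4) ==> (t == t')) (iota 0 24)) (iota 0 24) by [].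
move=> ht ht' e; have /allP h1 := h t ltac:(by rewrite mem_iota).
apply/eqP; have /implyP := h1 t' ltac:(by rewrite mem_iota); apply.
by apply/allP => x; rewrite mem_iota => hx; apply/eqP; apply: (e (Ordinal hx)).
Qed.

(** * Sporadic blocks *)

Section Weird.
Variables (R : realType) (d : nat) (A : dmatrix R d 4).
Hypothesis pA : polystochastic A.
Variables (X : {set 'I_d}) (r0 : idx d 4) (zX : zero A X r0).

(** A sporadic template allows a single permutation in each of its sixteen slices, so the known part
    of the array with one more coordinate E is completely determined; the search without relations
    shows that no such array exists. *)
Lemma sporadic_impossible (q : 'I_4 -> idx d 4) E L a b al be i :
  E \in X -> L \in X -> a \in X -> b \in X -> uniq [:: E; L; a; b] ->
  (forall i, i \in X -> i \notin [:: L; a; b] -> injective (fun k => q k i)) ->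
  (forall k i, i \notin X -> q k i = r0 i) ->
  injective (fun l => q l L) -> injective al -> injective be -> (i < 78)%N ->
  (forall k l x y, 0 < B2 A q L a b (fun l => q l L) al be k l x y ->
    rel_sporadic (nth [::] sporadic i) (4 * k + l) x y) -> False.
Proof.
move=> EX LX aX bX un qX qoff iqL ial ibe hi h.
have iqE : injective (fun e => q e E).
  by apply: qX => //; move: un => /= /andP [].
have W3B (k l x y : 'I_4) : W3 A q E L a b (fun e => q e E) (fun l => q l L) al be (16 * k + 4 * k + l)%N x y
   = B2 A q L a b (fun l => q l L) al be k l x y by rewrite W3E /B3 /B2 upd_id.
set w := nth [::] sporadic i in h *.
have wlt e : (e < 16)%N -> (nth 0 w e < 24)%N.
  have /allP h1 : all (fun w => all (fun e => nth 0 w e < 24)%N (iota 0 16)) sporadic by vm_compute.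
  have win : w \in sporadic by apply: mem_nth.
  by move=> he; have /allP := h1 w win; apply; rewrite mem_iota.
have qX4 j : j \in X -> j \notin [:: E; L; a; b] -> injective (fun k => q k j).
  by move=> jX; rewrite inE negb_or => /andP [_ hj]; apply: qX.
have uniqpos (k l : 'I_4) t : pos 3 (W3 A q E L a b (fun e => q e E) (fun l =>
  q l L) al be) (16 * k + 4 * k + l)%N t ->
   t = nth 0%N w (4 * k + l)%N.
  move=> pt; have ht := pos_dom pt; apply: papp_inj => // [|x].
    by apply: wlt; rewrite -[16%N]/(4 ^ 2)%N idx2_lt.
  case/and3P: pt => _ _ /forallP /(_ x); rewrite W3B => /h /eqP <-.
  by rewrite pp_val.
have := @search3 _ _ A pA X r0 zX q E L a b _ _ _ _ EX LX aX bX un iqE iqL ial ibe qX4 qoff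
  [::] (init_sporadic w) (nth [::] script_sporadic i).
case=> // [|].
  move=> e l t /mapP [e1]; rewrite mem_iota => he1 [-> -> ->].
  have := diag_entryE he1; rewrite /diag_entry => -[k [l' [e1k e1l e1kl]]].
  have -> : (digit 1 e1 * 16 + digit 1 e1 * 4 + digit 0 e1 = 16 * k + 4 * k + l')%N by rewrite -e1kl; lia.
  have -> : nth 0%N w e1 = nth 0%N w (4 * k + l')%N.
    congr nth; rewrite -e1k -e1l /digit expn0 divn1 expn1; move: he1; clear; lia.
  split=> [t1 /uniqpos ->|t1]; first by rewrite mem_head.
  rewrite inE => /eqP ->.
  have [f pf] := @ds_perm _ (W3 A q E L a b (fun e => q e E) (fun l =>
    q l L) al be (16 * k + 4 * k + l')%N) ltac:(by apply: W3_ds).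
  have [t2 ht2 ft2] := pp_surj (@perm_inj _ f).
  have pt2 : pos 3 (W3 A q E L a b (fun e => q e E) (fun l => q l L) al be) (16 * k + 4 * k + l')%N t2.
    by apply/and3P; split=> //; [apply: idx3_lt | apply/forallP => x; rewrite ft2].
  by rewrite -(uniqpos _ _ _ pt2).
by have /allP := search_sporadic; apply; rewrite mem_iota.
Qed.
End Weird.

(** * From the shifts to the shape of the support *)

Section Conclusion.
Variables (R : realType) (d : nat) (A : dmatrix R d 4).
Hypothesis pA : polystochastic A.
Variables (X : {set 'I_d}) (r0 : idx d 4) (zX : zero A X r0).
Variables (L a b : 'I_d).
Hypotheses (LX : L \in X) (aX : a \in X) (bX : b \in X) (un : uniq [:: L; a; b]).
Let B := [set L; a; b].
Variables (gl gx gy : 'S_4).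
Variables (p : 'I_4 -> idx d 4) (c : 'I_4 -> 'I_4).
Hypothesis pp : ppath (X :\: B) r0 p.
Hypothesis inv : Linv A L a b gl gx gy c p.

Let neq3 : [/\ L != a, L != b & a != b].
Proof. by move: un; rewrite /= !inE !negb_or => /and3P [/andP [-> ->] ->]. Qed.

Let all_paths p' : ppath (X :\: B) r0 p' -> exists c, Linv A L a b gl gx gy c p'.
Proof.
move=> pp'; apply: (@path_connect _ (X :\: B) r0 (fun p => exists c, Linv A L a b gl gx gy c p) _ p p') =>
  //; last by exists c.
move=> q E s; rewrite inE => /andP [EB EX] is_ pq [c' h].
exact: (Linv_travel pA zX LX aX bX un EX EB pq h is_).
Qed.

(** At special label 2, which pi fixes, the support condition is an equation, so a positive cell
    there determines the shift. *)
Lemma Lsup_unique c1 c2 r : Lsup A L a b gl gx gy c1 r -> Lpos A L a b gl gx gy false c1 r ->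
  Lsup A L a b gl gx gy c2 r -> c1 = c2.
Proof.
have [La Lb ab] := neq3.
move=> h1 h2 h3; pose z := upd (upd r b ((gy^-1)%g 2%:R)) L ((gl^-1)%g (c1 + 2%:R - gx (r a))).
have zL : gl (z L) = c1 + 2%:R - gx (r a) by rewrite upd_same permKV.
have za : z a = r a by rewrite !upd_other // eq_sym.
have zb : gy (z b) = 2%:R by rewrite upd_other 1?eq_sym // upd_same permKV.
have tz : Lval L a gl gx z = c1 + 2%:R by rewrite /Lval zL za subrK.
have az : agree B r z by apply: agree_upd; [|apply: agree_upd] => //; rewrite !inE eqxx ?orbT.
have pz : 0 < A z by apply: h2 => //; rewrite tz zb addrC addKr.
have := h3 z az pz; rewrite tz zb => g.
have : c1 - c2 = 0.
  move: g; rewrite (_ : (c1 + 2%:R - c2)%R = (c1 - c2) + 2%:R)%R; last by ring.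
  by move: (c1 - c2)%R; apply: I4_ind.
by move/eqP; rewrite subr_eq0 => /eqP.
Qed.

(** By [Lsup_unique] the shift is a function [cf] of the remaining coordinates. Along a diagonal its
    increments in direction E all come from one psi, so they agree at two points of a common
    diagonal, and at two arbitrary points by comparison with a third that differs from both
    everywhere. Hence [cf] is additive. *)
Lemma Linv_conclusion : odd #|X| /\ supptype A X r0.
Proof.
have [La Lb ab] := neq3.
have /boolp.choice [cf hcf] : forall r, exists c0, agree (X :\: B) r0 r ->
    Lsup A L a b gl gx gy c0 r /\ Lpos A L a b gl gx gy false c0 r.
  move=> r; case: (boolp.EM (agree (X :\: B) r0 r)) => [ag|nag]; last by exists 0.
  have [q [pq q0]] := path_through (0 : 'I_4) ag.
  by have [c' [_ /(_ 0) h]] := all_paths pq; exists (c' 0); rewrite q0 in h.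
have cfE r c' : agree (X :\: B) r0 r -> Lsup A L a b gl gx gy c' r -> cf r = c'.
  by move=> ag hs; have [h1 h2] := hcf r ag; apply: Lsup_unique h1 h2 hs.
have onp q k : ppath (X :\: B) r0 q -> agree (X :\: B) r0 (q k) by move=> pq i iX; apply: pq.2.
have path_sum q : ppath (X :\: B) r0 q -> \sum_k cf (q k) = 0.
  move=> pq; have [c' [sc h]] := all_paths pq; apply: etrans sc; apply: eq_bigr => k _.
  by apply: cfE; [apply: onp | case: (h k)].
have path_incr q E : E \in X :\: B -> ppath (X :\: B) r0 q -> exists psi : 'S_4,
    forall k u v, cf (upd (q k) E u) - cf (upd (q k) E v) = psi u - psi v.
  move=> EXB pq; have := EXB; rewrite inE => /andP [EB EX].
  have [c' h] := all_paths pq; have [psi hpsi] := Ltravel pA zX LX aX bX un EX EB pq h.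
  have [g gK Kg] := injF_bij (pq.1 E EXB).
  exists (perm (can_inj Kg) * psi)%g => k u v.
  have E1 u' : cf (upd (q k) E u') = c' k + psi (g u') - psi k.
    have [h1 _] := hpsi k (g u'); rewrite Kg in h1; apply: cfE => //.
    by apply: agree_upd => //; apply: onp.
  by rewrite !E1 !permM !permE; ring.
have incr_far E r1 r2 u v : E \in X :\: B -> agree (X :\: B) r0 r1 -> agree (X :\: B) r0 r2 ->
    (forall i, i \in X :\: B -> r1 i != r2 i) ->
    cf (upd r1 E u) - cf (upd r1 E v) = cf (upd r2 E u) - cf (upd r2 E v).
  move=> EXB ag1 ag2 ne; have [q [pq q0 q1]] := path_through2 ag1 ag2 ne.
  by have [psi h] := path_incr q E EXB pq; rewrite -q0 -q1 !h.
have incr E r1 r2 u v : E \in X :\: B -> agree (X :\: B) r0 r1 -> agree (X :\: B) r0 r2 ->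
    cf (upd r1 E u) - cf (upd r1 E v) = cf (upd r2 E u) - cf (upd r2 E v).
  move=> EXB ag1 ag2; have [r3 [ag3 n1 n2]] := exists_opposite (X :\: B) r0 r1 r2.
  exact: etrans (incr_far _ _ _ _ _ EXB ag1 ag3 n1) (incr_far _ _ _ _ _ EXB ag3 ag2 n2).
have additive := additive_of_increments incr.
pose de E v := cf (upd r0 E v) - cf r0.
have ag0 : agree (X :\: B) r0 r0 by [].
have ide E : E \in X :\: B -> injective (de E).
  move=> EXB u v /addIr e; have [q [pq q0]] := path_through (0 : 'I_4) ag0.
  have [psi h] := path_incr q E EXB pq; have := h 0 u v; rewrite q0 e subrr => /esym/eqP.
  by rewrite subr_eq0 => /eqP /perm_inj.
split.
  have [q [pq _]] := path_through (0 : 'I_4) ag0.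
  have := path_sum q pq.
  rewrite (eq_bigr (fun k => cf r0 + \sum_(e in X :\: B) (cf (upd r0 e (q k e)) - cf r0))) => [|k _];
    last first.
    by apply: additive; apply: onp.
  rewrite big_split /= exchange_big /=.
  have -> : \sum_(k < 4) cf r0 = 0 by rewrite sumI4; move: (cf r0); apply: I4_ind; apply: val_inj.
  (* Each coordinate outside the block contributes 2 to the sum of [cf] over a diagonal, and this
     sum is 0 modulo 4, so the number of these coordinates is even; the block adds three. *)
  have sperm (g : 'I_4 -> 'I_4) : injective g -> \sum_k g k = 2%:R.
    by move=> ig; rewrite -(reindex_inj ig (P := xpredT) (F := id)) sumI4; apply: val_inj.
  rewrite add0r (eq_bigr (fun=> 2%:R)) => [|E EXB]; last first.
    by rewrite -[LHS]/(\sum_k (de E \o (fun k => q k E)) k); apply: sperm;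
      apply: inj_comp (ide E EXB) (pq.1 E EXB).
  rewrite sumr_const => /(f_equal val) e.
  have cX : #|X| = (#|X :\: B| + 3)%N.
    have <- : #|B| = 3%N by rewrite /B setUC cardsU1 cards2 La !inE negb_or ![b == _]eq_sym Lb ab.
    have BX : B \subset X by apply/subsetP => i; rewrite !inE => /orP [/orP [] |] /eqP ->.
    by rewrite -(cardsID B X) (setIidPr BX) addnC.
  rewrite cX oddD /= addbT; apply/negP => od; move: e.
  have [m ->] : exists m, #|X :\: B| = m.*2.+1 by exists (#|X :\: B|)./2; rewrite -[LHS]odd_double_half od.
  rewrite mulrS -mul2n mulrnA (_ : 2%:R *+ 2 = 0 :> 'I_4) ?mul0rn //; exact: val_inj.
have igl : injective (fun v => gl v - cf r0) by move=> u v /addIr /perm_inj.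
have ine E : injective (fun v => if E \in X :\: B then - de E v else v).
  by case EXB: (E \in X :\: B) => u v // /oppr_inj /(ide _ EXB).
(* The additive shift is distributed over the labels: its constant goes to L, its increment along E
   goes to E with a minus sign. *)
pose phi i := if i == L then perm igl else if i == a then gx else if i == b then gy else perm (ine i).
exists b, phi; split=> // z az pz.
have phib : phi b = gy by rewrite /phi ![b == _]eq_sym (negbTE Lb) (negbTE ab) eqxx.
pose r1 := [ffun i => if i \in B then r0 i else z i].
have ag1 : agree (X :\: B) r0 r1.
  by move=> i; rewrite inE negb_and negbK ffunE; case: (i \in B) => //= iX; apply: az.
have [h1 _] := hcf r1 ag1.
have agz : agree B r1 z by move=> i iB; rewrite ffunE (negbTE iB).
rewrite phib; have := h1 z agz pz; rewrite additive //.
suff -> : tsum X b phi z = Lval L a gl gx z - (cf r0 + \sum_(e in X :\: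
  B) (cf (upd r0 e (r1 e)) - cf r0)) by [].
rewrite /tsum (bigD1 L) /=; last by rewrite LX.
rewrite (bigD1 a) /=; last by rewrite aX ab eq_sym.
rewrite {1}/phi eqxx {1}/phi eqxx [a == L]eq_sym (negbTE La) permE /Lval.
set S := \sum_(i | _) _; have -> : S = - \sum_(e in X :\: B) (cf (upd r0 e (r1 e)) - cf r0).
  rewrite /S -sumrN; apply: eq_big => [i|i]; first by rewrite !inE !negb_or; case: (i \in X); case: (i == L);
    case: (i == a); case: (i == b).
  move=> /andP [/andP [/andP [iX ib] iL] ia]; have iXB : i \in X :\: B by rewrite !inE !negb_or iL ia ib.
  by rewrite /phi (negbTE iL) (negbTE ia) (negbTE ib) permE iXB /de /r1 ffunE; move: iXB;
    rewrite inE => /andP [/negbTE ->].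
by ring.
Qed.
End Conclusion.

Section Cases.
Variables (R : realType) (d : nat) (A : dmatrix R d 4).
Hypothesis pA : polystochastic A.
Variables (X : {set 'I_d}) (r0 : idx d 4) (zX : zero A X r0).
Variables (L a b : 'I_d).
Hypotheses (LX : L \in X) (aX : a \in X) (bX : b \in X) (un : uniq [:: L; a; b]).
Let B := [set L; a; b].
Variables (gl gx gy : 'S_4) (c : 'I_4 -> 'I_4) (q : 'I_4 -> idx d 4).
Hypothesis qX : forall i, i \in X :\: B -> injective (fun k => q k i).
Hypothesis qoff : forall k i, i \notin X -> q k i = r0 i.

Let neq3 : [/\ L != a, L != b & a != b].
Proof. by move: un; rewrite /= !inE !negb_or => /and3P [/andP [-> ->] ->]. Qed.

(** Resetting the block coordinates to [r0] gives a diagonal of X without the block; the blocks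
    themselves do not see these coordinates. *)
Let rest (s : 'I_4 -> 'I_4) k : idx d 4 := [ffun i => if i \in B then r0 i else q (s k) i].

Let rest_path s : injective s -> ppath (X :\: B) r0 (rest s).
Proof.
move=> is_; split=> [i iX k k'|k i]; rewrite !ffunE.
  by have := iX; rewrite inE => /andP [/negbTE -> _]; move/(qX iX)/is_.
by rewrite inE negb_and negbK; case: (i \in B) => //=; apply: qoff.
Qed.

Let rest_agree s k z : agree B (rest s k) z <-> agree B (q (s k)) z.
Proof. by split=> h i iB; rewrite h // ffunE (negbTE iB). Qed.

Lemma Vtype_impossible : \big[xor/0]_k c k = 0 ->
  (forall k : 'I_4, Vsup A L a b gl gx gy (2 <= k)%N (c k) (q k)) -> False.
Proof.
move=> c0 h; apply: (@V_impossible _ _ _ pA _ _ zX L a b LX aX bX un gl gx gy (rest id) c);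
  first exact: rest_path.
by split=> // k z /(rest_agree id) az; apply: h.
Qed.

(** [o] marks templates whose first two positions carry the twisted branch. Rotating the positions
    by 2 exchanges the two pairs and brings them to the form of [Linv]. *)
Lemma Ltype_conclusion o : \sum_k c k = 0 -> (forall k : 'I_4, Lsup A L a b gl gx gy (c k) (q k)) ->
  (forall k : 'I_4, exists z, [/\ agree B (q k) z, 0 < A z,
    Lval L a gl gx z = c k & gy (z b) = twist ((2 <= k)%N (+) o) 0]) ->
  odd #|X| /\ supptype A X r0.
Proof.
have [La Lb ab] := neq3; move=> c0 hs hw.
pose s (k : 'I_4) : 'I_4 := if o then k + 2%:R else k.
have is_ : injective s by rewrite /s; case: (o) => // u v /addIr.
have so (k : 'I_4) : (2 <= s k)%N (+) o = (2 <= k)%N.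
  by rewrite /s; case: o {s is_ hw} => /=; move: k; apply: I4_ind.
apply: (@Linv_conclusion _ _ _ pA X r0 zX L a b LX aX bX un gl gx gy (rest s) (c \o s));
  first exact: rest_path.
split=> [|k]; first by rewrite -[RHS]c0 [RHS](reindex_inj is_).
split=> z /rest_agree az; first exact: hs.
have [z0 [az0 pz0 tz0 yz0]] := hw (s k); rewrite so in yz0.
have isl : injective (fun v => gl v - c (s k)) by move=> u v /addIr /perm_inj.
pose phi i := if i == L then perm isl else if i == a then gx else gy.
have phib : phi b = gy by rewrite /phi ![b == _]eq_sym (negbTE Lb) (negbTE ab).
have tE w : tsum B b phi w = Lval L a gl gx w - c (s k).
  rewrite /tsum (bigD1 L) /=; last by rewrite !inE eqxx Lb.
  rewrite (bigD1 a) /=; last by rewrite !inE eqxx ab eq_sym La orbT.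
  rewrite big1 ?addr0 => [|i].
    by rewrite /phi eqxx [a == L]eq_sym (negbTE La) eqxx permE /Lval; ring.
  by rewrite !inE; case: (i == L); case: (i == a); case: (i == b).
have bB : b \in B by rewrite !inE eqxx !orbT.
have LB : L \in B by rewrite !inE eqxx.
have sup w : agree B (q (s k)) w -> 0 < A w -> upto_swap (tsum B b phi w) (phi b (w b)).
  by move=> aw pw; rewrite tE phib; apply: hs.
rewrite /= -tE -phib => ez; apply: (@pos_spread _ _ _ pA B (q (s k)) b phi bB sup L LB Lb (2 <= k)%N z0) =>
  //.
  by rewrite tE tz0 subrr.
by rewrite tE tz0 subrr phib yz0; case: (2 <= k)%N => //=; rewrite sw01K.
Qed.
End Cases.

(** Looks for a cell of [start k] at level t - c = 0, where the two branches can be told apart: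
    special label 0 shows that the plain branch is positive, label 1 that the twisted one is ([ty]
    is read as a number). *)
Definition start_witness (sw : bool) il ix iy (c : nat -> nat) (ty : bool) (k : nat) : bool :=
  has (fun x => let y := papp (start k) x in
    (sub4 (add4 (papp il k) (papp ix (if sw then y else x))) (c k) == 0) &&
    (papp iy (if sw then x else y) == ty))%N (iota 0 4).
Definition Lpar_ok (p : bool * nat * nat * nat * seq nat) : bool :=
  let: (sw, il, ix, iy, c) := p in
  [&& il < 24, ix < 24, iy < 24, all (fun k => nth 0 c k < 4) (iota 0 4),
      (nth 0 c 0 + nth 0 c 1 + nth 0 c 2 + nth 0 c 3) %% 4 == 0 &
      all (fun k => start_witness sw il ix iy (nth 0 c) (2 <= k) k) (iota 0 4) ||
      all (fun k => start_witness sw il ix iy (nth 0 c) (~~ (2 <= k)) k) (iota 0 4)]%N.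
Definition Vpar_ok (p : bool * nat * nat * nat * seq nat) : bool :=
  let: (sw, il, ix, iy, c) := p in
  [&& il < 24, ix < 24, iy < 24, all (fun k => nth 0 c k < 4) (iota 0 4) &
      xor4 (nth 0 c 0) (xor4 (nth 0 c 1) (xor4 (nth 0 c 2) (nth 0 c 3))) == 0]%N.

Lemma par_L_ok : all Lpar_ok par_L. Proof. by vm_compute. Qed.
Lemma par_V_ok : all Vpar_ok par_V. Proof. by vm_compute. Qed.

Lemma digits2 (k l : 'I_4) : digit 1 (4 * k + l) = k /\ digit 0 (4 * k + l) = l.
Proof.
rewrite /digit expn0 divn1 expn1 mulnC divnMDl // divn_small // addn0 modn_small //.
by rewrite modnMDl modn_small.
Qed.

Section CaseE.
Variables (R : realType) (d : nat) (A : dmatrix R d 4).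
Hypothesis pA : polystochastic A.

(** Four coordinates provide L for the blocks and E for excluding the sporadic ones. [FL], [FA],
    [FB] carry the labels of the templates back to the array; templates with [sw] have a as special
    coordinate, whence the uses with a and b exchanged. *)
Lemma zero_of_positive_slice (X : {set 'I_d}) r0 (a b : 'I_d) (p : 'I_4 -> idx d 4) :
  zero A X r0 -> a \in X -> b \in X -> a != b -> (4 <= #|X|)%N ->
  (forall i, i \in X -> i != a -> i != b -> injective (fun k => p k i)) ->
  (forall k i, i \notin X -> p k i = r0 i) ->
  (forall k, p k a = p 0 a) -> (forall k, p k b = p 0 b) -> (forall k, 0 < A (p k)) ->
  odd #|X| /\ supptype A X r0.
Proof.
move=> zX aX bX ab X4 pX poff pa pb pp0.
have : (1 < #|X :\: [set a; b]|)%N.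
  have c2 : (#|X :&: [set a; b]| <= 2)%N by apply: leq_trans (subset_leq_card (subsetIr X _)) _;
    rewrite cards2 ab.
  by move: X4; rewrite -(cardsID [set a; b] X); move: c2; move: #|X :&: _| #|X :\: _| => u v; lia.
case/card_gt1P => E [L []]; rewrite !inE !negb_or => /andP [/andP [Ea Eb] EX] /andP [/andP [La Lb] LX] EL.
have [kap [al [be [ik ia ib hst [i lti hrel]]]]] := start_templates pA zX LX aX bX ab La Lb pX poff pa pb pp0.
set q := fun k => p (kap k) in hst hrel.
set B := B2 _ _ _ _ _ _ _ _ in hst hrel.
have qX j : j \in X -> j != a -> j != b -> injective (fun k => q k j).
  by move=> jX ja jb k k' /(pX j jX ja jb) /ik.
have qoff k j : j \notin X -> q k j = r0 j by move=> jX; apply: poff.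
have iqL := qX L LX La Lb.
pose FL := perm iqL; pose FA := perm ia; pose FB := perm ib.
have zB k z : agree [set L; a; b] (q k) z -> A z = B k ((FL^-1)%g (z L)) ((FA^-1)%g (z a)) ((FB^-1)%g (z b)).
  move=> az; rewrite /B /B2 -[q _ L](permE iqL) -/FL -[al _](permE ia) -[be _](permE ib) -/FA -/FB !permKV.
  congr A; apply/ffunP => j; rewrite !ffunE; case: eqP => [-> //|/eqP jb]; case: eqP => [-> //|/eqP ja];
    case: eqP => [-> //|/eqP jL].
  by rewrite az // !inE !negb_or jL ja jb.
have Bz k l x y : exists z, [/\ agree [set L; a;
  b] (q k) z, A z = B k l x y, (FL^-1)%g (z L) = l, (FA^-1)%g (z a) = x & (FB^-1)%g (z b) = y].
  exists (upd (upd (upd (q k) L (q l L)) a (al x)) b (be y)); split=> //.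
  - by do 3!(apply: agree_upd; first by rewrite !inE eqxx ?orbT).
  - by rewrite upd_other // upd_other // upd_same; apply: (canLR (permK FL)); rewrite permE.
  - by rewrite upd_other // upd_same; apply: (canLR (permK FA)); rewrite permE.
  - by rewrite upd_same; apply: (canLR (permK FB)); rewrite permE.
have unab : uniq [:: L; a; b] by rewrite /= !inE !negb_or La Lb ab.
have unba : uniq [:: L; b; a] by rewrite /= !inE !negb_or La Lb eq_sym ab.
have setba : [set L; b; a] = [set L; a; b] by rewrite -!setUA [[set b] :|: _]setUC.
have qXB j : j \in X :\: [set L; a; b] -> injective (fun k => q k j).
  by rewrite !inE !negb_or => /andP [/andP [/andP [_ ja] jb] jX]; apply: qX.
move: hrel lti; rewrite /start_rels !nth_cat !size_cat !size_map => hrel lti.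
have [lt0|ge0] := ltnP i (size par_L).
  have := allP par_L_ok (nth (true, 0, 0, 0, [::])%N par_L i) (mem_nth _ lt0).
  rewrite lt0 (nth_map (true, 0, 0, 0, [::])%N) // in hrel.
  case: (nth _ _ _) hrel => [[[[sw il] ix] iy] c] hrel.
  case/and5P => /papp_perm [gl Hl] /papp_perm [gx Hx] /papp_perm [gy Hy] c4 /andP [cs wit].
  pose cc (k : 'I_4) : 'I_4 := inord (nth 0%N c k).
  have ccE (k : 'I_4) : nth 0%N c k = cc k :> nat.
    by rewrite inordK //; have /allP := c4; apply; rewrite mem_iota ltn_ord.
  have sumc : \sum_k cc k = 0.
    have e (x y z w : 'I_4) : val (x + y + z + w) = ((x + y + z + w) %% 4)%N.
      by move: x y z w; do 4!apply: I4_ind.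
    by apply: val_inj; rewrite sumI4 e -!ccE; apply/eqP; exact: cs.
  have [o wit'] : exists o, forall k : 'I_4, start_witness sw il ix iy (nth 0%N c) ((2 <= k)%N (+) o) k.
    by case/orP: wit => /allP w; [exists false | exists true] => k; rewrite ?addbF ?addbT; apply: w;
      rewrite mem_iota ltn_ord.
  have {wit} wit (k : 'I_4) : exists x : 'I_4, let y := pp (start k) x in
      gl k + gx (if sw then y else x) = cc k /\ gy (if sw then x else y) = twist ((2 <= k)%N (+) o) 0.
    have hs : (start k < 24)%N by case: k => [[|[|[|[|//]]]] ?].
    have /hasP [x] := wit' k; rewrite mem_iota => hx /andP [/eqP e1 /eqP e2].
    exists (Ordinal hx : 'I_4); split.
      apply/eqP; rewrite -subr_eq0; apply/eqP/ord_inj; rewrite [RHS]/= -[RHS]e1.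
      rewrite -sub4E -add4E -Hl -ccE -Hx; congr (sub4 (add4 _ (papp ix _)) _).
      by case: (sw) => //; rewrite pp_val.
    apply: ord_inj; rewrite -Hy (_ : nat_of_ord (if sw then _ else _) = if sw then x else papp (start k) x);
      last first.
      by case: (sw) => //; rewrite pp_val.
    by rewrite e2; case: (_ (+) _) => //=; rewrite /sw01 tpermL.
  have hsup (k : 'I_4) z : agree [set L; a; b] (q k) z -> 0 < A z ->
     rel_L sw il ix iy (nth 0%N c) k ((FL^-1)%g (z L)) ((FA^-1)%g (z a)) ((FB^-1)%g (z b)).
    by move=> az; rewrite (zB k) // => /hrel; rewrite /at2; have [-> ->] := digits2 k ((FL^-1)%g (z L)).
  case: sw wit hsup {wit' hrel} => wit hsup.
    apply: (@Ltype_conclusion _ _ _ pA X r0 zX L b a LX bX aX unba (FL^-1 * gl)%g (FB^-1 * gx)%g (FA^-1 *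
      gy)%g cc q _ _ o) => //.
    - by move=> j; rewrite setba; apply: qXB.
    - move=> k z; rewrite setba => az pz; have := hsup k z az pz;
      rewrite /rel_L Hl Hx Hy ccE add4E sub4E /Lval !permM.
      by [].
    - move=> k; have [x [h1 h2]] := wit k; have [z [az zE zL za zb]] := Bz k k x (pp (start k) x).
      exists z; rewrite setba zE /Lval !permM zL za zb; split=> //; exact: hst.
  apply: (@Ltype_conclusion _ _ _ pA X r0 zX L a b LX aX bX unab (FL^-1 * gl)%g (FA^-1 * gx)%g (FB^-1 * gy)%g
    cc q _ _ o) => //.
  - move=> k z az pz; have := hsup k z az pz; rewrite /rel_L Hl Hx Hy ccE add4E sub4E /Lval !permM.
    by [].
  - move=> k; have [x [h1 h2]] := wit k; have [z [az zE zL za zb]] := Bz k k x (pp (start k) x).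
    exists z; rewrite zE /Lval !permM zL za zb; split=> //; exact: hst.
have nlt0 : (i < size par_L)%N = false by apply/negbTE; rewrite -leqNgt.
rewrite nlt0 in hrel; set i1 := (i - size par_L)%N in hrel.
have [lt1|ge1] := ltnP i1 (size par_V).
  exfalso; have := allP par_V_ok (nth (true, 0, 0, 0, [::])%N par_V i1) (mem_nth _ lt1).
  rewrite lt1 (nth_map (true, 0, 0, 0, [::])%N) // in hrel.
  case: (nth _ _ _) hrel => [[[[sw il] ix] iy] c] hrel.
  case/and5P => /papp_perm [gl Hl] /papp_perm [gx Hx] /papp_perm [gy Hy] c4 cs.
  pose cc (k : 'I_4) : 'I_4 := inord (nth 0%N c k).
  have ccE (k : 'I_4) : nth 0%N c k = cc k :> nat.
    by rewrite inordK //; have /allP := c4; apply; rewrite mem_iota ltn_ord.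
  have sumc : \big[xor/0]_k cc k = 0.
    have -> : \big[xor/0]_k cc k = xor (cc 0) (xor (cc 1) (xor (cc 2%:R) (cc 3%:R))).
      by rewrite !big_ord_recl big_ord0 xor0; do !congr (xor _ _); congr (cc _); apply: val_inj.
    by apply: val_inj; rewrite /= -!xorE -!ccE; apply/eqP; exact: cs.
  have hsup (k : 'I_4) z : agree [set L; a; b] (q k) z -> 0 < A z ->
     rel_V sw il ix iy (nth 0%N c) k ((FL^-1)%g (z L)) ((FA^-1)%g (z a)) ((FB^-1)%g (z b)).
    by move=> az; rewrite (zB k) // => /hrel; rewrite /at2; have [-> ->] := digits2 k ((FL^-1)%g (z L)).
  case: sw hsup {hrel} => hsup.
    apply: (@Vtype_impossible _ _ _ pA X r0 zX L b a LX bX aX unba (FL^-1 * gl)%g (FB^-1 * gx)%g (FA^-1 *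
      gy)%g cc q) => //.
      by move=> j; rewrite setba; apply: qXB.
    move=> k z; rewrite setba => az pz; have := hsup k z az pz;
      rewrite /rel_V Hl Hx Hy ccE !xorE /Vval !permM => /eqP e.
    by apply: val_inj; rewrite [LHS]e ltnNge; case: (2 <= k)%N => //=; rewrite omegaE.
  apply: (@Vtype_impossible _ _ _ pA X r0 zX L a b LX aX bX unab (FL^-1 * gl)%g (FA^-1 * gx)%g (FB^-1 * gy)%g
    cc q) => //.
  move=> k z az pz; have := hsup k z az pz; rewrite /rel_V Hl Hx Hy ccE !xorE /Vval !permM => /eqP e.
  by apply: val_inj; rewrite [LHS]e ltnNge; case: (2 <= k)%N => //=; rewrite omegaE.
have nlt1 : (i1 < size par_V)%N = false by apply/negbTE; rewrite -leqNgt.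
have lti2 : (i1 - size par_V < size sporadic)%N by rewrite ltn_subLR // /i1 ltn_subLR.
rewrite nlt1 (nth_map [::]) // in hrel.
exfalso; apply: (@sporadic_impossible _ _ _ pA X r0 zX q E L a b al be (i1 - size par_V)) => //.
- by rewrite /= !inE !negb_or EL Ea Eb La Lb ab.
- by move=> j jX; rewrite !inE !negb_or => /and3P [_ ja jb]; apply: qX.
Qed.
End CaseE.

(** * All slices of codimension two are zero *)

(* s is the centre of a star of non-edges. *)
Lemma no_star_graph (T : finType) (X : {set T}) (g : rel T) : (5 <= #|X|)%N ->
  (forall a b, a \in X -> b \in X -> a != b -> exists2 s, s \in X :\: [set a; b] &
     forall e f, e \in X :\: [set a; b] -> f \in X :\: [set a;
       b] -> e != f -> g e f = (e != s) && (f != s)) ->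
  False.
Proof.
move=> X5 H.
have H' a b : a \in X -> b \in X -> a != b -> exists s, [/\ s \in X, s != a, s != b &
     forall e f, e \in X -> f \in X -> e != a -> e != b -> f != a -> f != b -> e != f ->
       g e f = (e != s) && (f != s)].
  move=> aX bX ab; have [s sY h] := H a b aX bX ab; exists s.
  move: sY; rewrite !inE negb_or => /andP [/andP [sa sb] sX]; split=> // e f eX fX ea eb fa fb ef.
  by apply: h; rewrite // !inE negb_or ?ea ?eb ?fa ?fb ?eX ?fX.
have /card_gt1P [a [b [aX bX ab]]] : (1 < #|X|)%N by apply: leq_trans X5.
have [s [sX sa sb hs]] := H' a b aX bX ab.
have : (1 < #|X :\: [set a; b; s]|)%N.
  have c3 : (#|X :&: [set a; b; s]| <= 3)%N.
    apply: leq_trans (subset_leq_card (subsetIr X _)) _.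
    by rewrite setUC cardsU1 cards2; case: (_ \notin _); case: (_ == _).
  by move: X5; rewrite -(cardsID [set a; b; s] X); move: c3; move: #|X :&: _| #|X :\: _| => u v; lia.
case/card_gt1P => e [f []]; rewrite !inE !negb_or =>
  /andP [/andP [/andP [ea eb] es] eX] /andP [/andP [/andP [fa fb] fs] fX] ef.
have [as_ bs] : a != s /\ b != s by rewrite ![_ == s]eq_sym.
have [ae af be bf] : [/\ a != e, a != f, b != e & b != f] by rewrite ![a == _]eq_sym ![b == _]eq_sym.
have [se sf] : s != e /\ s != f by rewrite ![s == _]eq_sym.
have ba : b != a by rewrite eq_sym.
have fe : f != e by rewrite eq_sym.
(* Any centre other than b would be one of the vertices outside a, b, s, all of which are joined to
   each other by [hs]. *)
have [c1 [c1X c1s c1a h1]] := H' s a sX aX sa.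
have c1b : c1 = b.
  apply/eqP; apply: contraT => ne.
  case: (eqVneq e c1) => [e1|ne1].
    have := h1 e f eX fX es ea fs fa ef; rewrite -e1 eqxx hs // es fs; by [].
  have := h1 e c1 eX c1X es ea c1s c1a ne1; rewrite eqxx andbF hs // es c1s; by [].
have gbe : g b e = false by rewrite h1 // c1b eqxx.
have gbf : g b f = false by rewrite h1 // c1b eqxx.
have [c2 [c2X c2s c2b h2]] := H' s b sX bX sb.
have c2a : c2 = a.
  apply/eqP; apply: contraT => ne.
  case: (eqVneq e c2) => [e1|ne1].
    have := h2 e f eX fX es eb fs fb ef; rewrite -e1 eqxx hs // es fs; by [].
  have := h2 e c2 eX c2X es eb c2s c2b ne1; rewrite eqxx andbF hs // es c2s; by [].
have gae : g a e = false by rewrite h2 // c2a eqxx.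
have gaf : g a f = false by rewrite h2 // c2a eqxx.
have gsf : g s f = false by rewrite hs // eqxx.
have [c3 [c3X c3s c3f h3]] := H' s f sX fX sf.
have two (c x y z : T) : (x != c) && (z != c) = false -> (y != c) && (z != c) = false -> x != y -> c = z.
  case: (eqVneq z c) => // _; rewrite !andbT => /negbFE /eqP -> /negbFE /eqP ->.
  by rewrite eqxx.
have c3e : c3 = e by apply: (two _ b a) => //; [rewrite -h3 | rewrite -h3].
have gab : g a b by rewrite h3 // c3e ae be.
have [c4 [c4X c4e c4b h4]] := H' e b eX bX eb.
have c4f : c4 = f.
  by apply: (two _ s a); [rewrite -h4 | rewrite -h4 | ] => //; rewrite eq_sym.
have gas : g a s by rewrite h4 // c4f af sf.
(* The edges from a to b and to s exclude a, b and s as centre, so c is a sixth vertex; [hs] joins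
   it to e while [h3], with centre e, does not. *)
have [c [cX ce cf hc]] := H' e f eX fX ef.
have ca : c != a by apply: contraL gab => /eqP e1; rewrite hc // -e1 eqxx.
have cb : c != b by apply: contraL gab => /eqP e1; rewrite hc // -e1 eqxx andbF.
have cs : c != s by apply: contraL gas => /eqP e1; rewrite hc // -e1 eqxx andbF.
have ec : e != c by rewrite eq_sym.
have := h3 e c eX cX es ef cs cf ec; rewrite c3e eqxx hs //.
by rewrite es cs.
Qed.

Section Exact.
Variables (R : realType) (d : nat) (A : dmatrix R d 4).
Hypothesis pA : polystochastic A.
Implicit Types (X Y : {set 'I_d}) (r : idx d 4).

Definition fractional (z : idx d 4) : bool := (0 < A z) && (A z < 1).
(* When an entry q is fractional, this fails exactly when e or f is the special coordinate of a restriction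
   through q containing e and f. *)
Definition fractional_plane (q : idx d 4) (e f : 'I_d) : bool := [forall u, exists v,
  fractional (upd (upd q e u) f v)].

Lemma other_coord Y (s : 'I_d) : (2 <= #|Y|)%N -> exists2 L, L \in Y & L != s.
Proof.
move=> Y2; have : (0 < #|Y :\ s|)%N by move: Y2; rewrite (cardsD1 s Y); case: (s \in Y);
  rewrite ?add1n ?add0n // => /ltnW.
by case/card_gt0P => L; rewrite !inE => /andP [Ls LY]; exists L.
Qed.

(** An entry is fractional exactly when l is and both t and the special label lie in {0, 1}. If e is
    special, a choice of u puts the label at 2; if f is special, it puts t at 2; no v can repair
    either. In the remaining case v brings t back to 0. *)
Lemma fractional_plane_star Y q : (3 <= #|Y|)%N -> supptype A Y q -> fractional q ->
  exists2 s, s \in Y & forall e f, e \in Y -> f \in Y -> e != f ->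
    fractional_plane q e f = (e != s) && (f != s).
Proof.
move=> Y3 [s [phi [sY supp]]] fq; exists s => // e f eY fY ef.
have [L LY Ls] := other_coord s (ltnW Y3).
have [l l01 lE] := lambda_form pA sY supp LY Ls.
have agq : agree Y q q by [].
have two (t y : 'I_4) (w : R) : w = l * (t == y)%:R + (1 - l) * (t == sw01 y)%:R ->
   (0 < w < 1) = [&& (0 < l < 1), (t == 0) || (t == 1) & (y == 0) || (y == 1)].
  move=> ->; move: t y; apply: I4_ind; apply: I4_ind;
    rewrite /sw01 !permE /= ?andbT ?andbF ?mulr1 ?mulr0 ?addr0 ?add0r ?ltxx //.
  all: try (apply/negP; lra).
  all: try (by apply/idP/idP; lra).
have fracE z : agree Y q z -> fractional z = [&& (0 < l < 1),
  (tsum Y s phi z == 0) || (tsum Y s phi z == 1) & (phi s (z s) == 0) || (phi s (z s) == 1)].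
  by move=> az; apply: two; apply: lE.
have := fq; rewrite fracE // => /and3P [l01' t01 y01].
have ag2 u v : agree Y q (upd (upd q e u) f v) by do 2!apply: agree_upd => //.
rewrite /fractional_plane; case: (eqVneq e s) => [es|es] /=.
  apply/forallP => /(_ ((phi s)^-1%g 2%:R)) /existsP [v];
    rewrite fracE // -es upd_other // upd_same es permKV.
  by rewrite !andbF.
case: (eqVneq f s) => [fs|fs] /=.
  apply/forallP => /(_ ((phi e)^-1%g (2%:R - tsum Y s phi q + phi e (q e)))) /existsP [v]; rewrite fracE //.
  rewrite -[in tsum _ _ _ _]fs /=; subst s; rewrite tsum_upds tsum_upd // permKV.
  have -> : tsum Y f phi q - phi e (q e) + (2%:R - tsum Y f phi q + phi e (q e)) = 2%:R by ring.
  by rewrite !andbF.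
apply/forallP => u; pose q1 := upd q e u.
apply/existsP; exists ((phi f)^-1%g (- tsum Y s phi q1 + phi f (q1 f))).
rewrite fracE // tsum_upd // permKV l01' !upd_other 1?eq_sym // y01 andbT.
by rewrite (_ : _ + _ = 0) ?eqxx //; ring.
Qed.

(** The relation [fractional_plane q] does not depend on the removed pair, so the stars of all
    restrictions through q are parts of one graph on X. *)
Lemma exact_of_slices X r : (5 <= #|X|)%N ->
  (forall a b z, a \in X -> b \in X -> a != b -> agree X r z -> supptype A (X :\: [set a; b]) z) ->
  forall q, agree X r q -> ~~ fractional q.
Proof.
move=> X5 H q aq; apply/negP => fq.
apply: (@no_star_graph _ X (fractional_plane q) X5) => a b aX bX ab.
apply: fractional_plane_star => //; last exact: H.
have c2 : (#|X :&: [set a; b]| <= 2)%N by apply: leq_trans (subset_leq_card (subsetIr X _)) _;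
  rewrite cards2 ab.
by move: X5; rewrite -(cardsID [set a; b] X); move: c2; move: #|X :&: _| #|X :\: _| => u v; lia.
Qed.

(* The support of a relabelled M_4. *)
Definition mform X r : Prop := exists psi : 'I_d -> 'S_4,
  forall z, agree X r z -> 0 < A z -> \sum_(i in X) psi i (z i) = 0.

Definition perm_opp (g : 'S_4) : 'S_4 := perm (inj_comp (@oppr_inj 'I_4) (@perm_inj _ g)).

Lemma mform_supptype X r : X != set0 -> mform X r -> supptype A X r.
Proof.
case/set0Pn => s sX [psi h]; exists s, (fun i => if i == s then perm_opp (psi s) else psi i);
  split=> // z az pz.
rewrite eqxx upto_swapE permE /=; apply/orP; left;
  rewrite -subr_eq0 opprK -(h z az pz) [in eqbRHS](bigD1 s) //= addrC.
apply/eqP; congr (_ + _); apply: eq_bigr => i /andP [_ /negbTE ->] //.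
Qed.

Lemma mform_of_supptype X r : (2 <= #|X|)%N -> supptype A X r -> (forall z, agree X r z -> ~~ fractional z) ->
  mform X r.
Proof.
move=> X2 [s [phi [sX supp]]] nf.
have [L LX Ls] := other_coord s X2.
have [l l01 lE] := lambda_form pA sX supp LX Ls.
(* At t = y = 0 the branches are separate and the entry is l itself, hence 0 or 1. For l = 0 the
   transposition is absorbed into the label of s. *)
pose z0 := upd (upd r s ((phi s)^-1%g 0)) L ((phi L)^-1%g (- tsum X s phi (upd r s ((phi s)^-1%g 0)) + phi L
  (r L))).
have az0 : agree X r z0 by do 2!apply: agree_upd => //.
have t0 : tsum X s phi z0 = 0.
  by rewrite /z0 tsum_upd // permKV upd_other //; ring.
have y0 : phi s (z0 s) = 0 by rewrite /z0 upd_other 1?eq_sym // upd_same permKV.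
have A0 : A z0 = l by rewrite lE // t0 y0 eqxx /sw01 tpermL /= mulr1 mulr0 addr0.
have l2 : l = 1 \/ l = 0.
  have := nf z0 az0; rewrite /fractional A0; case/andP: l01 => l0 l1.
  rewrite negb_and -!leNgt => /orP [h|h]; [right|left]; apply/eqP; rewrite eq_le ?h ?l0 ?l1 //.
pose tw := fun i => if i == s then perm_opp (if l == 1 then phi s else (phi s * tperm 0%R 1%R)%g) else phi i.
exists tw => z az pz; rewrite (bigD1 s) //= {1}/tw eqxx permE /=.
have -> : \sum_(i in X | i != s) tw i (z i) = tsum X s phi z.
  by apply: eq_bigr => i /andP [_ /negbTE is_]; rewrite /tw is_.
apply/eqP; rewrite addrC subr_eq0; move: pz; rewrite lE //; case: l2 => ->.
  by rewrite eqxx subrr mul0r addr0 mul1r; case: eqP => //; rewrite ltxx.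
rewrite mul0r add0r subr0 mul1r [0 == 1]eq_sym oner_eq0 permM -/(sw01 _); by case: eqP => //; rewrite ltxx.
Qed.
End Exact.

(** * Gluing the restrictions for seven or more coordinates *)

Section Glue.
Variables (R : realType) (d : nat) (A : dmatrix R d 4).
Hypothesis pA : polystochastic A.
Variables (X : {set 'I_d}) (r0 : idx d 4).
Hypothesis exactA : forall z, agree X r0 z -> ~~ fractional A z.
Hypothesis X7 : (7 <= #|X|)%N.
Hypothesis Hm : forall a b z, a \in X -> b \in X -> a != b -> agree X r0 z -> mform A (X :\: [set a; b]) z.
Variables (y : 'I_d) (qf : idx d 4 -> 'I_4).
Hypothesis yX : y \in X.
Hypothesis qfP : forall r, 0 < A (upd r y (qf r)).

Lemma pos_one z : agree X r0 z -> 0 < A z -> A z = 1.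
Proof.
move=> az pz; have := exactA az; rewrite /fractional pz /= -leNgt => h.
apply/eqP; rewrite eq_le h andbT -(pA.2 y z) (bigD1 (z y)) //= upd_id lerDl.
by apply: sumr_ge0 => k _; apply: pA.1.
Qed.

Lemma line_unique z i u v : agree X r0 z -> i \in X -> 0 < A (upd z i u) -> 0 < A (upd z i v) -> u = v.
Proof.
move=> az iX pu pv; apply/eqP; apply: contraT => uv.
have := pA.2 i z; rewrite (bigD1 u) //= (bigD1 v) 1?eq_sym //=.
rewrite (pos_one (agree_upd u iX az) pu) (pos_one (agree_upd v iX az) pv).
set S := \sum_(_ | _) _; have S0 : 0 <= S by apply: sumr_ge0 => k _; apply: pA.1.
by move=> e1; exfalso; move: S0 e1; lra.
Qed.

Lemma qf_eq z : agree X r0 z -> 0 < A z -> qf z = z y.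
Proof. by move=> az pz; apply: (line_unique az yX (qfP z)); rewrite upd_id. Qed.

Lemma qf_updy z k : agree X r0 z -> qf (upd z y k) = qf z.
Proof.
move=> az; have p1 := qfP (upd z y k); rewrite upd_upd in p1.
exact: (line_unique az yX p1 (qfP z)).
Qed.

Lemma qf_inj z e : agree X r0 z -> e \in X -> e != y -> injective (fun u => qf (upd z e u)).
Proof.
move=> az eX ey u v /= h; have pu := qfP (upd z e u); have pv := qfP (upd z e v).
rewrite h in pu; rewrite updC // in pu; rewrite updC // in pv.
exact: (line_unique (agree_upd _ yX az) eX pu pv).
Qed.

(* If two relabellings phi both make [qf] additive on one plane, they differ by an affine bijection of Z/4,
   so they make it additive on the same planes; this propagates [planar phi] from one plane to all. *)
Definition planar (phi : 'I_4 -> 'I_4) (r : idx d 4) (e f : 'I_d) : Prop := forall u u' v v',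
  phi (qf (upd (upd r e u) f v)) + phi (qf (upd (upd r e u') f v')) =
  phi (qf (upd (upd r e u) f v')) + phi (qf (upd (upd r e u') f v)).

Lemma planar_mform (Y : {set 'I_d}) r (psi : 'I_d -> 'S_4) : Y \subset X -> y \in Y -> agree X r0 r ->
  (forall z, agree Y r z -> 0 < A z -> \sum_(i in Y) psi i (z i) = 0) ->
  forall e f z, e \in Y -> f \in Y -> e != y -> f != y -> e != f -> agree Y r z -> planar (psi y) z e f.
Proof.
move=> YX yY ar h e f z eY fY ey fy ef az.
have qE w : agree Y r w -> psi y (qf w) = - \sum_(i in Y | i != y) psi i (w i).
  move=> aw; apply/eqP; rewrite -addr_eq0; apply/eqP.
  rewrite -[RHS](h (upd w y (qf w))) //; last exact: agree_upd.
  rewrite [in RHS](bigD1 y) //= upd_same; congr (_ + _); apply: eq_bigr => i /andP [_ iy].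
  by rewrite upd_other.
have qE2 u v : psi y (qf (upd (upd z e u) f v)) = - (psi e u + psi f v + \sum_(i in Y
  | (i != y) && (i != e) && (i != f)) psi i (z i)).
  rewrite qE; last by do 2!apply: agree_upd => //.
  congr (- _); rewrite (bigD1 e) ?eY //= (bigD1 f) ?fY ?fy 1?eq_sym //=.
  rewrite upd_other // !upd_same addrA; congr (_ + _).
  apply: eq_big => [i|i /andP [/andP [_ ie] if_]]; first by rewrite !andbA.
  by rewrite !upd_other.
by move=> u u' v v'; rewrite !qE2; ring.
Qed.

Lemma planar_transfer (phi phi' : 'S_4) r e f : agree X r0 r -> e \in X -> f \in X -> e != y -> f != y ->
  e != f ->
  planar phi r e f -> planar phi' r e f -> forall r' e' f', planar phi' r' e' f' -> planar phi r' e' f'.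
Proof.
move=> ar eX fX ey fy ef P P'.
pose th := (phi'^-1 * phi)%g.
have thE w : phi w = th (phi' w) by rewrite permM permK.
(* [qf] is bijective in each direction of the plane, so any c, a, b occur as the phi' values at
   three corners of a rectangle. The fourth corner is a + b - c for phi' and, by the law for phi, th
   a + th b - th c after applying th. *)
have aff a b c : th (a + b - c) = th a + th b - th c.
  pose z := phi'^-1%g c.
  have ie : injective (fun u => phi' (qf (upd r e u))) by move=> u v /perm_inj; apply: qf_inj.
  have [g gK Kg] := injF_bij ie; pose u0 := g c.
  have e0 : phi' (qf (upd r e u0)) = c by rewrite /u0 Kg.
  have if_ : injective (fun v => phi' (qf (upd (upd r e u0) f v))).
    by move=> u v /perm_inj; apply: qf_inj => //; apply: agree_upd.
  have [g2 g2K Kg2] := injF_bij if_; pose v0 := g2 c; pose v := g2 b.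
  have e1 : phi' (qf (upd (upd r e u0) f v0)) = c by rewrite /v0 Kg2.
  have e2 : phi' (qf (upd (upd r e u0) f v)) = b by rewrite /v Kg2.
  have ie3 : injective (fun u => phi' (qf (upd (upd r e u) f v0))).
    move=> u w /perm_inj; rewrite !(updC _ _ _ ef); apply: qf_inj => //; exact: agree_upd.
  have [g3 g3K Kg3] := injF_bij ie3; pose u := g3 a.
  have e3 : phi' (qf (upd (upd r e u) f v0)) = a by rewrite /u Kg3.
  have := P' u0 u v0 v; rewrite e1 e2 e3 => h; have e4 : phi' (qf (upd (upd r e u) f v)) = a + b - c.
    by apply: (addrI c); rewrite h; ring.
  have := P u0 u v0 v; rewrite !thE e1 e2 e3 e4 => h4.
  by apply: (addrI (th c)); rewrite h4; ring.
move=> r' e' f' Q u u' v v'; rewrite !thE.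
have := Q u u' v v'; set x1 := phi' _; set x2 := phi' _; set x3 := phi' _; set x4 := phi' _ => h.
have -> : x2 = x3 + x4 - x1 by apply: (addrI x1); rewrite h; ring.
by rewrite aff; ring.
Qed.

Lemma avoid5 (s : seq 'I_d) : (size s <= 5)%N -> exists a b, [/\ a \in X, b \in X, a != b & forall i,
  i \in s -> i != a /\ i != b].
Proof.
move=> s5; have : (1 < #|X :\: [set x in s]|)%N.
  have c5 : (#|X :&: [set x in s]| <= 5)%N.
    apply: leq_trans (subset_leq_card (subsetIr X _)) _; apply: leq_trans s5.
    by rewrite cardsE; apply: card_size.
  by move: X7; rewrite -(cardsID [set x in s] X); move: c5; move: #|X :&: _| #|X :\: _| => u v; lia.
case/card_gt1P => a [b []]; rewrite !inE => /andP [as_ aX] /andP [bs bX] ab.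
exists a, b; split=> // i is_; split; [apply: contraNneq as_|apply: contraNneq bs]; by move=> <-.
Qed.

Lemma mform_glue : mform A X r0.
Proof.
have sub r (s : seq 'I_d) : agree X r0 r -> (size s <= 5)%N -> {subset s <= X} -> exists (Y :
  {set 'I_d}) (psi : 'I_d -> 'S_4), [/\ Y \subset X, {subset s <= Y} &
    forall z, agree Y r z -> 0 < A z -> \sum_(i in Y) psi i (z i) = 0].
  move=> ar s5 sX; have [a [b [aX bX ab h]]] := avoid5 s5.
  have [psi hpsi] := Hm aX bX ab ar; exists (X :\: [set a; b]), psi; split=> //; first exact: subsetDl.
  by move=> i is_; have [h1 h2] := h i is_; rewrite !inE negb_or h1 h2 sX.
have card_pick (s : seq 'I_d) : (size s <= 5)%N -> exists a, a \in X /\ a \notin s.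
  by move=> /avoid5 [a [b [aX _ _ h]]]; exists a; split=> //; apply/negP => /h [] /eqP.
have [e0 [e0X e0y]] := card_pick [:: y] isT.
have [f0 [f0X f0y]] := card_pick [:: y; e0] isT.
move: e0y f0y; rewrite !inE negb_or => e0y /andP [f0y f0e0].
have e0f0 : e0 != f0 by rewrite eq_sym.
have ag0 : agree X r0 r0 by [].
have s3 : {subset [:: y; e0; f0] <= X} by move=> i; rewrite !inE => /or3P [] /eqP ->.
have [Y0 [psi0 [YX0 sY0 h0]]] := sub _ [:: y; e0; f0] ag0 isT s3.
have Y0in : [/\ y \in Y0, e0 \in Y0 & f0 \in Y0] by split; apply: sY0; rewrite !inE eqxx ?orbT.
case: Y0in => yY0 eY0 fY0; pose phi := psi0 y.
have start : planar phi r0 e0 f0 by apply: (planar_mform YX0 yY0 ag0 h0).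
pose C r := exists e f, [/\ e \in X, f \in X, e != y, f != y & e != f /\ planar phi r e f].
have CP r : agree X r0 r -> C r -> forall e f h w, e \in X -> f \in X -> h \in X -> e != y -> f != y ->
  e != f ->
    planar phi r e f /\ (forall e' f', e' \in X -> f' \in X -> e' != y -> f' != y -> e' != f' ->
      planar phi r e' f' -> planar phi (upd r h w) e' f').
  move=> ar [e1 [f1 [e1X f1X e1y f1y [e1f1 P1]]]] e f h w eX fX hX ey fy ef; split.
    have s5 : {subset [:: y; e1; f1; e; f] <= X} by move=> i; rewrite !inE; do 4?[case/orP]; move/eqP ->.
    have [Y [psi [YX sY hY]]] := sub _ [:: y; e1; f1; e; f] ar isT s5.
    have [yY e1Y f1Y eY fY] : [/\ y \in Y, e1 \in Y, f1 \in Y, e \in Y & f \in Y] by split; apply: sY;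
      rewrite !inE eqxx ?orbT.
    apply: (planar_transfer ar e1X f1X e1y f1y e1f1 P1 (phi' := psi y)); exact: (planar_mform YX yY ar hY).
  move=> e' f' e'X f'X e'y f'y e'f' P'.
  have s4 : {subset [:: y; h; e'; f'] <= X} by move=> i; rewrite !inE; do 3?[case/orP]; move/eqP ->.
  have [Y [psi [YX sY hY]]] := sub _ [:: y; h; e'; f'] ar isT s4.
  have [yY hYY e'Y f'Y] : [/\ y \in Y, h \in Y, e' \in Y & f' \in Y] by split; apply: sY;
    rewrite !inE eqxx ?orbT.
  apply: (planar_transfer ar e'X f'X e'y f'y e'f' P' (phi' := psi y));
    first exact: (planar_mform YX yY ar hY).
  by apply: (planar_mform YX yY ar hY) => //; apply: agree_upd.
have allC : forall r, agree X r0 r -> C r.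
  apply: agree_ind => [|r h w hX ar Cr]; first by exists e0, f0.
  have [P0 _] := CP r ar Cr e0 f0 h w e0X f0X hX e0y f0y e0f0.
  have [_ Q] := CP r ar Cr e0 f0 h w e0X f0X hX e0y f0y e0f0.
  by exists e0, f0; split=> //; split=> //; apply: Q.
have allP r e f : agree X r0 r -> e \in X -> f \in X -> e != y -> f != y -> e != f -> planar phi r e f.
  by move=> ar eX fX ey fy ef; have [P _] := CP r ar (allC r ar) e f e (r e) eX fX eX ey fy ef.
pose g r := phi (qf r); pose X1 := X :\ y.
have X1X : {subset X1 <= X} by move=> i; rewrite inE => /andP [].
have ag1X r : agree X1 r0 r -> agree X r0 r by move=> h i iX; apply: h; apply: contra iX; apply: X1X.
have incr0 e u v b : e \in X1 -> agree X1 r0 b ->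
  g (upd b e u) - g (upd b e v) = g (upd r0 e u) - g (upd r0 e v).
  move=> eX1; have := eX1; rewrite inE => /andP []; rewrite inE => ey eX.
  move: b; apply: agree_ind => // b f w fX1 ab <-.
  have := fX1; rewrite inE => /andP []; rewrite inE => fy fX.
  case: (eqVneq f e) => [->|fe]; first by rewrite !upd_upd.
  have ef : e != f by rewrite eq_sym.
  have := allP b e f (ag1X _ ab) eX fX ey fy ef u v w (b f).
  have E u' : upd (upd b e u') f (b f) = upd b e u' by rewrite updC // upd_id.
  rewrite !E !(updC _ _ _ fe) -!/(g _) => h.
  by apply: (canLR (addrK _)); apply: (addIr (g (upd b e v))); rewrite h; ring.
have incr e a b u v : e \in X1 -> agree X1 r0 a -> agree X1 r0 b ->
  g (upd a e u) - g (upd a e v) = g (upd b e u) - g (upd b e v).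
  by move=> eX1 aa ab; rewrite !incr0.
have add := additive_of_increments incr.
have yX1 : y \notin X1 by rewrite !inE eqxx.
have ide e : injective (fun v => if e \in X1 then - (g (upd r0 e v) - g r0) else v).
  case eX1: (e \in X1) => u v //= /oppr_inj /addIr /perm_inj.
  by move: eX1; rewrite !inE => /andP [ey eX]; apply: qf_inj.
have idy : injective (fun v => phi v - g r0) by move=> u v /addIr /perm_inj.
(* The increments of phi o qf, with a minus sign, become the labels of the other coordinates; the
   constant goes to y. *)
exists (fun i => if i == y then perm idy else perm (ide i)) => z az pz.
rewrite (bigD1 y) //= eqxx permE -(qf_eq az pz).
pose z1 := upd z y (r0 y).
have az1 : agree X1 r0 z1.
  move=> i; rewrite !inE negb_and negbK ffunE; case: eqP => [-> //|_ /= iX]; exact: az.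
have gz : phi (qf z) = g z1 by rewrite /g /z1 qf_updy.
rewrite gz add // [g r0 + _]addrC addrK.
set S := \sum_(i in X | _) _.
have -> : S = \sum_(i in X1) - (g (upd r0 i (z1 i)) - g r0).
  rewrite /S; apply: eq_big => [i|i /andP [iX iy]]; first by rewrite !inE andbC.
  by rewrite (negbTE iy) permE !inE iy iX /z1 upd_other.
by rewrite sumrN subrr.
Qed.
End Glue.

(** * Five free coordinates *)

Definition cycle_ok (th g ka : nat) : bool := all (fun e => all (fun x => all (fun y =>
  (papp th y != add4 (papp th x) (papp ka e)) || (y == papp (nth 0 (nth [::] cycle_powers g) e) x)) (iota 0
    4)) (iota 0 4)) (iota 0 4).

Lemma cycle_all : all (fun th => has (fun g => has (fun ka =>
  cycle_ok th g ka) (iota 0 6)) (iota 0 3)) (iota 0 24).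
Proof. by vm_compute. Qed.

(* Up to the choice of a generator, a conjugate of x -> x + 1 is one of three 4-cycles. *)
Lemma conj_shift (th : 'S_4) : exists g (ka : 'S_4), [/\ (g < 3)%N, ka 0 = 0 &
  forall e x y : 'I_4, th y = th x + ka e -> y = papp (nth 0%N (nth [::] cycle_powers g) e) x :> nat].
Proof.
have [t ht tE] := pp_surj (@perm_inj _ th).
have := allP cycle_all t; rewrite mem_iota => /(_ ht) /hasP [g]; rewrite mem_iota => hg /hasP [k];
  rewrite mem_iota => hk ok.
have hk24 : (k < 24)%N by apply: leq_trans hk _.
have [ka kaE] := papp_perm hk24; exists g, ka; split=> //.
  have /allP h : all (fun k => papp k 0 == 0%N) (iota 0 6) by [].
  by apply: ord_inj; rewrite -kaE; apply/eqP/h; rewrite mem_iota.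
move=> e x y h; have thE (z : 'I_4) : papp t z = th z by rewrite -tE pp_val.
have /allP := allP ok e ltac:(by rewrite mem_iota ltn_ord) =>
  /(_ x ltac:(by rewrite mem_iota ltn_ord)) /allP /(_ y ltac:(by rewrite mem_iota ltn_ord)).
by rewrite !thE kaE add4E h eqxx /= => /eqP.
Qed.

Lemma base3 u v : (u < 3)%N -> (v < 3)%N ->
  [/\ 3 * u + v < 9, (3 * u + v) %/ 3 = u & (3 * u + v) %% 3 = v]%N.
Proof. by move=> hu hv; split; lia. Qed.

Section Five.
Variables (R : realType) (d : nat) (A : dmatrix R d 4).
Hypothesis pA : polystochastic A.
Variables (X : {set 'I_d}) (r0 : idx d 4) (zX : zero A X r0).

Lemma mform_plane (E a b : 'I_d) r : uniq [:: E; a; b] -> mform A [set E; a; b] r ->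
  exists pe pa pb : 'S_4, forall z, agree [set E; a; b] r z -> 0 < A z -> pe (z E) + pa (z a) + pb (z b) = 0.
Proof.
rewrite /= !inE !negb_or => /and3P [/andP [Ea Eb] ab _] [psi h].
exists (psi E), (psi a), (psi b) => z az pz; rewrite -[RHS](h z az pz).
rewrite (bigD1 E) /=; last by rewrite !inE eqxx.
rewrite (bigD1 a) /=; last by rewrite !inE eqxx ?orbT /= eq_sym.
rewrite (bigD1 b) /=; last by rewrite !inE eqxx !orbT ![b == _]eq_sym Eb ab.
rewrite big1 ?addr0 ?addrA // => i; rewrite !inE.
by case: (i == E); case: (i == a); case: (i == b).
Qed.

(** In the labels [al] and [be] the slice at [r1] is the identity, so the label map of b conjugates
    the other slices to shifts: they are the powers of one 4-cycle, and the choice of its generator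
    goes into [fe]. *)
Lemma plane_gens (E a b : 'I_d) (al be : 'S_4) r1 : uniq [:: E; a; b] -> mform A [set E; a; b] r1 ->
  (forall x, 0 < A (upd (upd r1 a (al x)) b (be x))) ->
  exists g (fe : 'S_4), [/\ (g < 3)%N, fe 0 = r1 E & forall e x y : 'I_4,
    0 < A (upd (upd (upd r1 E (fe e)) a (al x)) b (be y)) ->
      y = papp (nth 0%N (nth [::] cycle_powers g) e) x :> nat].
Proof.
move=> un mf diag; have [pe [pa [pb h]]] := mform_plane un mf.
have [g [ka [hg ka0 hka]]] := conj_shift (be * perm_opp pb)%g.
have un' := un; move: un'; rewrite /= !inE !negb_or => /and3P [/andP [Ea Eb] ab _].
have pt v x y : 0 < A (upd (upd (upd r1 E v) a (al x)) b (be y)) -> pe v + pa (al x) + pb (be y) = 0.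
  move=> pz; have az : agree [set E; a; b] r1 (upd (upd (upd r1 E v) a (al x)) b (be y)).
    by do 3!(apply: agree_upd; first by rewrite !inE eqxx ?orbT).
  have := h _ az pz; rewrite upd_same (upd_other _ _ ab) upd_same (upd_other _ _ Eb) (upd_other _ _ Ea)
    upd_same //.
have pae x : pa (al x) = - pb (be x) - pe (r1 E).
  have := pt (r1 E) x x; rewrite upd_id => /(_ (diag x)) e; apply: (addrI (pe (r1 E))).
  by apply: (addIr (pb (be x))); rewrite e; ring.
pose ife e := (pe^-1)%g (pe (r1 E) + ka e).
have ifi : injective ife by move=> u v /perm_inj /addrI /perm_inj.
exists g, (perm ifi); split=> //; first by rewrite permE /ife ka0 addr0 permK.
move=> e x y /pt; rewrite permE /ife permKV pae => e1; apply: hka; rewrite !permM !permE /=.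
apply: (addIr (pb (be y))); rewrite addNr -e1; ring.
Qed.

(** The block in L, a, b at [r0] is labelled so that it reads y = x + l, which makes the slice at
    [r1] the identity. The directions E and K through [r1] then have one of three 4-cycles each,
    numbered 3 gK + gE for the search. *)
Lemma mform_card5 : #|X| = 5%N ->
  (forall a b z, a \in X -> b \in X -> a != b -> agree X r0 z -> mform A (X :\: [set a;
    b]) z) -> mform A X r0.
Proof.
move=> X5 Hm; have : size (enum X) = 5%N by rewrite -cardE.
case eX : (enum X) => [|K [|E [|L [|a [|b [|]]]]]] // _.
have unX : uniq [:: K; E; L; a; b] by rewrite -eX enum_uniq.
have inX i : (i \in X) = (i \in [:: K; E; L; a; b]) by rewrite -eX mem_enum.
have := unX; rewrite /= !inE !negb_or => /and5P [/and4P [KE KL Ka Kb] /and3P [EL Ea Eb] /andP [La Lb] ab _].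
have [EK LK aK bK] : [/\ E != K, L != K, a != K & b != K] by rewrite ![_ == K]eq_sym.
have [LE aE bE] : [/\ L != E, a != E & b != E] by rewrite ![_ == E]eq_sym.
have [aL bL] : a != L /\ b != L by rewrite ![_ == L]eq_sym.
have ba : b != a by rewrite eq_sym.
have [KX EX LX aX bX] : [/\ K \in X, E \in X, L \in X, a \in X & b \in X] by rewrite !inX !inE !eqxx !orbT.
have setD u v : X :\: [set u; v] = [set i in [:: K; E; L; a; b] | (i != u) && (i != v)].
  by apply/setP => i; rewrite in_setD in_set2 in_set inX negb_or andbC.
have sKE : X :\: [set K; E] = [set L; a; b].
  apply/setP => i; rewrite setD !inE.
  case: (eqVneq i K) => [->|_] /=; first by rewrite !(negbTE KL, negbTE Ka, negbTE Kb).
  by case: (eqVneq i E) => [->|_] /=; rewrite ?(negbTE EL, negbTE Ea, negbTE Eb) // andbT orbA.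
have sKL : X :\: [set K; L] = [set E; a; b].
  apply/setP => i; rewrite setD !inE.
  case: (eqVneq i K) => [->|_] /=; first by rewrite !(negbTE KE, negbTE Ka, negbTE Kb).
  by case: (eqVneq i L) => [->|_] /=; rewrite ?(negbTE LE, negbTE La, negbTE Lb) ?andbF // andbT orbA.
have sEL : X :\: [set E; L] = [set K; a; b].
  apply/setP => i; rewrite setD !inE.
  case: (eqVneq i E) => [->|_] /=; first by rewrite !(negbTE EK, negbTE Ea, negbTE Eb) andbF.
  by case: (eqVneq i L) => [->|_] /=; rewrite ?(negbTE LK, negbTE La, negbTE Lb) ?andbF // andbT orbA.
have ag0 : agree X r0 r0 by [].
have unL : uniq [:: L; a; b] by rewrite /= !inE !negb_or La Lb ab.
have unE : uniq [:: E; a; b] by rewrite /= !inE !negb_or Ea Eb ab.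
have unK : uniq [:: K; a; b] by rewrite /= !inE !negb_or Ka Kb ab.
have mL : mform A [set L; a; b] r0 by rewrite -sKE; apply: Hm.
have [pl [pa [pb hL]]] := mform_plane unL mL.
have iop (g : 'S_4) : injective (fun x => (g^-1)%g (- x)) by move=> u v /perm_inj /oppr_inj.
pose fl := perm (iop pl); pose al := perm (iop pa); pose be : 'S_4 := (pb^-1)%g.
have hL0 l x y : 0 < A (upd (upd (upd r0 L (fl l)) a (al x)) b (be y)) -> y = x + l.
  move=> pz; have az : agree [set L; a; b] r0 (upd (upd (upd r0 L (fl l)) a (al x)) b (be y)).
    by do 3!(apply: agree_upd; first by rewrite !inE eqxx ?orbT).
  have := hL _ az pz; rewrite upd_same (upd_other _ _ ab) upd_same (upd_other _ _ Lb) (upd_other _ _ La)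
    upd_same.
  rewrite [fl l]permE [al x]permE /be !permKV => e.
  by apply: (addrI (- l - x)); rewrite e; ring.
pose r1 := upd r0 L (fl 0).
have ag1 : agree X r0 r1 by apply: agree_upd.
have diag x : 0 < A (upd (upd r1 a (al x)) b (be x)).
  have [k pk] := line_pos pA (upd r1 a (al x)) b.
  have := hL0 0 x ((be^-1)%g k); rewrite permKV => /(_ pk); rewrite addr0 => e.
  by rewrite -{2}e permKV.
have [gE [fe [hgE fe0 hE]]] := plane_gens unE (ltac:(by rewrite -sKL; apply: Hm) : mform A [set E; a;
  b] r1) diag.
have [gK [fk [hgK fk0 hK]]] := plane_gens unK (ltac:(by rewrite -sEL; apply: Hm) : mform A [set K; a;
  b] r1) diag.
rewrite /r1 upd_other // in fe0; rewrite /r1 upd_other // in fk0.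
have un4 : uniq [:: E; L; a; b] by move: unX => /= /andP [].
pose p k := upd r0 K (fk k).
have p0 : p 0 = r0 by rewrite /p fk0 upd_id.
have pX i : i \in X -> i \notin [:: E; L; a; b] -> injective (fun k => p k i).
  rewrite inX inE => /predU1P [-> _ u v|-> //]; by rewrite /p !upd_same => /perm_inj.
have poff k i : i \notin X -> p k i = r0 i by move=> iX; rewrite /p upd_other //; apply: (memPnC iX).
have KN : K \notin [:: E; L; a; b] by move: unX => /= /andP [].
pose ix := (3 * gK + gE)%N.
have [hix d1 d2] := base3 hgK hgE; rewrite -/ix in hix d1 d2.
have glt g j : (g < 3)%N -> (j < 4)%N -> (nth 0 (nth [::] cycle_powers g) j < 24)%N.
  by case: g => [|[|[|]]] // _; case: j => [|[|[|[|]]]].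
have := @search3k _ _ A pA X r0 zX p E L a b fe fl al be EX LX aX bX un4 (@perm_inj _ fe) (@perm_inj _ fl)
  (@perm_inj _ al) (@perm_inj _ be) pX poff
   r0 K fk [:: rel_exact5] (init_exact5 ix) (nth [::] script_exact5 ix) KN (@perm_inj _ fk) (fun=> erefl).
have single (k e l : 'I_4) t0 : (t0 < 24)%N -> (forall x y : 'I_4, 0 < B3 A p E L a b fe fl al be k e l x y ->
  y = papp t0 x :> nat) ->
   forall t, pos 3 (W3 A p E L a b fe fl al be) (16 * k + 4 * e + l)%N t -> t \in [:: t0].
  move=> ht0 h t pt; rewrite inE; apply/eqP; have ht := pos_dom pt; apply: papp_inj => // x.
  case/and3P: pt => _ _ /forallP /(_ x); rewrite W3E => /h <-; by rewrite pp_val.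
case.
- move=> e l t; rewrite /init_exact5 d1 d2 !mem_cat => /or3P [] /mapP [j]; rewrite mem_iota => hj [-> -> ->];
  split=> //.
  + have -> : (16 * j = 16 * (Ordinal hj : 'I_4) + 4 * (0%R : 'I_4) + (0%R : 'I_4))%N by rewrite /= !addn0.
    apply: single; first exact: glt.
    move=> x y; rewrite /B3 fe0 => pz; apply: (hK (Ordinal hj)); move: pz.
    by rewrite /r1 /p (updC _ _ _ KE) upd_id (updC _ _ _ KL).
  + have -> : (4 * j = 16 * (0%R : 'I_4) + 4 * (Ordinal hj : 'I_4) + (0%R : 'I_4))%N by rewrite /= addn0.
    apply: single; first exact: glt.
    move=> x y; rewrite /B3 p0 => pz; apply: (hE (Ordinal hj)); move: pz.
    by rewrite /r1 (updC _ _ _ EL).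
  + have -> : (j = 16 * (0%R : 'I_4) + 4 * (0%R : 'I_4) + (Ordinal hj : 'I_4))%N by [].
    apply: single; first exact: (glt 0%N).
    move=> x y; rewrite /B3 p0 fe0 upd_id => /hL0 ->.
    by move: x; move: hj; case: j => [|[|[|[|//]]]] hj; apply: I4_ind.
- by have /allP := search_exact5; apply; rewrite mem_iota.
case=> // _ h.
pose psi i : 'S_4 := if i == K then fk^-1%g else if i == E then fe^-1%g else if i == L then fl^-1%g else if i
  == a then al^-1%g else perm_opp (be^-1)%g.
exists psi => z az pz.
have zE : z = upd (upd (upd (upd (p (fk^-1%g (z K))) E (fe (fe^-1%g (z E)))) L (fl (fl^-1%g (z L)))) a (al
  (al^-1%g (z a)))) b (be (be^-1%g (z b))).
  rewrite /p !permKV; apply/ffunP => j; rewrite !ffunE.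
  case: eqP => [-> //|/eqP jb]; case: eqP => [-> //|/eqP ja]; case: eqP => [-> //|/eqP jL];
    case: eqP => [-> //|/eqP jE]; case: eqP => [-> //|/eqP jK].
  by rewrite az // inX !inE !negb_or jK jE jL ja jb.
have := h (fk^-1%g (z K)) (fe^-1%g (z E)) (fl^-1%g (z L)) (al^-1%g (z a)) (be^-1%g (z b)).
rewrite /B3 -zE => /(_ pz) /=; rewrite /rel_exact5;
  have [-> -> ->] := digits3 (fk^-1%g (z K)) (fe^-1%g (z E)) (fl^-1%g (z L)).
move=> /eqP e.
rewrite (bigD1 K) //= (bigD1 E) ?EX //= (bigD1 L) /=; last by rewrite LX LK LE.
rewrite (bigD1 a) /=; last by rewrite aX aK aE aL.
rewrite (bigD1 b) /=; last by rewrite bX bK bE bL ba.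
rewrite big1 ?addr0 => [|i]; last first.
  by rewrite inX !inE; case: (i == K); case: (i == E); case: (i == L); case: (i == a); case: (i == b).
rewrite /psi !eqxx (negbTE EK) (negbTE LK) (negbTE LE) (negbTE aK) (negbTE aE) (negbTE aL) (negbTE bK)
  (negbTE bE) (negbTE bL) (negbTE ba) [perm_opp _ _]permE /=.
move: e; move: (fk^-1%g (z K)) (fe^-1%g (z E)) (fl^-1%g (z L)) (al^-1%g (z a)) (be^-1%g (z b)) =>
  k1 e1 l1 x1 y1 e.
have -> : y1 = k1 + e1 + l1 + x1.
  by apply: ord_inj; rewrite e; move: k1 e1 l1 x1 {e}; do 4!apply: I4_ind.
by ring.
Qed.
End Five.

(** * Conclusion *)

Section Induction.
Variables (R : realType) (d : nat) (A : dmatrix R d 4).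
Hypothesis pA : polystochastic A.

Lemma zero_card2 (X : {set 'I_d}) r : #|X| = 2%N -> ~ zero A X r.
Proof.
move=> /eqP /cards2P [a [b [ab ->]]] zX.
have idi : injective (@id 'I_4) by [].
have [f pf] := ds_perm (slice_ds pA (fun=> r) ab idi idi 0).
apply: (zX (fun k => upd (upd r a k) b (f k))) => [|k]; last exact: pf.
split=> [i|k i]; rewrite !inE ?negb_or.
  move=> /orP [] /eqP -> u v; last by rewrite !upd_same => /perm_inj.
  by rewrite !(upd_other _ _ ab) !upd_same.
by move=> /andP [ia ib]; rewrite !upd_other.
Qed.

Lemma card_setD2 (X : {set 'I_d}) a b : a \in X -> b \in X -> a != b -> #|X| = (#|X :\: [set a; b]| + 2)%N.
Proof.
move=> aX bX ab; rewrite -(cardsID [set a; b] X) addnC; congr (_ + _)%N.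
by rewrite (setIidPr _) ?cards2 ?ab // subUset !sub1set aX.
Qed.

Lemma zero_supptype (X : {set 'I_d}) r : (2 <= #|X|)%N -> zero A X r -> odd #|X| /\ supptype A X r.
Proof.
have [n] := ubnP #|X|; elim: n X r => // n IH X r ltn X2 zX.
have [X2'|X2'] := eqVneq #|X| 2%N; first by case: (zero_card2 X2' zX).
have [X3|X3] := eqVneq #|X| 3%N; first by rewrite X3; split=> //; apply: supptype_card3.
have X4 : (4 <= #|X|)%N by rewrite 2!ltn_neqAle ![_ == #|X|]eq_sym X2' X3.
case: (boolp.EM (exists a b z p, [/\ a \in X, b \in X, a != b, agree X r z & ppath (X :\: [set a;
  b]) z p /\ forall k, 0 < A (p k)])).
  move=> [a [b [z [p [aX bX ab az [[p1 p2] pp]]]]]].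
  have aD : a \notin X :\: [set a; b] by rewrite !inE eqxx.
  have bD : b \notin X :\: [set a; b] by rewrite !inE eqxx orbT.
  apply: (zero_of_positive_slice pA zX aX bX ab X4 (p := p)) => //.
  - by move=> i iX ia ib; apply: p1; rewrite !inE negb_or ia ib.
  - by move=> k i iX; rewrite p2 ?az // inE (negbTE iX) andbF.
  - by move=> k; rewrite !p2.
  - by move=> k; rewrite !p2.
move=> no.
have zs a b z : a \in X -> b \in X -> a != b -> agree X r z -> zero A (X :\: [set a; b]) z.
  by move=> aX bX ab az p pp pos; apply: no; exists a, b, z, p.
have ss a b z : a \in X -> b \in X -> a != b -> agree X r z -> odd #|X :\: [set a;
  b]| /\ supptype A (X :\: [set a; b]) z.
  move=> aX bX ab az; have cX := card_setD2 aX bX ab; apply: IH; [| |exact: zs].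
    by rewrite cX addn2 ltnS in ltn; exact: ltnW ltn.
  by move: X4; rewrite cX addn2.
have oX : odd #|X|.
  have /card_gt1P [a [b [aX bX ab]]] : (1 < #|X|)%N by apply: leq_trans X4.
  have [o _] := ss a b r aX bX ab (fun _ _ => erefl).
  by rewrite (card_setD2 aX bX ab) oddD o.
have X5 : (5 <= #|X|)%N by rewrite ltn_neqAle X4 andbT; apply: contraTneq oX => <-.
have nf : forall z, agree X r z -> ~~ fractional A z.
  apply: (exact_of_slices pA X5) => a b z aX bX ab az; exact: (ss _ _ _ aX bX ab az).2.
have Hm a b z : a \in X -> b \in X -> a != b -> agree X r z -> mform A (X :\: [set a; b]) z.
  move=> aX bX ab az; have [_ st] := ss a b z aX bX ab az.
  apply: (mform_of_supptype pA) => //; first by move: X4; rewrite (card_setD2 aX bX ab) addn2.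
  move=> w aw; apply: nf => i iX; rewrite aw ?az // inE (negbTE iX) andbF //.
split=> //; apply: mform_supptype; first by rewrite -card_gt0; apply: leq_trans X2.
have [X5'|X5'] := eqVneq #|X| 5%N; first exact: mform_card5.
have X7 : (7 <= #|X|)%N.
  rewrite ltn_neqAle; apply/andP; split; first by apply: contraTneq oX => <-.
  by rewrite ltn_neqAle eq_sym X5' X5.
have [y yX] : exists y, y \in X by apply/set0Pn; rewrite -card_gt0; apply: leq_trans X2.
have /boolp.choice [qf hqf] : forall z : idx d 4, exists k, 0 < A (upd z y k) by move=> z; apply: line_pos.
exact: (mform_glue pA nf X7 Hm yX hqf).
Qed.

Lemma zero_of_per r : (0 < d)%N -> per A = 0 -> zero A [set: 'I_d] r.
Proof.
move=> d0 per0 p [p1 _] pos; have inj i : injective (fun k => p k i) by apply: p1; rewrite inE.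
pose i0 := Ordinal d0; have ip : injective p by move=> k k' e; apply: (inj i0); rewrite /= e.
pose D := p @: 'I_4.
have dD : diagonal D.
  rewrite /diagonal card_imset // card_ord eqxx /=.
  apply/forall_inP => x /imsetP [k _ ->]; apply/forall_inP => y /imsetP [k' _ ->].
  apply/implyP => ne; apply/forallP => j; apply: contraNneq ne => /inj ->; exact: eqxx.
have ge0 (q : {set idx d 4}) : 0 <= \prod_(a in q) A a by apply: prodr_ge0 => a _; apply: pA.1.
have : 0 < per A.
  rewrite /per (bigD1 D) //=; apply: ltr_wpDr; first by apply: sumr_ge0.
  by apply: prodr_gt0 => a /imsetP [k _ ->].
by rewrite per0 ltxx.
Qed.
End Induction.

(** * Equivalence with the model matrices *)

Section Equivalence.
Variables (R : realType) (d : nat).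
Implicit Types A B : dmatrix R d 4.

Lemma equivalent_relabel A (g : 'I_d -> 'S_4) : equivalent A (fun a => A [ffun i => g i (a i)]).
Proof.
pose B (s : seq 'I_d) : dmatrix R d 4 := fun a => A [ffun i => if i \in s then g i (a i) else a i].
suff H s : uniq s -> equivalent A (B s).
  have := H (enum 'I_d) (enum_uniq _); congr (equivalent A _); apply: boolp.funext => a.
  by congr A; apply/ffunP => i; rewrite !ffunE mem_enum inE.
elim: s => [|i s IH] /= => [_|/andP [is_ /IH h]].
  have -> : B [::] = A by apply: boolp.funext => a; congr A; apply/ffunP => i; rewrite ffunE.
  exact: rt_refl.
apply: (rt_trans _ _ _ _ _ h); apply: rt_step; right; exists i, (g i) => a.
congr A; apply/ffunP => j; rewrite !ffunE inE.
by case: (eqVneq j i) => [->|//]; rewrite (negbTE is_).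
Qed.

Lemma sum_mod4 (I : finType) (P : pred I) (f : I -> 'I_4) : (\sum_(i | P i) f i : 'I_4) = ((\sum_(i
  | P i) f i) %% 4)%N :> nat.
Proof.
apply: (big_rec2 (fun (x : nat) (y : 'I_4) => val y = x %% 4)%N) => // i y x _ e.
by rewrite /= e modnDmr.
Qed.

Lemma pi01E (x : 'I_4) : pi01 x = sw01 x :> nat.
Proof. by move: x; apply: I4_ind; rewrite /sw01 permE. Qed.

Lemma MmatE (a : idx d 4) : @Mmat R d 4 a = (\sum_i a i == 0 :> 'I_4)%:R.
Proof. by rewrite /Mmat -sum_mod4 -[0%N]/(val (0 : 'I_4)) val_eqE; case: eqP. Qed.

Lemma MpiE (l : 'I_d) (a : idx d 4) : val l = d.-1 ->
  @Mpi R d 4 a = (sw01 (a l) + \sum_(i | i != l) a i == 0 :> 'I_4)%:R.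
Proof.
move=> le; rewrite /Mpi.
have -> : (\sum_(j < d) (if val j == d.-1 then pi01 (a j) else a j) = \sum_(j < d) (if j == l then sw01 (a j)
  else a j : 'I_4))%N.
  by apply: eq_bigr => j _; rewrite -le val_eqE; case: (j == l); rewrite ?pi01E.
rewrite -sum_mod4 -[0%N]/(val (0 : 'I_4)) val_eqE (bigD1 l) //= eqxx.
have -> : \sum_(i | i != l) (if i == l then sw01 (a i) else a i) = \sum_(i | i != l) a i.
  by apply: eq_bigr => i /negbTE ->.
by case: eqP.
Qed.

(** The reflection v -> 1 - v preserves {0, 1} and so commutes with pi, which v -> -v does not;
    hence the label 1 - y below. *)
Lemma sw01_opp (v : 'I_4) : sw01 (1 - v) = 1 - sw01 v.
Proof. by move: v; apply: I4_ind; rewrite /sw01 !permE; apply: val_inj. Qed.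

(** With label 1 - y on s, and 1 subtracted on L in compensation, t = y and t = pi y become the
    equations of [Mmat] and [Mpi]; [tperm s la] moves s to the last place, where [Mpi] has its
    transposition. [C] is given by its values so that weight 1 covers [Mmat] too. *)
Lemma equivalent_Lmat A C (s : 'I_d) (phi : 'I_d -> 'S_4) (l : R) : (2 <= d)%N ->
  (forall a, A a = l * (tsum setT s phi a == phi s (a s))%:R + (1 - l) * (tsum setT s phi a == sw01 (phi s (a
    s)))%:R) ->
  (forall a, C a = @Lmat R d 4 l a) -> equivalent A C.
Proof.
move=> d2 AE CE.
have [L _ Ls] : exists2 L, L \in [set: 'I_d] & L != s by apply: other_coord; rewrite cardsT card_ord.
have dp : (d.-1 < d)%N by rewrite prednK //; apply: ltnW.
pose la := Ordinal dp.
have is_ : injective (fun v => 1 - phi s v) by move=> u v /addrI /oppr_inj /perm_inj.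
have iL : injective (fun v => phi L v - 1) by move=> u v /addIr /perm_inj.
pose g i := if i == s then perm is_ else if i == L then perm iL else phi i.
apply: rt_trans (equivalent_relabel A (fun i => (g i)^-1%g)) _.
apply: rt_step; left; exists (tperm s la) => a; rewrite CE /Lmat AE.
set b := [ffun j => a (tperm s la j)]; set z := [ffun i => _].
have zs : phi s (z s) = 1 - b s.
  have : g s (z s) = b s by rewrite ffunE permKV.
  by rewrite /g eqxx permE => <-; ring.
have sumE : \sum_(i | i != la) a i = \sum_(i | i != s) b i.
  rewrite (reindex_inj (@perm_inj _ (tperm s la))) /=; apply: eq_big => [i|i _]; last by rewrite ffunE.
  by rewrite (can2_eq (tpermK s la) (tpermK s la)) tpermR.
have al : a la = b s by rewrite ffunE tpermL.
have tz : tsum setT s phi z = 1 + \sum_(i | i != s) b i.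
  rewrite /tsum (eq_bigl (fun i => i != s)) => [|i]; last by rewrite inE.
  rewrite (bigD1 L) //= [in RHS](bigD1 L) //= addrA; congr (_ + _).
    have : g L (z L) = b L by rewrite ffunE permKV.
    by rewrite /g (negbTE Ls) eqxx permE => <-; ring.
  apply: eq_bigr => i /andP [/negbTE is1 /negbTE iL1].
  have : g i (z i) = b i by rewrite ffunE permKV.
  by rewrite /g is1 iL1.
rewrite zs tz MmatE (MpiE a (erefl : val la = d.-1)) (bigD1 la) //= sumE al sw01_opp.
set S := \sum_(i | _) _.
by congr (_ * (nat_of_bool _)%:R + _ * (nat_of_bool _)%:R); rewrite -[in RHS]subr_eq0; congr (_ == _); ring.
Qed.
End Equivalence.

Theorem mainTheorem1 (R : realType) (d : nat) (hd : (2 <= d)%N)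
    (A : dmatrix R d 4) :
  polystochastic A -> per A = 0 ->
  odd d /\
  (equivalent A (@Mmat R d 4) \/
   exists l : R, 0 < l < 1 /\ equivalent A (@Lmat R d 4 l)).
Proof.
move=> pA per0; pose r : idx d 4 := [ffun=> 0].
have cT : #|[set: 'I_d]| = d by rewrite cardsT card_ord.
have [|od [s [phi [sT supp]]]] := zero_supptype pA _ (@zero_of_per _ _ _ pA r (ltnW hd) per0);
  first by rewrite cT.
rewrite cT in od; split=> //.
have [L LT Ls] : exists2 L, L \in [set: 'I_d] & L != s by apply: other_coord; rewrite cT.
have [l /andP [l0 l1] lE] := lambda_form pA sT supp LT Ls.
have agT a : agree [set: 'I_d] r a by move=> i; rewrite inE.
(* At weight 0 only t = pi y remains; absorbing pi into the label of s turns this into weight 1. *)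
have [l00|ln0] := eqVneq l 0.
  left; pose psi i := if i == s then (phi s * tperm 0%R 1%R)%g else phi i.
  have tE a : tsum setT s psi a = tsum setT s phi a.
    by apply: eq_bigr => i /andP [_ /negbTE is_]; rewrite /psi is_.
  apply: (@equivalent_Lmat _ _ A _ s psi 1 hd) => a; last by rewrite /Lmat subrr mul0r addr0 mul1r.
  rewrite lE // l00 tE subrr !mul0r addr0 add0r subr0 !mul1r /psi eqxx permM //.
have [l11|ln1] := eqVneq l 1.
  left; apply: (@equivalent_Lmat _ _ A _ s phi 1 hd) => a; first by rewrite lE // l11.
  by rewrite /Lmat subrr mul0r addr0 mul1r.
right; exists l; split; first by rewrite !lt_neqAle l0 l1 eq_sym ln0 ln1.
by apply: (@equivalent_Lmat _ _ A _ s phi l hd) => // a; apply: lE.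
Qed.
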